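(* (Anti-symmetric Clark–Ocone formula.) Let $F\in\mathrm{Dom}(\mathcal{D})$. Then $$F=m(F)+\int_0^1 d\Psi_t\; m(\mathcal{D}_tF\,|\,\mathcal{C}_t).$$
   Context: $L^2(\mathbb{R}_+)$ is the complex $L^2$ space for Lebesgue measure (inner products linear in the second variable), with complex conjugation $J$. For $h\in L^2(\mathbb{R}_+^n)$ its anti-symmetrization is $\hat h(t_1,\dots,t_n)=\frac1{n!}\sum_{\sigma\in S_n}\mathrm{sgn}(\sigma)h(t_{\sigma(1)},\dots,t_{\sigma(n)})$. $\Lambda_n$ is the space of anti-symmetric functions in $L^2(\mathbb{R}_+^n)$ with inner product $\langle f,g\rangle_{\Lambda_n}=n!\int\overline{f}g\,d\mathbf{x}$, and $\Lambda_0=\mathbb{C}$. $\Gamma_a=\bigoplus_{n\ge0}\Lambda_n$ is the anti-symmetric Fock space (Hilbert direct sum) with vacuum vector $\Omega=1\in\Lambda_0$. For $z\in L^2(\mathbb{R}_+)$, $b^*(z)$ is the bounded operator with $b^*(z)w=\widehat{z\otimes w}$ for $w\in\Lambda_n$, $b(z)$ is its adjoint, and $\Psi(z)=b^*(z)+b(Jz)$. $\mathcal{C}$ is the von Neumann algebra generated by $\{\Psi(z)\}$, and $m(u)=\langle\Omega,u\Omega\rangle$ is a faithful normal tracial state on it; $L^2(\mathcal{C})$ is the completion of $\mathcal{C}$ for the inner product $m(u^*v)$ (a $\mathcal{C}$-bimodule), and $m$ extends continuously to $L^2(\mathcal{C})$. The map $u\mapsto u\Omega$ extends to a unitary $L^2(\mathcal{C})\to\Gamma_a$,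 and for $f\in\Lambda_n$, $J_n(f)\in L^2(\mathcal{C})$ denotes the element mapped to $f$ by this unitary; $J_{-1}(\cdot)=0$. On finite sums of $J_n(v_n)$, $v_n\in\Lambda_n$, $\mathcal{D}$ is defined by linearity and $\mathcal{D}_t(J_n(v_n))=nJ_{n-1}(v_n(t,\cdot))$, as an operator into $L^2(\mathbb{R}_+)\otimes L^2(\mathcal{C})\cong L^2(\mathbb{R}_+;L^2(\mathcal{C}))$; it is closable, and $\mathcal{D}$ also denotes its closure, with domain $\mathrm{Dom}(\mathcal{D})\subset L^2(\mathcal{C})$. $\mathcal{C}_t$ is the von Neumann subalgebra generated by $\{\Psi(u):u\in L^2(\mathbb{R}_+),\ \mathrm{supp}(u)\subset[0,t]\}$, $L^2(\mathcal{C}_t)$ is the closure of $\mathcal{C}_t$ in $L^2(\mathcal{C})$, $m(\cdot|\mathcal{C}_t)$ is the $m$-preserving conditional expectation onto $\mathcal{C}_t$ extended to $L^2(\mathcal{C})$, and $\Psi_t=\Psi(\mathbf{1}_{[0,t]})$. Let $\mathfrak{H}[0,1]$ be the set of adapted $u\in L^2([0,1];L^2(\mathcal{C}))$, i.e. $u_s\in L^2(\mathcal{C}_s)$ for a.e. $s$. For a simple adapted process $h=\sum_{k=1}^n h_{k-1}\mathbf{1}_{[t_{k-1},t_k)}$ with $0\le t_0\le\dots\le t_n\le1$ and $h_k\in L^2(\mathcal{C}_{t_k})$, the (left) Itô–Clifford integral is $\int_0^1 d\Psi_s\,h(s)=\sum_{k=1}^n(\Psi_{t_k}-\Psi_{t_{k-1}})h_{k-1}$.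 Simple adapted processes are dense in $\mathfrak{H}[0,1]$, the integral is an isometry into $L^2(\mathcal{C})$ on them, and the Itô–Clifford integral on $\mathfrak{H}[0,1]$ is its continuous extension.
   Formalization: The formal theorem also assumes F ∈ L²(C_1): since the integral runs only over [0,1], the formula fails for F = Ψ(1_[1,2]), where both terms on the right vanish, and it can hold only for F in L²(C_1). *)

(* Defs.v *)
From HB Require Import structures.
From mathcomp Require Import all_boot all_order all_algebra perm.
From mathcomp Require Import all_classical all_reals all_analysis.
From mathcomp Require Import measurable_realfun complex ring.

Set Implicit Arguments.
Unset Strict Implicit.
Unset Printing Implicit Defensive.

Import Order.TTheory GRing.Theory Num.Theory.
Import numFieldNormedType.Exports.

Local Open Scope classical_set_scope.
Local Open Scope ring_scope.
Local Open Scope complex_scope.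
Local Open Scope quotient_scope.

Section restricted.
Variables (R : realType) (D : set (measurableTypeR R)) (mD : measurable D).

Definition lebesgue_on : set (measurableTypeR R) -> \bar R :=
  mrestr lebesgue_measure mD.

HB.instance Definition _ := Measure.on lebesgue_on.

Let lebesgue_on_sigma_finite : sigma_finite setT lebesgue_on.
Proof.
have [F FT Ffin] := @sigma_finiteT _ _ _ (@lebesgue_measure R).
exists F => // i; have [mF Foo] := Ffin i; split => //.
rewrite (le_lt_trans _ Foo)// /lebesgue_on /mrestr.
by rewrite le_measure ?inE//; exact: measurableI.
Qed.

HB.instance Definition _ :=
  Measure_isSigmaFinite.Build _ _ _ lebesgue_on lebesgue_on_sigma_finite.

End restricted.

(* Functions on R_+ are functions on R integrated against this measure, which
   ignores the negative half-line. *)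
Definition lebRp (R : realType) :
    {sigma_finite_measure set (measurableTypeR R) -> \bar R} :=
  lebesgue_on (@measurable_itv R `[0, +oo[%R).

Definition leb01 (R : realType) :
    {sigma_finite_measure set (measurableTypeR R) -> \bar R} :=
  lebesgue_on (@measurable_itv R `[0, 1]%R).

(* MathComp-Analysis has binary product measures only; the n-fold product is
   transported to n.-tuple T one coordinate at a time. *)
Section cons_measure.
Context d (T : measurableType d) (R : realType) (n : nat).
Variables (m : {sigma_finite_measure set T -> \bar R})
  (mu : {sigma_finite_measure set (n.-tuple T) -> \bar R}).

Definition tcons (p : T * n.-tuple T) : n.+1.-tuple T := [tuple of p.1 :: p.2].

Definition cons_measure : set (n.+1.-tuple T) -> \bar R :=
  pushforward (m \x mu)%E tcons.

Let measurable_tcons : measurable_fun setT tcons.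
Proof. exact: measurable_cons. Qed.

Let pf : {measure set _ -> \bar R} :=
  measure_function_pushforward__canonical__measure_function_Measure
    (m \x mu)%E measurable_tcons.

Let cons_measure0 : cons_measure set0 = 0%E.
Proof. exact: (@measure0 _ _ _ pf). Qed.

Let cons_measure_ge0 A : (0 <= cons_measure A)%E.
Proof. exact: (@measure_ge0 _ _ _ pf). Qed.

Let cons_measure_sigma_additive : semi_sigma_additive cons_measure.
Proof. exact: (@measure_semi_sigma_additive _ _ _ pf). Qed.

HB.instance Definition _ := isMeasure.Build _ _ _ cons_measure
  cons_measure0 cons_measure_ge0 cons_measure_sigma_additive.

Let cons_measure_sigma_finite : sigma_finite setT cons_measure.
Proof.
have /sigma_finiteP[F [TF ndF Foo]] := sigma_finiteT m.
have /sigma_finiteP[G [TG ndG Goo]] := sigma_finiteT mu.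
have FGT : setT = \bigcup_i (F i `*` G i).
  rewrite -setXTT TF TG predeqE => -[x y]; split.
    move=> [/= [i _ Fx] [k _ Gy]]; exists (maxn i k) => //; split.
    - by move: x Fx; exact/subsetPset/ndF/leq_maxl.
    - by move: y Gy; exact/subsetPset/ndG/leq_maxr.
  by move=> [i _ []/= ? ?]; split; exists i.
pose g (t : n.+1.-tuple T) : T * n.-tuple T := (tnth t ord0, [tuple of behead t]).
have mg : measurable_fun setT g.
  apply/measurable_fun_pair; first exact: measurable_tnth.
  exact: measurable_behead.
exists (fun i => g @^-1` (F i `*` G i)).
  by rewrite -preimage_bigcup -FGT preimage_setT.
move=> i; have [mF Fioo] := Foo i; have [mG Gioo] := Goo i; split.
  by rewrite -[X in measurable X]setTI; apply: mg => //; exact: measurableX.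
rewrite /cons_measure /pushforward -comp_preimage.
suff -> : g \o tcons = id.
  by rewrite preimage_id product_measure1E// lte_mul_pinfty// ge0_fin_numE.
apply/funext => -[x t]; congr pair.
exact: val_inj.
Qed.

HB.instance Definition _ :=
  Measure_isSigmaFinite.Build _ _ _ cons_measure cons_measure_sigma_finite.

End cons_measure.

Section tuple_measure.
Context d (T : measurableType d) (R : realType).
Variable m : {sigma_finite_measure set T -> \bar R}.

Fixpoint tuple_measure (n : nat) :
    {sigma_finite_measure set (n.-tuple T) -> \bar R} :=
  match n with
  | 0 => \d_ [tuple]
  | n.+1 => cons_measure m (tuple_measure n)
  end.

End tuple_measure.

Section square_integrable.
Context d (T : measurableType d) (R : realType).
Variable mu : {measure set T -> \bar R}.

Definition abs2 (z : R[i]) : R := complex.Re z ^+ 2 + complex.Im z ^+ 2.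

Definition cmeasurable (f : T -> R[i]) : Prop :=
  measurable_fun setT (fun x => complex.Re (f x)) /\
  measurable_fun setT (fun x => complex.Im (f x)).

Definition L2norm2 (f : T -> R[i]) : \bar R := (\int[mu]_x (abs2 (f x))%:E)%E.

Definition L2fun (f : T -> R[i]) : Prop := cmeasurable f /\ (L2norm2 f < +oo)%E.

Definition cintegral (f : T -> R[i]) : R[i] :=
  Rintegral mu setT (fun x => complex.Re (f x)) +i*
  Rintegral mu setT (fun x => complex.Im (f x)).

Lemma abs2_ge0 z : 0 <= abs2 z.
Proof. by rewrite addr_ge0 ?sqr_ge0. Qed.

Lemma abs2ZD (a z w : R[i]) :
  abs2 (a * z + w) <= 2 * abs2 a * abs2 z + 2 * abs2 w.
Proof.
case: a z w => [a b] [x y] [u v]; rewrite /abs2 /=.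
rewrite -subr_ge0 (_ : _ - _ =
  (a * x - b * y - u) ^+ 2 + (a * y + b * x - v) ^+ 2); last first.
  by ring.
by rewrite addr_ge0 ?sqr_ge0.
Qed.

Lemma measurable_abs2 f : cmeasurable f ->
  measurable_fun setT (EFin \o (fun x => abs2 (f x))).
Proof.
move=> [mr mi]; apply/measurable_EFinP.
by apply: measurable_funD; exact: measurable_funX.
Qed.

Lemma L2norm2_ge0 f : (0 <= L2norm2 f)%E.
Proof. by apply: integral_ge0 => x _; rewrite lee_fin abs2_ge0. Qed.

Lemma cmeasurableZD (a : R[i]) f g : cmeasurable f -> cmeasurable g ->
  cmeasurable (fun x => a * f x + g x).
Proof.
case: a => a b [fr fi] [gr gi]; split.
  rewrite (_ : (fun _ => _) = (fun x => (a * complex.Re (f x)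
    - b * complex.Im (f x)) + complex.Re (g x))).
    apply: measurable_funD => //; apply: measurable_funB;
      exact: measurable_funM.
  by apply/funext => x; case: (f x) (g x) => ? ? [].
rewrite (_ : (fun _ => _) = (fun x => (a * complex.Im (f x)
    + b * complex.Re (f x)) + complex.Im (g x))).
  apply: measurable_funD => //; apply: measurable_funD;
    exact: measurable_funM.
by apply/funext => x; case: (f x) (g x) => ? ? [].
Qed.

Lemma L2norm2ZD (a : R[i]) f g : cmeasurable f -> cmeasurable g ->
  (L2norm2 (fun x => a * f x + g x)%R <=
   (2 * abs2 a)%:E * L2norm2 f + 2%:E * L2norm2 g)%E.
Proof.
move=> mf mg.
have c0 : 0 <= 2 * abs2 a by rewrite mulr_ge0// abs2_ge0.
have ge0E (c : R) h x : 0 <= c -> (0 <= c%:E * (abs2 (h x))%:E :> \bar R)%E.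
  by move=> ?; rewrite mule_ge0// lee_fin// abs2_ge0.
have mE (c : R) h : cmeasurable h ->
    measurable_fun setT (fun x => c%:E * (abs2 (h x))%:E)%E.
  by move=> mh; apply: measurable_funeM; exact: measurable_abs2.
have intE (c : R) h : 0 <= c -> cmeasurable h ->
    (c%:E * L2norm2 h = \int[mu]_x (c%:E * (abs2 (h x))%:E))%E.
  move=> ? mh; rewrite ge0_integralZl//; first exact: measurable_abs2.
  by move=> x _; rewrite lee_fin abs2_ge0.
rewrite !intE// -ge0_integralD//; last 4 first.
- by move=> x _; exact: ge0E.
- exact: mE.
- by move=> x _; exact: ge0E.
- exact: mE.
apply: ge0_le_integral => //.
- by move=> x _; rewrite lee_fin abs2_ge0.
- by apply: measurable_abs2; exact: cmeasurableZD.
- by apply: emeasurable_funD; exact: mE.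
- by move=> x _; rewrite -!EFinM -EFinD lee_fin abs2ZD.
Qed.

End square_integrable.

Section antisymmetric.
Context d (T : measurableType d) (R : realType).
Variable m : {sigma_finite_measure set T -> \bar R}.
Implicit Type n : nat.

Definition tperm_tuple n (s : 'S_n) (t : n.-tuple T) : n.-tuple T :=
  [tuple tnth t (s i) | i < n].

Definition antisymmetrize n (f : n.-tuple T -> R[i]) (t : n.-tuple T) : R[i] :=
  n`!%:R^-1 * \sum_(s : 'S_n) (-1) ^+ s * f (tperm_tuple s t).

Definition antisymmetric_fun n (f : n.-tuple T -> R[i]) : Prop :=
  forall s : 'S_n,
    \forall t \ae tuple_measure m n, f (tperm_tuple s t) = (-1) ^+ s * f t.

Definition Lambda n (f : n.-tuple T -> R[i]) : Prop :=
  L2fun (tuple_measure m n) f /\ antisymmetric_fun f.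

End antisymmetric.

Section Fock.
Variable R : realType.
Local Notation C := R[i].
Local Notation T := (measurableTypeR R).
Local Notation lam := (tuple_measure (lebRp R)).

(* A sequence (h_n) of functions of n variables is coded as a single function on
   finite sequences, h_n being its restriction to sequences of length n. *)
Definition chaos_comp (h : seq T -> C) (n : nat) : n.-tuple T -> C :=
  fun t => h t.

Definition prefock_norm2 (h : seq T -> C) : \bar R :=
  (\sum_(0 <= n <oo) (n`!%:R)%:E * L2norm2 (lam n) (@chaos_comp h n))%E.

Definition prefock_pred : {pred seq T -> C} := fun h =>
  `[< (forall n, Lambda (lebRp R) (@chaos_comp h n)) /\
      (prefock_norm2 h < +oo)%E >].


Lemma prefock_submod_closed : submod_closed prefock_pred.
Proof.
have mZD (a : C) n (f g : n.-tuple T -> C) :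
    Lambda (lebRp R) f -> Lambda (lebRp R) g ->
    Lambda (lebRp R) (fun t => a * f t + g t).
  move=> [[mf foo] af] [[mg goo] ag]; split; first split.
  - exact: cmeasurableZD.
  - rewrite (le_lt_trans (L2norm2ZD _ _ mf mg))// lte_add_pinfty//.
      by rewrite lte_mul_pinfty// lee_fin mulr_ge0// abs2_ge0.
    by rewrite lte_mul_pinfty// lee_fin.
  - move=> s; near=> t.
    have -> : f (tperm_tuple s t) = (-1) ^+ s * f t by near: t; exact: af.
    have -> : g (tperm_tuple s t) = (-1) ^+ s * g t by near: t; exact: ag.
    by rewrite mulrDr !mulrA; congr (_ * _ + _); rewrite mulrC.
split.
  apply/asboolP; split.
    move=> n; split; first split.
    - by split; exact: measurable_cst.
    - rewrite /L2norm2 integral0_eq// => x _.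
      by rewrite /abs2 /chaos_comp/= expr0n addr0.
    - by move=> s; near=> t; rewrite /chaos_comp mulr0.
  rewrite /prefock_norm2 eseries0// => n _ _.
  rewrite /L2norm2 integral0_eq ?mule0// => x _.
  by rewrite /abs2 /chaos_comp/= expr0n addr0.
move=> a f g /asboolP[Lf foo] /asboolP[Lg goo]; apply/asboolP; split.
  by move=> n; exact: mZD.
pose c := 2 * abs2 a; have c0 : 0 <= c by rewrite mulr_ge0// abs2_ge0.
have ge0 h n : (0 <= (n`!%:R)%:E * L2norm2 (lam n) (@chaos_comp h n))%E.
  by rewrite mule_ge0 ?lee_fin// L2norm2_ge0.
apply: (@le_lt_trans _ _
    (c%:E * prefock_norm2 f + 2%:E * prefock_norm2 g)%E); last first.
  by rewrite lte_add_pinfty// lte_mul_pinfty// lee_fin.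
rewrite /prefock_norm2 -!nneseriesZl// -nneseriesD//; last 2 first.
- by move=> n _ _; rewrite mule_ge0// lee_fin.
- by move=> n _ _; rewrite mule_ge0// lee_fin.
apply: lee_nneseries => // n _.
rewrite ![(_%:E * (n`!%:R%:E * _))%E]muleCA -ge0_muleDr; last 2 first.
- by rewrite mule_ge0 ?lee_fin// L2norm2_ge0.
- by rewrite mule_ge0 ?lee_fin// L2norm2_ge0.
rewrite lee_wpmul2l ?lee_fin//; apply: L2norm2ZD.
  by have [[]] := Lf n.
by have [[]] := Lg n.
Unshelve. all: by end_near. Qed.

HB.instance Definition _ := GRing.isSubmodClosed.Build C (seq T -> C)
  prefock_pred prefock_submod_closed.

Record prefock := Prefock {
  prefock_val :> seq T -> C;
  _ : prefock_val \in prefock_pred }.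

HB.instance Definition _ := [isSub for prefock_val].
HB.instance Definition _ := [Choice of prefock by <:].
HB.instance Definition _ := [SubChoice_isSubLmodule of prefock by <:].

(* Almost everywhere equality of all the components. *)
Definition prefock_eqv (f g : prefock) : bool :=
  `[< forall n, \forall t \ae lam n, chaos_comp f t = chaos_comp g t :> C >].

Lemma prefock_eqv_refl : reflexive prefock_eqv.
Proof. by move=> f; apply/asboolP => n; exact/nearW. Qed.

Lemma prefock_eqv_sym : symmetric prefock_eqv.
Proof.
by move=> f g; apply/asboolP/asboolP => fg n; apply: filterS (fg n) => t.
Qed.

Lemma prefock_eqv_trans : transitive prefock_eqv.
Proof.
move=> g f h /asboolP fg /asboolP gh; apply/asboolP => n.
by apply: filterS2 (fg n) (gh n) => t -> ->.
Qed.

Canonical prefock_equiv :=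
  EquivRel prefock_eqv prefock_eqv_refl prefock_eqv_sym prefock_eqv_trans.

Definition fock := {eq_quot prefock_eqv}.

HB.instance Definition _ := Choice.on fock.
HB.instance Definition _ := EqQuotient.on fock.

Lemma prefock_eqvZD (a : C) (f f' g g' : prefock) :
  f = f' %[mod fock] -> g = g' %[mod fock] ->
  a *: f + g = a *: f' + g' %[mod fock].
Proof.
move=> /eqmodP/asboolP ff' /eqmodP/asboolP gg'.
apply/eqmodP/asboolP => n; apply: filterS2 (ff' n) (gg' n) => t.
rewrite /chaos_comp => ft gt.
rewrite -[LHS]/(a * prefock_val f t + prefock_val g t) ft gt.
by [].
Qed.

Definition fock_add (x y : fock) : fock := \pi_fock (repr x + repr y).
Definition fock_opp (x : fock) : fock := \pi_fock (- repr x).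
Definition fock_scale (a : C) (x : fock) : fock := \pi_fock (a *: repr x).

Lemma fock_addE f g : fock_add (\pi_fock f) (\pi_fock g) = \pi_fock (f + g).
Proof.
have := @prefock_eqvZD 1 (repr (\pi_fock f)) f (repr (\pi_fock g)) g.
by rewrite !scale1r; apply; rewrite reprK.
Qed.

Lemma fock_scaleE a f : fock_scale a (\pi_fock f) = \pi_fock (a *: f).
Proof.
have := @prefock_eqvZD a (repr (\pi_fock f)) f 0 0.
by rewrite !addr0; apply; rewrite ?reprK.
Qed.

Lemma fock_oppE f : fock_opp (\pi_fock f) = \pi_fock (- f).
Proof. by rewrite -scaleN1r -fock_scaleE /fock_scale scaleN1r. Qed.

Lemma fock_addA : associative fock_add.
Proof.
move=> x y z; elim/quotW: x => f; elim/quotW: y => g; elim/quotW: z => h.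
by rewrite (fock_addE g h) (fock_addE f g) (fock_addE f) fock_addE addrA.
Qed.

Lemma fock_addC : commutative fock_add.
Proof. move=> x y; elim/quotW: x => f; elim/quotW: y => g.
by rewrite (fock_addE f g) (fock_addE g f) addrC. Qed.

Lemma fock_add0 : left_id (\pi_fock 0) fock_add.
Proof. by move=> x; elim/quotW: x => f; rewrite fock_addE add0r. Qed.

Lemma fock_addN : left_inverse (\pi_fock 0) fock_opp fock_add.
Proof. by move=> x; elim/quotW: x => f; rewrite fock_oppE fock_addE addNr. Qed.

HB.instance Definition _ :=
  GRing.isZmodule.Build fock fock_addA fock_addC fock_add0 fock_addN.

Lemma fock_scaleA a b x : fock_scale a (fock_scale b x) = fock_scale (a * b) x.
Proof. by elim/quotW: x => f; rewrite (fock_scaleE b) !fock_scaleE scalerA. Qed.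

Lemma fock_scale1 : left_id 1 fock_scale.
Proof. by move=> x; elim/quotW: x => f; rewrite fock_scaleE scale1r. Qed.

Lemma fock_scaleDr : right_distributive fock_scale +%R.
Proof.
move=> a x y; elim/quotW: x => f; elim/quotW: y => g.
rewrite -[_ + _]/(fock_add _ _) -[RHS]/(fock_add _ _) (fock_addE f g).
by rewrite (fock_scaleE a f) (fock_scaleE a g) fock_addE fock_scaleE scalerDr.
Qed.

Lemma fock_scaleDl x : {morph fock_scale^~ x : a b / a + b}.
Proof.
move=> a b; elim/quotW: x => f; rewrite -[RHS]/(fock_add _ _).
by rewrite (fock_scaleE a) (fock_scaleE b) fock_addE fock_scaleE scalerDl.
Qed.

HB.instance Definition _ := GRing.Zmodule_isLmodule.Build C fock
  fock_scaleA fock_scale1 fock_scaleDr fock_scaleDl.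

End Fock.

Section Fock_structure.
Variable R : realType.
Local Notation C := R[i].
Local Notation T := (measurableTypeR R).
Local Notation fock := (fock R).
Local Notation lam := (tuple_measure (lebRp R)).

Definition fock_comp (x : fock) (n : nat) : n.-tuple T -> C :=
  @chaos_comp R (repr x) n.

(* sum_n n! \int conj(x_n) y_n: linear in the second variable. *)
Definition fock_dot (x y : fock) : C :=
  let S N := \sum_(n < N) n`!%:R *
    cintegral (lam n) (fun t => conjc (fock_comp x t) * fock_comp y t) in
  limn (fun N => complex.Re (S N)) +i* limn (fun N => complex.Im (S N)).

Definition fock_norm (x : fock) : R :=
  Num.sqrt (fine (prefock_norm2 (repr x))).

(* The element f of the n-th summand; the default 0 is taken only when f is not
   an antisymmetric square integrable function. *)
Definition chaos (n : nat) (f : n.-tuple T -> C) : fock :=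
  \pi_fock (insubd (0 : prefock R) (fun s : seq T => oapp f 0 (insub s))).

Definition vacuum : fock := @chaos 0 (fun=> 1).

End Fock_structure.

Section operators.
Variable R : realType.
Local Notation C := R[i].
Local Notation T := (measurableTypeR R).
Local Notation fock := (fock R).

Definition op := fock -> fock.
HB.instance Definition _ := GRing.Lmodule.on op.

Definition bounded_op (u : op) : Prop :=
  linear u /\ exists M : R, forall x, fock_norm (u x) <= M * fock_norm x.

(* In this definition and in the ones below that use xget, the object is unique
   and exists in the situations considered, so the default is immaterial. *)
Definition adjoint (u : op) : op :=
  xget 0 [set v | bounded_op v /\
                  forall x y, fock_dot (v x) y = fock_dot x (u y)].

Definition positive_op (u : op) : Prop := forall x, 0 <= fock_dot x (u x).

Definition commutant (S : set op) : set op :=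
  [set u | bounded_op u /\ forall v, S v -> u \o v = v \o u].

Definition von_neumann_algebra : set (set op) :=
  [set M | [/\ M `<=` bounded_op, (forall u, M u -> M (adjoint u)) &
               commutant (commutant M) = M]].

Definition vN_generated (S : set op) : set op := smallest von_neumann_algebra S.

Definition tensor (n : nat) (z : T -> C) (f : n.-tuple T -> C)
    (t : n.+1.-tuple T) : C :=
  z (thead t) * f [tuple of behead t].

Definition creation (z : T -> C) : op :=
  xget 0 [set u | bounded_op u /\
    forall n (f : n.-tuple T -> C), Lambda (lebRp R) f ->
      u (chaos f) = chaos (antisymmetrize (tensor z f))].

Definition annihilation (z : T -> C) : op := adjoint (creation z).

(* Psi z = b^*(z) + b(J z), J being complex conjugation. *)
Definition Psi (z : T -> C) : op :=
  creation z + annihilation (fun t => conjc (z t)).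

Definition clifford : set op := vN_generated (Psi @` L2fun (lebRp R)).

Definition clifford_upto (t : R) : set op :=
  vN_generated (Psi @` [set z | L2fun (lebRp R) z /\
                        \forall s \ae lebRp R, t < s -> z s = 0]).

Definition Psi_upto (t : R) : op := Psi (fun s => (\1_`[0, t] s)%:C).

Definition state (u : op) : C := fock_dot (vacuum R) (u (vacuum R)).

Record conditional_expectation (t : R) (E : op -> op) : Prop := {
  cond_exp_range : forall u, clifford u -> clifford_upto t (E u);
  cond_exp_id : forall u, clifford_upto t u -> E u = u;
  cond_exp_linear : forall a u v, clifford u -> clifford v ->
    E (a *: u + v) = a *: E u + E v;
  cond_exp_bimod : forall a b u, clifford_upto t a -> clifford_upto t b ->
    clifford u -> E (a \o u \o b) = a \o E u \o b;
  cond_exp_positive : forall u, clifford u -> positive_op u ->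
    positive_op (E u);
  cond_exp_state : forall u, clifford u -> state (E u) = state u }.

End operators.

Definition dot_norm (R : realType) (V : Type) (dot : V -> V -> R[i]) (x : V) : R :=
  Num.sqrt (complex.Re (dot x x)).

HB.mixin Record isHilbert (R : realType) V of GRing.Lmodule R[i] V := {
  hdot : V -> V -> R[i];
  hdotC : forall x y, hdot y x = conjc (hdot x y);
  hdotZD : forall a x y z, hdot x (a *: y + z) = a * hdot x y + hdot x z;
  hdot_ge0 : forall x, 0 <= hdot x x;
  hdot_eq0 : forall x, hdot x x = 0 -> x = 0;
  hilbert_complete : forall u : nat -> V,
    (forall e : R, 0 < e -> exists N, forall i j, (N <= i)%N -> (N <= j)%N ->
       dot_norm hdot (u i - u j) < e) ->
    exists l, dot_norm hdot (u k - l) @[k --> \oo] --> 0 }.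

#[short(type="hilbertType")]
HB.structure Definition Hilbert (R : realType) :=
  {V of isHilbert R V & GRing.Lmodule R[i] V}.

Definition hnorm (R : realType) (H : hilbertType R) (x : H) : R :=
  dot_norm hdot x.

(* Extension by continuity of a densely defined map given by its graph, and
   closure of an operator.  NX and NY stand for the norms of X and Y, or for
   their squares; they are extended real valued because the L2 norm of an
   arbitrary process may be infinite. *)
Section extension.
Variables (R : realType) (X Y : zmodType) (NX : X -> \bar R) (NY : Y -> \bar R).

Definition graph_closure (G : set (X * Y)) : set (X * Y) :=
  [set p | exists g : nat -> X * Y, [/\ forall k, G (g k),
     NX ((g k).1 - p.1) @[k --> \oo] --> 0%E &
     NY ((g k).2 - p.2) @[k --> \oo] --> 0%E]].

Definition extend (G : set (X * Y)) (x : X) : Y :=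
  xget 0 [set y | graph_closure G (x, y)].

End extension.

Section L2_clifford.
Variables (R : realType) (H : hilbertType R) (iota : op R -> H).
Local Notation C := R[i].
Local Notation T := (measurableTypeR R).
Local Notation hnormE := (fun x : H => (hnorm x)%:E).

(* iota : clifford -> H is a completion of the Clifford algebra for the inner
   product m(u^* v); its values outside clifford are irrelevant.  The completion
   is determined by this up to a unique unitary. *)
Record is_L2_clifford : Prop := {
  L2_iota_linear : forall a u v, clifford u -> clifford v ->
    iota (a *: u + v) = a *: iota u + iota v;
  L2_iota_dot : forall u v, clifford u -> clifford v ->
    hdot (iota u) (iota v) = state (adjoint u \o v);
  L2_iota_dense : forall (x : H) (e : R), 0 < e ->
    exists u, clifford u /\ hnorm (iota u - x) < e }.

Definition L2_upto (t : R) : set H :=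
  [set x | forall e : R, 0 < e ->
     exists u, clifford_upto t u /\ hnorm (iota u - x) < e].

Definition L2_state : H -> C :=
  extend hnormE (fun z : C => (Num.sqrt (abs2 z))%:E)
    [set (iota u, state u) | u in @clifford R].

(* Left action of the Clifford algebra on L^2. *)
Definition L2_lmul (a : op R) : H -> H :=
  extend hnormE hnormE [set (iota u, iota (a \o u)) | u in @clifford R].

Definition L2_cond_exp (E : op R -> op R) : H -> H :=
  extend hnormE hnormE [set (iota u, iota (E u)) | u in @clifford R].

(* The unitary extending u |-> u Omega. *)
Definition L2_fock : H -> fock R :=
  extend hnormE (fun x => (fock_norm x)%:E)
    [set (iota u, u (vacuum R)) | u in @clifford R].

Definition J (n : nat) (f : n.-tuple T -> C) : H :=
  xget 0 [set x | L2_fock x = chaos f].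

Definition simple_process (u : T -> H) : Prop :=
  exists n (A : 'I_n -> set T) (x : 'I_n -> H), (forall i, measurable (A i)) /\
    u = fun t => \sum_(i < n) (\1_(A i) t)%:C *: x i.

Section processes.
Variable mu : {measure set T -> \bar R}.

Definition strongly_measurable (u : T -> H) : Prop :=
  exists s : nat -> T -> H, (forall k, simple_process (s k)) /\
    \forall t \ae mu, hnorm (s k t - u t) @[k --> \oo] --> 0.

Definition process_norm2 (u : T -> H) : \bar R :=
  (\int[mu]_t (hnorm (u t) ^+ 2)%:E)%E.

Definition L2_process (u : T -> H) : Prop :=
  strongly_measurable u /\ (process_norm2 u < +oo)%E.

End processes.

(* n J_{n-1}(f(t, .)), with J_{-1} = 0. *)
Definition DJ (n : nat) : (n.-tuple T -> C) -> T -> H :=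
  match n with
  | 0 => fun _ _ => 0
  | n.+1 => fun f t =>
      n.+1%:R *: @J n (fun s => f [tuple of t :: s])
  end.

Definition finite_chaos_D : set (H * (T -> H)) :=
  [set p | exists N (v : forall n, n.-tuple T -> C),
     [/\ forall n, Lambda (lebRp R) (v n),
         p.1 = \sum_(n < N) J (v n),
         L2_process (lebRp R) p.2 &
         \forall t \ae lebRp R, p.2 t = \sum_(n < N) DJ (v n) t]].

(* The graph of the closed operator D: (F, u) belongs to it when F is in Dom(D)
   and u is a representative of D F in L^2(R_+; H). *)
Definition D_graph : set (H * (T -> H)) :=
  [set p | L2_process (lebRp R) p.2 /\
     graph_closure hnormE (process_norm2 (lebRp R)) finite_chaos_D p].

Definition adapted_L2_process (u : T -> H) : Prop :=
  L2_process (leb01 R) u /\ \forall s \ae leb01 R, L2_upto s (u s).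

Definition simple_ito : set ((T -> H) * H) :=
  [set p | exists n (t : nat -> R) (h : nat -> H),
     [/\ 0 <= t 0%N, (forall k, (k < n)%N -> t k <= t k.+1), t n <= 1,
         (forall k, (k < n)%N -> L2_upto (t k) (h k)) &
         p = (fun s => \sum_(k < n) (\1_`[t k, t k.+1[ s)%:C *: h k,
              \sum_(k < n) L2_lmul (Psi_upto (t k.+1) - Psi_upto (t k)) (h k))]].

Definition ito_integral : (T -> H) -> H :=
  extend (process_norm2 (leb01 R)) hnormE simple_ito.

End L2_clifford.

(* Main.v *)
Require Import Defs.
From HB Require Import structures.
From mathcomp Require Import all_boot all_order all_algebra perm.
From mathcomp Require Import all_classical all_reals all_analysis.
From mathcomp Require Import measurable_realfun complex ring lra.

Set Implicit Arguments.
Unset Strict Implicit.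
Unset Printing Implicit Defensive.

Import Order.TTheory GRing.Theory Num.Theory.
Import numFieldNormedType.Exports.

Local Open Scope classical_set_scope.
Local Open Scope ring_scope.

(* The unitary u |-> u Omega turns everything into statements on the Fock space:
   the conditional expectation m(. | C_t) becomes the operator pi_t that
   multiplies each f_n by the indicator of [0, t]^n, and the left increments of
   Psi become, on vectors living up to the left end of the increment, the creation
   operators b^*(1_]a, b]).  A kernel of the form a(t) * 1[s_i <= t for all i] is
   carried by the tuples whose first entry is the largest one, and such a kernel is
   orthogonal to its rearrangements that move the head; hence antisymmetrization
   multiplies its squared norm by 1/n, and it recovers an antisymmetric f from
   n 1[s_i <= t] f(t, s).  For a simple adapted process h and a finite chaos
   expansion F this gives
     \int_0^1 | h_t - pi_t D_t F |^2 dt = | I(h) - (pi_1 F - m(F)) |^2.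
   Simple integrals are dense in the orthogonal complement of Omega in the range of
   pi_1, so F can be approached by finite chaos expansions in the graph norm of D
   and h chosen with the right-hand side small: this yields both the convergence of
   the integrals and the identification of the limit. *)

(** * Complex numbers and Hilbert spaces *)

(** Two features of the definitions shape the argument. The stochastic integral is a choice of a
    limit with a default value, so a limit has to be exhibited and shown unique; and F is known
    through finite chaos expansions converging in the graph norm. Comparing an arbitrary simple
    integral with an arbitrary finite expansion in one identity settles both, without polarization,
    since the isometry is applied to the difference of two kernels. The identity is exact because
    the weights of Fock space absorb the factor 1/n: (n+1)! |antisymmetrization of W|^2 = n! |W|^2,
    and the right-hand side is an integral over the head of level-n Fock norms of slices. The
    annihilation half of an increment of Psi is never computed: it kills vectors living before the
    increment. All density statements come from one totality result for the vectors b^*(1_]a,b]) g,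
    [headmax_total]. Applied level by level it shows that the vacuum generates the range of pi_t
    under C_t, which identifies L^2(C_t) and forces every m-preserving conditional expectation to
    act as pi_t; applied at time 1 it yields the density of simple integrals. *)

Section complex_numbers.
Variable R : realType.
Implicit Types (z w : R[i]) (r : R).
Local Notation Re := (@complex.Re R).
Local Notation Im := (@complex.Im R).

Lemma cReD z w : Re (z + w) = Re z + Re w.
Proof. by case: z w => [? ?] []. Qed.

Lemma cImD z w : Im (z + w) = Im z + Im w.
Proof. by case: z w => [? ?] []. Qed.

Lemma cReN z : Re (- z) = - Re z.
Proof. by case: z. Qed.

Lemma cImN z : Im (- z) = - Im z.
Proof. by case: z. Qed.

Lemma cRe_sum I (s : seq I) (P : pred I) (F : I -> R[i]) :
  Re (\sum_(i <- s | P i) F i) = \sum_(i <- s | P i) Re (F i).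
Proof. exact: (big_morph Re cReD (erefl : Re 0 = 0)). Qed.

Lemma cIm_sum I (s : seq I) (P : pred I) (F : I -> R[i]) :
  Im (\sum_(i <- s | P i) F i) = \sum_(i <- s | P i) Im (F i).
Proof. exact: (big_morph Im cImD (erefl : Im 0 = 0)). Qed.

Lemma cReM z w : Re (z * w) = Re z * Re w - Im z * Im w.
Proof. by case: z w => [? ?] []. Qed.

Lemma cImM z w : Im (z * w) = Re z * Im w + Im z * Re w.
Proof. by case: z w => [? ?] []. Qed.

Lemma cReMl r z : Re ((r%:C)%C * z) = r * Re z.
Proof. by rewrite cReM/= mul0r subr0. Qed.

Lemma cImMl r z : Im ((r%:C)%C * z) = r * Im z.
Proof. by rewrite cImM/= mul0r addr0. Qed.

Lemma cRe_conj z : Re (conjc z) = Re z. Proof. by case: z. Qed.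

Lemma cIm_conj z : Im (conjc z) = - Im z. Proof. by case: z. Qed.

Lemma complex_ext z w : Re z = Re w -> Im z = Im w -> z = w.
Proof. by case: z w => [? ?] [? ?] /= -> ->. Qed.

Lemma abs2M z w : abs2 (z * w) = abs2 z * abs2 w.
Proof. by rewrite /abs2 cReM cImM; ring. Qed.

Lemma abs2N z : abs2 (- z) = abs2 z.
Proof. by rewrite /abs2 cReN cImN !sqrrN. Qed.

Lemma abs2_conj z : abs2 (conjc z) = abs2 z.
Proof. by rewrite /abs2 cRe_conj cIm_conj sqrrN. Qed.

Lemma abs2_real r : abs2 (r%:C)%C = r ^+ 2.
Proof. by rewrite /abs2 /= expr0n addr0. Qed.

Lemma abs20 : abs2 (0 : R[i]) = 0.
Proof. by rewrite /abs2 /= expr0n addr0. Qed.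

Lemma mulJ_abs2 z : conjc z * z = ((abs2 z)%:C)%C.
Proof. by case: z => a b; apply/complex_ext; rewrite /abs2 /=; ring. Qed.

Lemma abs2_eq0 z : abs2 z = 0 -> z = 0.
Proof.
move=> /eqP; rewrite paddr_eq0 ?sqr_ge0// !sqrf_eq0 => /andP[/eqP a /eqP b].
exact: complex_ext.
Qed.

Lemma sqr_Re_le z : Re z ^+ 2 <= abs2 z.
Proof. by rewrite lerDl sqr_ge0. Qed.

Lemma sqr_Im_le z : Im z ^+ 2 <= abs2 z.
Proof. by rewrite lerDr sqr_ge0. Qed.

Lemma abs2D z w : abs2 (z + w) <= 2 * abs2 z + 2 * abs2 w.
Proof.
by have := abs2ZD 1 z w; rewrite mul1r {2}/abs2 /= expr0n addr0 expr1n mulr1.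
Qed.

Lemma conjcM z w : conjc (z * w) = conjc z * conjc w.
Proof. by apply/complex_ext; rewrite !(cRe_conj, cIm_conj, cReM, cImM); ring. Qed.

Lemma conjcD z w : conjc (z + w) = conjc z + conjc w.
Proof. by apply/complex_ext; rewrite !(cRe_conj, cIm_conj, cReD, cImD); ring. Qed.

Lemma conjc_sum I (s : seq I) (P : pred I) (F : I -> R[i]) :
  conjc (\sum_(i <- s | P i) F i) = \sum_(i <- s | P i) conjc (F i).
Proof. exact: (big_morph _ conjcD (conjc0 _)). Qed.

End complex_numbers.

Section hilbert.
Variables (R : realType) (H : hilbertType R).
Implicit Types (x y z w : H) (a b : R[i]) (S : set H).

Lemma hdotDr x y z : hdot x (y + z) = hdot x y + hdot x z.
Proof. by have := hdotZD 1 x y z; rewrite scale1r mul1r. Qed.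

Lemma hdot0r x : hdot x 0 = 0.
Proof. by have /eqP := hdotDr x 0 0; rewrite addr0 -subr_eq0 opprD addNKr oppr_eq0 => /eqP. Qed.

Lemma hdotZr a x y : hdot x (a *: y) = a * hdot x y.
Proof. by have := hdotZD a x y 0; rewrite !addr0 hdot0r addr0. Qed.

Lemma hdotNr x y : hdot x (- y) = - hdot x y.
Proof. by rewrite -scaleN1r hdotZr mulN1r. Qed.

Lemma hdotBr x y z : hdot x (y - z) = hdot x y - hdot x z.
Proof. by rewrite hdotDr hdotNr. Qed.

Lemma hdotDl x y z : hdot (x + y) z = hdot x z + hdot y z.
Proof. by rewrite hdotC hdotDr conjcD -!hdotC. Qed.

Lemma hdotZl a x y : hdot (a *: x) y = conjc a * hdot x y.
Proof. by rewrite hdotC hdotZr conjcM -hdotC. Qed.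

Lemma hdot0l x : hdot 0 x = 0.
Proof. by rewrite hdotC hdot0r conjc0. Qed.

Lemma hdotNl x y : hdot (- x) y = - hdot x y.
Proof. by rewrite hdotC hdotNr raddfN/= -hdotC. Qed.

Lemma hdotBl x y z : hdot (x - y) z = hdot x z - hdot y z.
Proof. by rewrite hdotDl hdotNl. Qed.

Lemma hdot_sumr I (s : seq I) (P : pred I) (F : I -> H) x :
  hdot x (\sum_(i <- s | P i) F i) = \sum_(i <- s | P i) hdot x (F i).
Proof. exact: (big_morph (hdot x) (hdotDr x) (hdot0r x)). Qed.

Definition hn2 : H -> R := locked (fun x => complex.Re (hdot x x)).

Lemma hn2_hdot x : hn2 x = complex.Re (hdot x x).
Proof. by rewrite /hn2 -lock. Qed.

Lemma hdotxx x : hdot x x = ((hn2 x)%:C)%C.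
Proof.
apply/complex_ext => /=; first by rewrite hn2_hdot.
have := congr1 (@complex.Im R) (hdotC x x).
by rewrite cIm_conj; lra.
Qed.

Lemma hn2_ge0 x : 0 <= hn2 x.
Proof. by have := hdot_ge0 x; rewrite hdotxx ler0c. Qed.

Lemma hn2_eq0 x : hn2 x = 0 -> x = 0.
Proof. by move=> x0; apply: hdot_eq0; rewrite hdotxx x0. Qed.

Lemma hn20 : hn2 0 = 0. Proof. by rewrite hn2_hdot hdot0r. Qed.

Lemma hnormE x : hnorm x = Num.sqrt (hn2 x). Proof. by rewrite hn2_hdot. Qed.

Lemma sqr_hnorm x : hnorm x ^+ 2 = hn2 x.
Proof. by rewrite hnormE sqr_sqrtr// hn2_ge0. Qed.

Lemma hnorm_ge0 x : 0 <= hnorm x.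
Proof. exact: sqrtr_ge0. Qed.

Lemma hnorm0 : hnorm (0 : H) = 0.
Proof. by rewrite hnormE hn20 sqrtr0. Qed.

Lemma hnorm_eq0 x : hnorm x = 0 -> x = 0.
Proof. by move=> x0; apply: hn2_eq0; rewrite -sqr_hnorm x0 expr0n. Qed.

Lemma hn2D x y : hn2 (x + y) = hn2 x + hn2 y + 2 * complex.Re (hdot x y).
Proof.
rewrite !hn2_hdot hdotDl !hdotDr !cReD (hdotC x y) cRe_conj; ring.
Qed.

Lemma hn2N x : hn2 (- x) = hn2 x.
Proof. by rewrite !hn2_hdot hdotNl hdotNr opprK. Qed.

Lemma hn2B x y : hn2 (x - y) = hn2 x + hn2 y - 2 * complex.Re (hdot x y).
Proof. by rewrite hn2D hn2N hdotNr cReN mulrN. Qed.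

Lemma hn2Z a x : hn2 (a *: x) = abs2 a * hn2 x.
Proof. by rewrite !hn2_hdot hdotZl hdotZr mulrA mulJ_abs2 cReM/= mul0r subr0. Qed.

(* The squared distance from [x] to the line spanned by [y], times [|y|^2]. *)
Lemma hn2_line x y : hn2 y * hn2 (hdot y y *: x - hdot y x *: y) =
  hn2 y ^+ 2 * (hn2 x * hn2 y - abs2 (hdot x y)).
Proof.
rewrite hn2B !hn2Z hdotZl hdotZr (hdotxx y) (hdotC x y) abs2_conj abs2_real.
rewrite /abs2 !(cReM, cImM, cRe_conj, cIm_conj)/=; ring.
Qed.

Lemma cauchy_schwarz x y : abs2 (hdot x y) <= hn2 x * hn2 y.
Proof.
have [y0|y0] := eqVneq (hn2 y) 0.
  by rewrite (hn2_eq0 y0) hdot0r abs20 hn20 mulr0.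
have yp : 0 < hn2 y by rewrite lt_def y0 hn2_ge0.
rewrite -subr_ge0 -(pmulr_rge0 _ (exprn_gt0 2 yp)) -hn2_line.
by rewrite mulr_ge0 ?hn2_ge0.
Qed.

Lemma Re_hdot_le x y : complex.Re (hdot x y) <= hnorm x * hnorm y.
Proof.
rewrite (le_trans (ler_norm _))// -(@ler_pXn2r _ 2)//; last first.
  by rewrite nnegrE mulr_ge0 ?hnorm_ge0.
rewrite real_normK ?num_real// exprMn !sqr_hnorm.
exact: le_trans (sqr_Re_le _) (cauchy_schwarz _ _).
Qed.

Lemma hnorm_triangle x y : hnorm (x + y) <= hnorm x + hnorm y.
Proof.
rewrite -(@ler_pXn2r _ 2)// ?nnegrE ?hnorm_ge0 ?addr_ge0 ?hnorm_ge0//.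
by rewrite sqrrD !sqr_hnorm hn2D; have := Re_hdot_le x y; lra.
Qed.

Lemma hnorm_opp x : hnorm (- x) = hnorm x.
Proof. by rewrite !hnormE hn2N. Qed.

Lemma hdistC x y : hnorm (x - y) = hnorm (y - x).
Proof. by rewrite -hnorm_opp opprB. Qed.

Lemma hdistD y x z : hnorm (x - z) <= hnorm (x - y) + hnorm (y - z).
Proof. by rewrite -(subrKA y) hnorm_triangle. Qed.

Lemma hnormZ a x : hnorm (a *: x) = Num.sqrt (abs2 a) * hnorm x.
Proof. by rewrite !hnormE hn2Z sqrtrM ?abs2_ge0. Qed.

Lemma hnorm_lt x (e : R) : 0 < e -> (hnorm x < e) = (hn2 x < e ^+ 2).
Proof.
move=> e0; rewrite -sqr_hnorm -(@ltr_pXn2r _ 2)// nnegrE ?hnorm_ge0//.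
exact: ltW.
Qed.

Lemma hn2D_le x y : hn2 (x + y) <= 2 * hn2 x + 2 * hn2 y.
Proof.
by rewrite -subr_ge0 (_ : _ - _ = hn2 (x - y)) ?hn2_ge0// hn2D hn2B; ring.
Qed.

Definition hclosure S : set H :=
  [set x | forall e : R, 0 < e -> exists y, S y /\ hnorm (y - x) < e].

Lemma sub_hclosure S : S `<=` hclosure S.
Proof. by move=> x Sx e e0; exists x; rewrite subrr hnorm0. Qed.

Lemma hclosure_sub S S' : S `<=` hclosure S' -> hclosure S `<=` hclosure S'.
Proof.
move=> SS' x Sx e e0; have e2 : 0 < e / 2 by rewrite divr_gt0.
have [y [/SS' /(_ _ e2) [z [S'z zy]] yx]] := Sx _ e2.
by exists z; split => //; rewrite (le_lt_trans (hdistD y _ _))// (splitr e) ltrD.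
Qed.

Definition lin_subspace S : Prop := S 0 /\ forall a x y, S x -> S y -> S (a *: x + y).

Lemma lin_subspaceD S x y : lin_subspace S -> S x -> S y -> S (x + y).
Proof. by move=> [_ SD] Sx Sy; rewrite -(scale1r x); exact: SD. Qed.

Lemma lin_subspaceZ S a x : lin_subspace S -> S x -> S (a *: x).
Proof. by move=> [S0 SD] Sx; rewrite -(addr0 (a *: x)); exact: SD. Qed.

Lemma lin_subspaceB S x y : lin_subspace S -> S x -> S y -> S (x - y).
Proof. by move=> S0 Sx Sy; rewrite addrC -scaleN1r; apply: (S0.2). Qed.

Lemma lin_subspace_sum S I (s : seq I) (P : pred I) (F : I -> H) : lin_subspace S ->
  (forall i, P i -> S (F i)) -> S (\sum_(i <- s | P i) F i).
Proof.
move=> SS SF; elim/big_ind : _ => //; first by case: SS.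
by move=> x y; exact: lin_subspaceD.
Qed.

Lemma lin_subspace_hclosure S : lin_subspace S -> lin_subspace (hclosure S).
Proof.
move=> [S0 SD]; split; first exact: sub_hclosure.
move=> a x y Sx Sy e e0.
pose c := Num.sqrt (abs2 a) + 1.
have c0 : 0 < c by rewrite ltr_wpDl// sqrtr_ge0.
have [x' [Sx' xx']] := Sx (e / 2 / c) ltac:(by rewrite !divr_gt0).
have [y' [Sy' yy']] := Sy (e / 2) ltac:(by rewrite !divr_gt0).
exists (a *: x' + y'); split; first exact: SD.
rewrite opprD addrACA -scalerBr (le_lt_trans (hnorm_triangle _ _))// (splitr e) ler_ltD//.
rewrite hnormZ (@le_trans _ _ (c * hnorm (x' - x)))//.
  by rewrite ler_wpM2r ?hnorm_ge0// lerDl.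
by rewrite mulrC -ler_pdivlMr// ltW.
Qed.

Lemma eps_eq0 (r : R) : (forall e : R, 0 < e -> r <= e) -> 0 <= r -> r = 0.
Proof.
move=> re r0; apply/eqP; rewrite eq_le r0 andbT; apply/ler_addgt0Pl => e e0.
by rewrite addr0 re.
Qed.

Lemma hclosure_ortho S z x : (forall y, S y -> hdot z y = 0) -> hclosure S x ->
  hdot z x = 0.
Proof.
move=> zS Sx; apply/abs2_eq0/eps_eq0; last exact: abs2_ge0.
(* The added 1 keeps the quotient meaningful when [z = 0]; Cauchy-Schwarz then bounds
   [abs2 (hdot z x)] by [e]. *)
move=> e e0; have d0 : 0 < Num.sqrt (e / (hn2 z + 1)).
  by rewrite sqrtr_gt0 divr_gt0// ltr_wpDl ?hn2_ge0.
have [y [Sy]] := Sx _ d0.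
rewrite hnorm_lt// sqr_sqrtr ?divr_ge0 ?addr_ge0 ?hn2_ge0 ?(ltW e0)// => yx.
have -> : hdot z x = - hdot z (y - x) by rewrite hdotBr (zS _ Sy) sub0r opprK.
rewrite abs2N (le_trans (cauchy_schwarz _ _))//.
rewrite (@le_trans _ _ ((hn2 z + 1) * hn2 (y - x)))//.
  by rewrite ler_wpM2r ?hn2_ge0// lerDl.
by rewrite mulrC -ler_pdivlMr ?ltr_wpDl ?hn2_ge0// ltW.
Qed.

(** A contraction moves a point near a fixed point [y] to a point equally near [y], so [x] and [P x]
    are within twice the distance of [x] to the fixed points. *)
Lemma hclosure_fixed (P : H -> H) x : (forall x y, P (x - y) = P x - P y) ->
  (forall x, hnorm (P x) <= hnorm x) -> hclosure [set x | P x = x] x -> P x = x.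
Proof.
move=> PB Pn hx; apply/eqP; rewrite -subr_eq0; apply/eqP.
apply: hnorm_eq0; apply: eps_eq0 => [e e0|]; last exact: hnorm_ge0.
have [y [yt yx]] := hx _ (divr_gt0 e0 (ltr0n R 2)).
apply: le_trans (hdistD y _ _) _; rewrite [X in _ <= X]splitr lerD ?(ltW yx)//.
rewrite -[X in _ - X]yt -PB; apply: le_trans (Pn _) _.
by rewrite hdistC; exact: ltW.
Qed.

Lemma hnorm_cvg0P (u : nat -> H) :
  (hnorm (u k) @[k --> \oo] --> 0) <->
  (forall e : R, 0 < e -> exists N, forall k, (N <= k)%N -> hnorm (u k) < e).
Proof.
split=> [/cvgrPdist_lt uP e e0|uP].
  have [N _ NP] := uP e e0; exists N => k Nk.
  by apply: le_lt_trans (NP k Nk); rewrite sub0r normrN ler_norm.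
apply/cvgrPdist_lt => e e0; have [N NP] := uP e e0; exists N => // k /= Nk.
by rewrite sub0r normrN ger0_norm ?hnorm_ge0// NP.
Qed.

Lemma hcomplete (u : nat -> H) :
  (forall e : R, 0 < e -> exists N, forall i j, (N <= i)%N -> (N <= j)%N ->
    hnorm (u i - u j) < e) ->
  exists l, forall e : R, 0 < e -> exists N, forall k, (N <= k)%N ->
    hnorm (u k - l) < e.
Proof.
by move=> /hilbert_complete[l ul]; exists l; apply/hnorm_cvg0P.
Qed.

(** [S] is not assumed closed, so the nearest point lies in its closure only. It is the limit of a
    minimizing sequence [u] with defect 1/(k+1) in squared distance; the parallelogram law makes [u]
    Cauchy. *)
Lemma orthogonal_projection S x : lin_subspace S ->
  exists p, hclosure S p /\ forall y, S y -> hdot y (x - p) = 0.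
Proof.
move=> SS; have [S0 SD] := SS.
pose D := [set hn2 (x - y) | y in S]; pose d := inf D.
have D0 : D !=set0 by exists (hn2 (x - 0)), 0.
have Dlb : has_lbound D by exists 0 => _ [y _ <-]; exact: hn2_ge0.
have dle y : S y -> d <= hn2 (x - y) by move=> Sy; apply: ge_inf => //; exists y.
have /choice[u uP] : forall k, exists y, S y /\ hn2 (x - y) < d + k.+1%:R^-1.
  move=> k; have [|_ [y Sy <-] yd] := @inf_adherent _ D k.+1%:R^-1 _ (conj D0 Dlb).
    by rewrite invr_gt0.
  by exists y.
have uC i j : hn2 (u i - u j) <= 2 * (i.+1%:R^-1 + j.+1%:R^-1).
  have [Si ui] := uP i; have [Sj uj] := uP j.
  (* The midpoint is again in [S], hence at squared distance at least [d] from [x]; the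
     parallelogram law turns this into closeness of [u i] and [u j]. *)
  pose m := ((2^-1)%:C)%C *: (u i + u j).
  have Sm : S m by apply: lin_subspaceZ => //; exact: lin_subspaceD.
  have -> : hn2 (u i - u j) =
      2 * hn2 (x - u i) + 2 * hn2 (x - u j) - 4 * hn2 (x - m).
    rewrite !hn2B /m hn2Z hdotZr hdotDr hn2D abs2_real cReM cReD/=.
    by rewrite mul0r subr0; field.
  by have := dle _ Sm; move: (_^-1) (_^-1) ui uj => p q; lra.
have [|p up] := @hcomplete u.
  move=> e e0; have e1 : 0 < e ^+ 2 / 4 by rewrite divr_gt0// exprn_gt0.
  have [N NP] : exists N : nat, N.+1%:R^-1 < e ^+ 2 / 4.
    have [N _ NP] := near_infty_natSinv_lt (PosNum e1).
    by exists N; exact: (NP N (leqnn N)).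
  exists N => i j Ni Nj; rewrite hnorm_lt// (le_lt_trans (uC i j))//.
  have le_inv k : (N <= k)%N -> k.+1%:R^-1 <= N.+1%:R^-1 :> R.
    by move=> Nk; rewrite lef_pV2 ?posrE// ler_nat.
  have := le_inv _ Ni; have := le_inv _ Nj.
  by move: (i.+1%:R^-1) (j.+1%:R^-1) (N.+1%:R^-1) NP => p q s; lra.
exists p; split.
  move=> e /up[N /(_ N (leqnn _)) Np]; exists (u N); split => //.
  by have [] := uP N.
move=> w Sw; apply/abs2_eq0/eps_eq0; last exact: abs2_ge0.
have uw k : abs2 (hdot w (x - u k)) <= hn2 w * k.+1%:R^-1.
  have [Sk uk] := uP k.
  have [w0|w0] := eqVneq (hn2 w) 0.
    by rewrite (hn2_eq0 w0) hdot0l abs20 hn20 mul0r.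
  have wp : 0 < hn2 w by rewrite lt_def w0 hn2_ge0.
  set r := x - u k in uk *.
  (* Correcting [u k] by the best multiple of [w] lowers the squared distance by
     [abs2 (hdot w r) / hn2 w], which cannot exceed the defect 1/(k+1). *)
  pose c := hdot w r / hdot w w.
  have : d <= hn2 (r - c *: w).
    have -> : r - c *: w = x - (c *: w + u k) by rewrite /r opprD addrA addrAC.
    by apply: dle; exact: SD.
  have -> : hn2 (r - c *: w) = hn2 r - abs2 (hdot w r) / hn2 w.
    rewrite hn2B hn2Z hdotZr /c (hdotC w r) hdotxx.
    have -> : hdot w r / ((hn2 w)%:C)%C = (((hn2 w)^-1)%:C)%C * hdot w r.
      by rewrite mulrC fmorphV.
    rewrite !(cReM, abs2M, abs2_real, cRe_conj, cIm_conj, cImM)/= /abs2.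
    by field.
  move=> dr; rewrite mulrC -ler_pdivrMr//.
  by rewrite ltW// -(ltrD2l d) (le_lt_trans _ uk)// addrC -lerBrDl.
move=> e e0.
have q0 : 0 < e / (4 * (hn2 w + 1)) by rewrite divr_gt0// mulr_gt0// ltr_wpDl ?hn2_ge0.
have s0 : 0 < Num.sqrt (e / (4 * (hn2 w + 1))) by rewrite sqrtr_gt0.
have [N1 N1P] := up _ s0.
have [N2 N2P] : exists N : nat, forall k, (N <= k)%N ->
    k.+1%:R^-1 < e / (4 * (hn2 w + 1)).
  by have [N _ NP] := near_infty_natSinv_lt (PosNum q0); exists N => k; exact: NP.
pose k := maxn N1 N2.
have -> : x - p = (x - u k) + (u k - p) by rewrite addrA subrK.
rewrite hdotDr (le_trans (abs2D _ _))//.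
have := N1P k (leq_maxl _ _); rewrite hnorm_lt// sqr_sqrtr ?(ltW q0)// => k1.
have k2 := N2P k (leq_maxr _ _).
have h1 := uw k; have h2 := cauchy_schwarz w (u k - p).
have w0 := hn2_ge0 w.
have b1 : hn2 w * k.+1%:R^-1 <= e / 4.
  rewrite (@le_trans _ _ ((hn2 w + 1) * (e / (4 * (hn2 w + 1)))))//.
    by rewrite ler_pM// ?lerDl// ?ltW// invr_gt0.
  rewrite le_eqVlt; apply/orP; left; apply/eqP; field; lra.
have b2 : hn2 w * hn2 (u k - p) <= e / 4.
  rewrite (@le_trans _ _ ((hn2 w + 1) * (e / (4 * (hn2 w + 1)))))//.
    by rewrite ler_pM// ?lerDl// ?hn2_ge0// ltW.
  rewrite le_eqVlt; apply/orP; left; apply/eqP; field; lra.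
by have := le_trans h1 b1; have := le_trans h2 b2; clear; lra.
Qed.

Lemma dense_of_ortho S : lin_subspace S ->
  (forall x, (forall y, S y -> hdot y x = 0) -> x = 0) -> forall x, hclosure S x.
Proof.
move=> SS S0 x; have [p [Sp xp]] := orthogonal_projection x SS.
by have /eqP := S0 _ xp; rewrite subr_eq0 => /eqP ->.
Qed.

(** The kernel of [f] has codimension at most one, so the part [r] of any [z] with [f z != 0] that
    is orthogonal to the kernel represents [f] up to a scalar. *)
Lemma riesz (f : H -> R[i]) (M : R) :
  (forall a x y, f (a *: x + y) = a * f x + f y) ->
  (forall x, abs2 (f x) <= M * hn2 x) ->
  exists v, forall x, f x = hdot v x.
Proof.
move=> fZD fM; pose S := [set x | f x = 0].
have f0 : f 0 = 0 by apply/abs2_eq0/eqP; rewrite eq_le abs2_ge0 (le_trans (fM _))// hn20 mulr0.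
have SS : lin_subspace S.
  by split=> // a x y; rewrite /S/= fZD => -> ->; rewrite mulr0 addr0.
have [fS|/existsNP[z fz]] := pselect (forall x, f x = 0).
  by exists 0 => x; rewrite fS hdot0l.
have [p [Sp zp]] := orthogonal_projection z SS.
have fB x y : f (x - y) = f x - f y.
  by rewrite addrC -scaleN1r fZD mulN1r addrC.
(* The projection lies in the closure of the kernel only; boundedness of [f] carries the value 0
   over to it. *)
have fp : f p = 0.
  apply/abs2_eq0/eps_eq0; last exact: abs2_ge0.
  move=> e e0.
  have M0 : 0 < `|M| + 1 by rewrite ltr_wpDl.
  have q0 : 0 < Num.sqrt (e / (`|M| + 1)) by rewrite sqrtr_gt0 divr_gt0.
  have [y [Sy]] := Sp _ q0.
  rewrite hnorm_lt// sqr_sqrtr ?(ltW (divr_gt0 _ _))// => yp.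
  have -> : f p = - f (y - p) by rewrite fB Sy sub0r opprK.
  rewrite abs2N (le_trans (fM _))// (@le_trans _ _ ((`|M| + 1) * hn2 (y - p)))//.
    by rewrite ler_wpM2r ?hn2_ge0// (le_trans (ler_norm _))// lerDl.
  by rewrite mulrC -ler_pdivlMr// ltW.
pose r := z - p; have fr : f r = f z by rewrite fB fp subr0.
have r0 : hdot r r != 0.
  by apply/eqP => /hdot_eq0 r0; move: fr; rewrite r0 f0 => /esym.
(* The scalar is conjugated because the inner product is conjugate-linear in its first argument. *)
exists (conjc (f r / hdot r r) *: r) => x.
have : S (x - (f x / f r) *: r).
  rewrite /S/= fB -[_ *: r]addr0 fZD f0 addr0 divfK ?subrr//.
  by rewrite fr; exact/eqP.
move=> /zp; rewrite hdotC => /eqP; rewrite conjc_eq0 hdotBr hdotZr subr_eq0.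
move=> /eqP rx; rewrite hdotZl conjcK rx mulrA.
have ? : f r != 0 by rewrite fr; exact/eqP.
by field; apply/andP.
Qed.

End hilbert.

(** * Computing the extensions by continuity that occur in the definitions *)

Section extension_by_continuity.
Variable R : realType.

Lemma extendE (X Y : zmodType) (NX : X -> \bar R) (NY : Y -> \bar R)
    (G : set (X * Y)) x y : graph_closure NX NY G (x, y) ->
  (forall y', graph_closure NX NY G (x, y') -> y' = y) -> extend NX NY G x = y.
Proof. by move=> xy uniq; apply: xget_unique. Qed.

Lemma EFin_cvg0 (u : nat -> R) :
  ((u k)%:E @[k --> \oo] --> 0%E) <-> (u k @[k --> \oo] --> 0).
Proof.
split=> [/fine_cvgP[_]//|u0].
by apply: cvg_EFin => //; exact: nearW.
Qed.

Lemma invS_cvg0 : k.+1%:R^-1 @[k --> \oo] --> (0 : R).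
Proof. exact: cvg_harmonic. Qed.

Lemma squeeze0 (u v : nat -> R) : (forall k, 0 <= u k <= v k) ->
  v k @[k --> \oo] --> 0 -> u k @[k --> \oo] --> 0.
Proof.
move=> uv v0; apply: squeeze_cvgr (cvg_cst 0) v0.
by near=> k; exact: uv.
Unshelve. all: by end_near. Qed.

Local Notation hnormE := (fun x => (hnorm x)%:E).

Variables (H K : hilbertType R) (G : set (H * K)) (Phi : H -> K) (M : R).
Hypothesis GPhi : forall p, G p -> p.2 = Phi p.1.
Hypothesis Gdense : forall x (e : R), 0 < e -> exists p, G p /\ hnorm (p.1 - x) < e.
Hypothesis PhiM : forall x y, hnorm (Phi x - Phi y) <= M * hnorm (x - y).

(** [extend] picks a limit by choice, so it is computed only by exhibiting one limit and showing
    that every other one coincides with it. A Lipschitz map known to agree with the dense graph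
    provides both. *)
Lemma extend_continuous x : extend hnormE hnormE G x = Phi x.
Proof.
apply: extendE.
  have /choice[g gP] : forall k : nat, exists p, G p /\ hnorm (p.1 - x) < k.+1%:R^-1.
    by move=> k; apply: Gdense; rewrite invr_gt0.
  have gx : hnorm ((g k).1 - x) @[k --> \oo] --> 0.
    apply: squeeze0 invS_cvg0 => k.
    by have [_ /ltW ->] := gP k; rewrite hnorm_ge0.
  exists g; split => /=; first by move=> k; have [] := gP k.
  - exact/EFin_cvg0.
  - apply/EFin_cvg0/(@squeeze0 _ (fun k => M * hnorm ((g k).1 - x))).
      move=> k; have [Gk _] := gP k.
      by rewrite hnorm_ge0/= (GPhi Gk) PhiM.
    by rewrite -(mulr0 M); exact: cvgMr.
move=> y [g [/= gG /EFin_cvg0 gx /EFin_cvg0 gy]].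
apply/eqP; rewrite -subr_eq0; apply/eqP/hnorm_eq0.
apply/esym; apply: (cvg_unique (@Rhausdorff R) (F := (fun _ : nat => hnorm (y - Phi x)) @ \oo)).
- apply: (@squeeze0 _ (fun k => hnorm ((g k).2 - y) + M * hnorm ((g k).1 - x))).
    move=> k; rewrite hnorm_ge0/= (le_trans (hdistD (g k).2 _ _))//.
    by rewrite hdistC lerD2l (GPhi (gG k)) PhiM.
  by rewrite -(addr0 0) -{2}(mulr0 M); apply: cvgD => //; exact: cvgMr.
- exact: cvg_cst.
Qed.

End extension_by_continuity.

(** * The space L^2 *)

Section lower_integral.
Context d (T : measurableType d) (R : realType).
Variable mu : {measure set T -> \bar R}.
Implicit Types f g : T -> \bar R.
Local Open Scope ereal_scope.
Import HBNNSimple.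

(* No measurability is assumed: the integral of a nonnegative function is the
   supremum of the integrals of the simple functions below it. *)
Lemma ae_le_lower_integral f g : (forall x, 0 <= f x) -> (forall x, 0 <= g x) ->
  (\forall x \ae mu, f x <= g x) -> \int[mu]_x f x <= \int[mu]_x g x.
Proof.
move=> f0 g0 [N [mN N0 fgN]].
rewrite [leLHS]ge0_integralTE//.
apply: ge_ereal_sup => _ [h hf <-].
have mNC : measurable (~` N) by exact: measurableC.
(* Killing [h] on the null set keeps its integral and puts it below [g] everywhere, so that it
   competes in the supremum defining the integral of [g]. *)
pose h' := mul_nnsfun h (indic_nnsfun R mNC).
rewrite -integralT_nnsfun.
rewrite (@ge0_ae_eq_integral _ _ _ mu setT _ (fun x => (h x * \1_(~` N) x)%R%:E))//.
- rewrite (_ : (\int[mu]_x _) = sintegral mu h'); last by rewrite -integralT_nnsfun.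
  rewrite [leRHS]ge0_integralTE//.
  apply: ereal_sup_ubound; exists h' => // x.
  have -> : h' x = (h x * \1_(~` N) x)%R by [].
  rewrite indicE.
  have [xN|xN] := pselect (N x).
    by rewrite memNset ?mulr0//= => /(_ xN).
  rewrite mem_set ?mulr1//= (le_trans (hf x))//.
  by apply: contrapT => fg; apply: xN; exact: fgN.
- exact/measurable_EFinP.
- by apply/measurable_EFinP; apply: measurable_funM => //; exact: measurable_indic.
- by move=> x _; rewrite lee_fin.
- by move=> x _; rewrite lee_fin mulr_ge0.
- exists N; split => // x /= /not_implyP[_]; apply: contra_notP => xN.
  by rewrite indicE mem_set// mulr1.
Qed.

Lemma ae_eq_lower_integral f g : (forall x, 0 <= f x) -> (forall x, 0 <= g x) ->
  (\forall x \ae mu, f x = g x) -> \int[mu]_x f x = \int[mu]_x g x.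
Proof.
move=> f0 g0 fg; apply/eqP; rewrite eq_le !ae_le_lower_integral//.
  by apply: filterS fg => x ->.
by apply: filterS fg => x ->.
Qed.

End lower_integral.

Section real_sequences.
Variable R : realType.

(** Bounded variation makes [u] a constant plus the difference of two bounded nondecreasing
    sequences: [v] sums the absolute increments, and [w] what must be removed from them to recover
    the increments. *)
Lemma summable_increments_cvg (u : nat -> R) (B : R) :
  (forall n, \sum_(i < n) `|u i.+1 - u i| <= B) -> cvgn u.
Proof.
move=> uB.
pose v n := \sum_(i < n) `|u i.+1 - u i|.
pose w n := \sum_(i < n) (`|u i.+1 - u i| - (u i.+1 - u i)).
have nd (a : nat -> R) : (forall i, 0 <= a i) ->
    {homo (fun n => \sum_(i < n) a i) : n m / (n <= m)%N >-> n <= m}.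
  move=> a0; apply: homo_leq => // [x y z|n]; first exact: le_trans.
  by rewrite big_ord_recr/= lerDl.
have cv : cvgn v.
  apply: nondecreasing_is_cvgn.
    by apply: (nd (fun i => `|u i.+1 - u i|)) => i; exact: normr_ge0.
  by exists B => _ [n _ <-]; exact: uB.
have cw : cvgn w.
  apply: nondecreasing_is_cvgn.
    by apply: (nd (fun i => `|u i.+1 - u i| - (u i.+1 - u i))) => i; rewrite subr_ge0 ler_norm.
  exists (B + B) => _ [n _ <-]; rewrite (le_trans _ (lerD (uB n) (uB n)))// -big_split/=.
  by apply: ler_sum => i _; rewrite lerD2l -normrN ler_norm.
have -> : u = fun n => u 0%N + (v n - w n).
  apply/funext => n; rewrite /v /w -sumrB.
  under eq_bigr do rewrite opprB addrC subrK.
  elim: n => [|n ih]; first by rewrite big_ord0 addr0.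
  by rewrite big_ord_recr/= addrA -ih addrC subrK.
by apply: is_cvgD; [exact: is_cvg_cst|exact: is_cvgB].
Qed.

End real_sequences.

Section complex_integral.
Context d (T : measurableType d) (R : realType).
Variable mu : {measure set T -> \bar R}.
Local Notation C := R[i].
Implicit Types f g h : T -> C.

Lemma cmeasurable_cst (c : C) : cmeasurable (fun _ : T => c).
Proof. by split; exact: measurable_cst. Qed.

Lemma cmeasurableD f g : cmeasurable f -> cmeasurable g ->
  cmeasurable (fun x => f x + g x).
Proof.
move=> mf mg; have := cmeasurableZD 1 mf mg.
by congr cmeasurable; apply/funext => x; rewrite mul1r.
Qed.

Lemma cmeasurable_conj f : cmeasurable f -> cmeasurable (fun x => conjc (f x)).
Proof.
move=> [fr fi]; split.
  by under eq_fun do rewrite cRe_conj.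
by under eq_fun do rewrite cIm_conj; exact: measurable_funN.
Qed.

Lemma cmeasurableM f g : cmeasurable f -> cmeasurable g ->
  cmeasurable (fun x => f x * g x).
Proof.
move=> [fr fi] [gr gi]; split.
  under eq_fun do rewrite cReM.
  by apply: measurable_funB; exact: measurable_funM.
under eq_fun do rewrite cImM.
by apply: measurable_funD; exact: measurable_funM.
Qed.

Lemma cmeasurableN f : cmeasurable f -> cmeasurable (fun x => - f x).
Proof.
move=> mf; have := cmeasurableM (cmeasurable_cst (-1)) mf.
by congr cmeasurable; apply/funext => x; rewrite mulN1r.
Qed.

Lemma cmeasurableB f g : cmeasurable f -> cmeasurable g ->
  cmeasurable (fun x => f x - g x).
Proof. by move=> mf mg; apply: cmeasurableD => //; exact: cmeasurableN. Qed.

Lemma cmeasurable_real (r : T -> R) : measurable_fun setT r ->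
  cmeasurable (fun x => ((r x)%:C)%C).
Proof. by move=> mr; split => //=; exact: measurable_cst. Qed.

Lemma cmeasurable_comp d' (T' : measurableType d') (phi : T' -> T) f :
  measurable_fun setT phi -> cmeasurable f -> cmeasurable (f \o phi).
Proof.
by move=> mphi [fr fi]; split; [exact: (measurableT_comp fr)|exact: (measurableT_comp fi)].
Qed.

Definition cintegrable f : Prop :=
  mu.-integrable setT (EFin \o (fun x => complex.Re (f x))) /\
  mu.-integrable setT (EFin \o (fun x => complex.Im (f x))).

Lemma cintegrable_meas f : cintegrable f -> cmeasurable f.
Proof.
by move=> [/integrableP[/measurable_EFinP ? _] /integrableP[/measurable_EFinP ? _]].
Qed.

Lemma cintegrable_dom f (B : T -> R) : cmeasurable f ->
  mu.-integrable setT (EFin \o B) ->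
  (forall x, `|complex.Re (f x)| <= B x /\ `|complex.Im (f x)| <= B x) ->
  cintegrable f.
Proof.
move=> [fr fi] iB fB; split; apply: le_integrable iB => //.
- exact/measurable_EFinP.
- move=> x _ /=; rewrite lee_fin (le_trans (fB x).1)// ler_norm//.
- exact/measurable_EFinP.
- move=> x _ /=; rewrite lee_fin (le_trans (fB x).2)// ler_norm//.
Qed.

Lemma cintegrableZD (a : C) f g : cintegrable f -> cintegrable g ->
  cintegrable (fun x => a * f x + g x).
Proof.
move=> [fr fi] [gr gi]; split; rewrite /comp/=.
  under eq_fun do rewrite cReD cReM EFinD EFinB !EFinM.
  by apply: integrableD => //; apply: integrableB => //; exact: integrableZl.
under eq_fun do rewrite cImD cImM EFinD EFinD !EFinM.
by apply: integrableD => //; apply: integrableD => //; exact: integrableZl.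
Qed.

Lemma cintegralZD (a : C) f g : cintegrable f -> cintegrable g ->
  cintegral mu (fun x => a * f x + g x) = a * cintegral mu f + cintegral mu g.
Proof.
move=> [fr fi] [gr gi].
have Z (r : R) (k : T -> R) : mu.-integrable setT (EFin \o k) ->
    mu.-integrable setT (EFin \o (fun x => r * k x)).
  by move=> ik; have := integrableZl measurableT r ik.
apply/complex_ext; rewrite !(cReD, cImD, cReM, cImM) /cintegral /=.
  under eq_Rintegral do rewrite cReD cReM.
  rewrite RintegralD// ?RintegralB// ?RintegralZl//; try exact: Z.
  rewrite /comp; under eq_fun do rewrite EFinB.
  by apply: integrableB => //; exact: Z.
under eq_Rintegral do rewrite cImD cImM.
rewrite RintegralD// ?RintegralD// ?RintegralZl//; try exact: Z.
rewrite /comp; under eq_fun do rewrite EFinD.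
by apply: integrableD => //; exact: Z.
Qed.

Lemma cintegrable0 : cintegrable (fun=> 0).
Proof. by split; exact: integrable0. Qed.

Lemma cintegral0 : cintegral mu (fun=> 0) = 0.
Proof. by apply/complex_ext; rewrite /cintegral/= /Rintegral integral0. Qed.

Lemma cintegralZ (a : C) f : cintegrable f ->
  cintegral mu (fun x => a * f x) = a * cintegral mu f.
Proof.
move=> mf; rewrite -[RHS]addr0 -cintegral0 -cintegralZD//; last exact: cintegrable0.
by congr cintegral; apply/funext => x; rewrite addr0.
Qed.

Lemma cintegrableZ (a : C) f : cintegrable f -> cintegrable (fun x => a * f x).
Proof.
move=> /(cintegrableZD a)/(_ cintegrable0).
by congr cintegrable; apply/funext => x; rewrite addr0.
Qed.

Lemma cintegrableD f g : cintegrable f -> cintegrable g ->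
  cintegrable (fun x => f x + g x).
Proof.
move=> /(cintegrableZD 1) /[apply].
by congr cintegrable; apply/funext => x; rewrite mul1r.
Qed.

Lemma cintegralD f g : cintegrable f -> cintegrable g ->
  cintegral mu (fun x => f x + g x) = cintegral mu f + cintegral mu g.
Proof.
move=> If Ig; rewrite -[in RHS](mul1r (cintegral mu f)) -cintegralZD//.
by congr cintegral; apply/funext => x; rewrite mul1r.
Qed.

Lemma cintegrable_sum I (s : seq I) (F : I -> T -> C) :
  (forall i, cintegrable (F i)) -> cintegrable (fun x => \sum_(i <- s) F i x).
Proof.
move=> mF; elim: s => [|i s ih].
  by under eq_fun do rewrite big_nil; exact: cintegrable0.
by under eq_fun do rewrite big_cons; exact: cintegrableD.
Qed.

Lemma cintegral_sum I (s : seq I) (F : I -> T -> C) :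
  (forall i, cintegrable (F i)) ->
  cintegral mu (fun x => \sum_(i <- s) F i x) = \sum_(i <- s) cintegral mu (F i).
Proof.
move=> iF; elim: s => [|i s ih].
  by rewrite big_nil -[RHS]cintegral0; congr cintegral; apply/funext => x; rewrite big_nil.
rewrite big_cons -ih -cintegralD//; last exact: cintegrable_sum.
by congr cintegral; apply/funext => x; rewrite big_cons.
Qed.

Lemma cintegral_conj f : cintegrable f ->
  cintegral mu (fun x => conjc (f x)) = conjc (cintegral mu f).
Proof.
move=> [fr fi]; apply/complex_ext; rewrite ?(cRe_conj, cIm_conj) /cintegral/=.
  by under eq_Rintegral do rewrite cRe_conj.
under eq_Rintegral do rewrite cIm_conj -mulN1r.
by rewrite RintegralZl// mulN1r.
Qed.

Lemma ae_eq_cintegral f g : cmeasurable f -> cmeasurable g ->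
  (\forall x \ae mu, f x = g x) -> cintegral mu f = cintegral mu g.
Proof.
move=> [fr fi] [gr gi] fg; apply/complex_ext; rewrite /cintegral/= /Rintegral.
- congr fine; apply: ae_eq_integral => //; try exact/measurable_EFinP.
  by apply: filterS fg => x /= ->.
- congr fine; apply: ae_eq_integral => //; try exact/measurable_EFinP.
  by apply: filterS fg => x /= ->.
Qed.

Lemma L2fun_integrable f : L2fun mu f ->
  mu.-integrable setT (EFin \o (fun x => abs2 (f x))).
Proof.
move=> [mf foo]; apply/integrableP; split; first exact: measurable_abs2.
under eq_integral do rewrite gee0_abs ?lee_fin ?abs2_ge0//.
exact: foo.
Qed.

Lemma L2fun_prod f g : L2fun mu f -> L2fun mu g ->
  cintegrable (fun x => conjc (f x) * g x).
Proof.
move=> Lf Lg; have [mf _] := Lf; have [mg _] := Lg.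
apply: (@cintegrable_dom _ (fun x => abs2 (f x) + abs2 (g x))).
- by apply: cmeasurableM => //; exact: cmeasurable_conj.
- rewrite /comp; under eq_fun do rewrite EFinD.
  by apply: integrableD => //; exact: L2fun_integrable.
have h (a b c e : R) : `|a * b + c * e| <= a ^+ 2 + c ^+ 2 + (b ^+ 2 + e ^+ 2).
  have k (x y : R) : `|x * y| <= x ^+ 2 + y ^+ 2.
    by rewrite ler_norml; apply/andP; split; nra.
  by rewrite (le_trans (ler_normD _ _))// [leRHS]addrACA lerD.
move=> x; rewrite /abs2 cReM cImM cRe_conj cIm_conj mulNr opprK mulNr; split.
  exact: h.
rewrite -mulrN (le_trans (h _ _ _ _))// sqrrN.
by rewrite [X in _ + X]addrC lexx.
Qed.

Lemma L2funZD (a : C) f g : L2fun mu f -> L2fun mu g ->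
  L2fun mu (fun x => a * f x + g x).
Proof.
move=> [mf foo] [mg goo]; split; first exact: cmeasurableZD.
rewrite (le_lt_trans (L2norm2ZD _ _ mf mg))// lte_add_pinfty//.
  by rewrite lte_mul_pinfty// lee_fin mulr_ge0// abs2_ge0.
by rewrite lte_mul_pinfty// lee_fin.
Qed.

Lemma L2norm20 : L2norm2 mu (fun=> 0) = 0%E.
Proof. by rewrite /L2norm2 integral0_eq// => x _; rewrite abs20. Qed.

Lemma L2fun0 : L2fun mu (fun=> 0).
Proof. by split; [exact: cmeasurable_cst|rewrite L2norm20]. Qed.

Lemma L2funZ (a : C) f : L2fun mu f -> L2fun mu (fun x => a * f x).
Proof.
move=> /(L2funZD a)/(_ L2fun0).
by congr L2fun; apply/funext => x; rewrite addr0.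
Qed.

Lemma L2funD f g : L2fun mu f -> L2fun mu g -> L2fun mu (fun x => f x + g x).
Proof.
move=> /(L2funZD 1) /[apply].
by congr L2fun; apply/funext => x; rewrite mul1r.
Qed.

Lemma L2funB f g : L2fun mu f -> L2fun mu g -> L2fun mu (fun x => f x - g x).
Proof.
move=> Lf Lg; have := L2funZD (-1) Lg Lf.
by congr L2fun; apply/funext => x; rewrite mulN1r addrC.
Qed.

Lemma L2fun_sum I (s : seq I) (F : I -> T -> C) :
  (forall i, L2fun mu (F i)) -> L2fun mu (fun x => \sum_(i <- s) F i x).
Proof.
move=> mF; elim: s => [|i s ih].
  by under eq_fun do rewrite big_nil; exact: L2fun0.
by under eq_fun do rewrite big_cons; exact: L2funD.
Qed.

Lemma L2fun_le f g : L2fun mu f -> cmeasurable g ->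
  (forall x, abs2 (g x) <= abs2 (f x)) -> L2fun mu g.
Proof.
move=> [mf foo] mg gf; split => //; apply: le_lt_trans foo.
by apply: ae_le_lower_integral => [x|x|]; rewrite ?lee_fin ?abs2_ge0//;
  apply/nearW => x; rewrite lee_fin.
Qed.

Lemma ae_eq_L2norm2 f g : (\forall x \ae mu, f x = g x) ->
  L2norm2 mu f = L2norm2 mu g.
Proof.
move=> fg; apply: ae_eq_lower_integral => [x|x|]; rewrite ?lee_fin ?abs2_ge0//.
by apply: filterS fg => x ->.
Qed.

Definition ldot f g : C := cintegral mu (fun x => conjc (f x) * g x).

Lemma ldotC f g : L2fun mu f -> L2fun mu g -> ldot g f = conjc (ldot f g).
Proof.
move=> Lf Lg; rewrite /ldot -cintegral_conj; last exact: L2fun_prod.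
by congr cintegral; apply/funext => x; rewrite conjcM conjcK mulrC.
Qed.

Lemma ldotZD (a : C) f g h : L2fun mu f -> L2fun mu g -> L2fun mu h ->
  ldot f (fun x => a * g x + h x) = a * ldot f g + ldot f h.
Proof.
move=> Lf Lg Lh; rewrite /ldot -cintegralZD; try exact: L2fun_prod.
by congr cintegral; apply/funext => x; rewrite mulrDr mulrCA.
Qed.

Lemma ldotxx f : L2fun mu f -> ldot f f = ((fine (L2norm2 mu f))%:C)%C.
Proof.
move=> Lf; apply/complex_ext; rewrite /ldot /cintegral /=.
  rewrite /Rintegral /L2norm2; congr fine; apply: eq_integral => x _.
  by rewrite mulJ_abs2.
rewrite /Rintegral integral0_eq// => x _.
by rewrite mulJ_abs2.
Qed.

Lemma L2norm2_fin f : L2fun mu f -> L2norm2 mu f \is a fin_num.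
Proof. by move=> [_ foo]; rewrite ge0_fin_numE ?L2norm2_ge0. Qed.

Lemma L2norm2_eq0 f : cmeasurable f -> L2norm2 mu f = 0%E ->
  \forall x \ae mu, f x = 0.
Proof.
move=> mf f0; have : (\int[mu]_x `|(abs2 (f x))%:E|)%E = 0%E.
  by rewrite -[RHS]f0; apply: eq_integral => x _; rewrite gee0_abs ?lee_fin ?abs2_ge0.
move/(ae_eq_integral_abs _ measurableT (measurable_abs2 mf)).1.
by apply: filterS => x /(_ I)[] /abs2_eq0.
Qed.

Lemma eq_L2norm2 f g : (forall x, abs2 (f x) = abs2 (g x)) ->
  L2norm2 mu f = L2norm2 mu g.
Proof. by move=> fg; apply: eq_integral => x _; rewrite fg. Qed.

Lemma L2norm2Z (a : C) f : cmeasurable f ->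
  L2norm2 mu (fun x => a * f x) = ((abs2 a)%:E * L2norm2 mu f)%E.
Proof.
move=> mf; rewrite /L2norm2 -ge0_integralZl//.
- by apply: eq_integral => x _; rewrite abs2M EFinM.
- exact: measurable_abs2.
- by move=> x _; rewrite lee_fin abs2_ge0.
- by rewrite lee_fin abs2_ge0.
Qed.

Lemma L2norm2D f g : cmeasurable f -> cmeasurable g ->
  (L2norm2 mu (fun x => f x + g x)%R <= 2%:E * L2norm2 mu f + 2%:E * L2norm2 mu g)%E.
Proof.
move=> mf mg; have := L2norm2ZD mu 1 mf mg.
rewrite (_ : abs2 1 = 1) ?mulr1; last by rewrite /abs2 /= expr1n expr0n addr0.
by congr (_ <= _)%E; apply: eq_L2norm2 => x; rewrite mul1r.
Qed.

Lemma L2norm2BC f g : L2norm2 mu (fun x => f x - g x) = L2norm2 mu (fun x => g x - f x).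
Proof. by apply: eq_L2norm2 => x; rewrite -abs2N opprB. Qed.

End complex_integral.

(** * Completeness of L^2, together with almost everywhere convergence of a subsequence *)

Section L2_complete.
Context d (T : measurableType d) (R : realType).
Variable mu : {measure set T -> \bar R}.
Local Notation C := R[i].

Definition pointwise_ae (u : nat -> T -> C) (g : T -> C) : Prop :=
  \forall x \ae mu, complex.Re (u k x) @[k --> \oo] --> complex.Re (g x) /\
    complex.Im (u k x) @[k --> \oo] --> complex.Im (g x).

(** The sum [S] of the squared increments weighted by 2^k is integrable: in the assumed bound one
    factor cancels the weight and the other sums to 1. Where [S] is finite the increments themselves
    are summable. *)
Lemma fast_cauchy_cvg_ae (u : nat -> T -> C) : (forall k, cmeasurable (u k)) ->
  (forall k, L2norm2 mu (fun x => (u k.+1 x - u k x)%R) <=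
     ((2 ^+ k)^-1 * (1 / (2 ^ (k + 1))%:R))%:E)%E ->
  exists g, cmeasurable g /\ pointwise_ae u g.
Proof.
move=> mu_ u_fast.
pose dk k x : R := abs2 (u k.+1 x - u k x).
have dk0 k x : 0 <= dk k x by exact: abs2_ge0.
pose s k x : \bar R := (2 ^+ k * dk k x)%:E.
have s0 k x : (0 <= s k x)%E by rewrite lee_fin mulr_ge0// exprn_ge0.
have mdk k : measurable_fun setT (EFin \o dk k).
  by apply: measurable_abs2; exact: cmeasurableB.
have ms k : measurable_fun setT (s k).
  rewrite /s; under eq_fun do rewrite EFinM.
  exact: measurable_funeM (mdk k).
pose S x : \bar R := (\sum_(0 <= k <oo) s k x)%E.
have mS : measurable_fun setT S by apply: ge0_emeasurable_sum.
have S0 x : (0 <= S x)%E by apply: nneseries_ge0.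
have Soo : (\int[mu]_x S x <= 1%:E)%E.
  rewrite integral_nneseries//.
  have -> : 1%:E = (\sum_(0 <= k <oo) (1 / (2 ^ (k + 1))%:R)%:E)%E :> \bar R.
    have /cvg_lim : eseries (fun k => (1 / (2 ^ (k + 1))%:R)%:E) x @[x --> \oo] --> (1 / 2 ^+ 0 : R)%:E.
      exact: cvg_geometric_eseries_half.
    by rewrite expr0 divr1 => <-.
  apply: lee_nneseries => [k _ _|k _].
    by apply: integral_ge0 => x _.
  rewrite /s; under eq_integral do rewrite EFinM.
  rewrite ge0_integralZl//; [|exact: mdk|by move=> x _; rewrite lee_fin].
  have := u_fast k; rewrite EFinM -[X in (X <= _)%E]/(\int[mu]_x (dk k x)%:E)%E.
  rewrite -(@lee_pmul2l _ (2 ^+ k)%:E)// ?lte_fin ?exprn_gt0//.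
  by rewrite muleA -(EFinM (2 ^+ k)) divff ?mul1e// expf_neq0// pnatr_eq0.
have iS : mu.-integrable setT S.
  apply/integrableP; split => //; under eq_integral do rewrite gee0_abs//.
  exact: le_lt_trans Soo (ltry _).
(* Setting [u] to 0 outside [A] makes the sequence converge at every point, so that its limit is
   measurable on the whole space. *)
pose A := [set x | S x < +oo]%E.
have mA : measurable A.
  by rewrite -[A]setTI; apply: emeasurable_fun_infty_o.
pose v k x : C := ((\1_A x)%:C)%C * u k x.
have mv k : cmeasurable (v k).
  by apply: cmeasurableM => //; apply: cmeasurable_real.
have inc (p : C -> R) : (forall z w, p (z - w) = p z - p w) ->
    (forall z, p z ^+ 2 <= abs2 z) -> (forall z x, p (((\1_A x)%:C)%C * z) = \1_A x * p z) ->
    forall x, cvgn (fun k => p (v k x)).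
  move=> pB pz pA x; have [Ax|Ax] := pselect (A x); last first.
    apply: (@summable_increments_cvg _ _ 0) => n.
    by rewrite big1// => i _; rewrite /v -pB -mulrBr pA indicE memNset// mul0r normr0.
  apply: (@summable_increments_cvg _ _ (2 + fine (S x))) => n.
  have Sfin : S x \is a fin_num by rewrite ge0_fin_numE.
  apply: (@le_trans _ _ (\sum_(i < n) ((2 ^+ i)^-1 + 2 ^+ i * dk i x))).
    apply: ler_sum => i _; rewrite /v -pB -mulrBr pA indicE mem_set// mul1r.
    have := pz (u i.+1 x - u i x); rewrite -/(dk i x).
    move: (p _) => r rd; have a0 : 0 < 2 ^+ i :> R by rewrite exprn_gt0.
    (* With a = 2^i this is |r| <= 1/a + a r^2, i.e. |a r| <= 1 + (a r)^2 after multiplication by a: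
       a square-summability bound becomes a summability bound. *)
    apply: (@le_trans _ _ ((2 ^+ i)^-1 + 2 ^+ i * r ^+ 2)); last first.
      by rewrite lerD2l ler_wpM2l// ltW.
    rewrite -(@ler_pM2l _ (2 ^+ i))// mulrDr divff ?gt_eqF// mulrA -expr2 -exprMn.
    rewrite -{1}(ger0_norm (ltW a0)) -normrM.
    by move: (_ * r) => y; rewrite ler_norml; apply/andP; split; nra.
  rewrite big_split/= lerD//.
    suff -> : \sum_(i < n) (2 ^+ i)^-1 = 2 - 2 * (2 ^+ n)^-1 :> R.
      by rewrite gerBl mulr_ge0// invr_ge0 exprn_ge0.
    elim: n => [|n ih]; first by rewrite big_ord0 expr0 invr1 mulr1 subrr.
    rewrite big_ord_recr/= ih exprS invfM.
    by move: ((2 ^+ n)^-1) => y; field.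
  rewrite -lee_fin fineK// -sumEFin.
  have := @nneseries_lim_ge R (fun k => s k x) xpredT 0 n (fun k _ _ => s0 k x).
  by rewrite big_mkord.
have cR := inc (@complex.Re R) (fun z w => etrans (cReD _ _) (congr1 _ (cReN _)))
  (@sqr_Re_le R) (fun z x => cReMl _ _).
have cI := inc (@complex.Im R) (fun z w => etrans (cImD _ _) (congr1 _ (cImN _)))
  (@sqr_Im_le R) (fun z x => cImMl _ _).
exists (fun x => Complex (limn (fun k => complex.Re (v k x))) (limn (fun k => complex.Im (v k x)))).
split.
  split => /=.
    apply: (@measurable_fun_cvg _ _ _ setT (fun k x => complex.Re (v k x))) => [k|x _].
      by have [] := mv k.
    exact: cR.
  apply: (@measurable_fun_cvg _ _ _ setT (fun k x => complex.Im (v k x))) => [k|x _].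
    by have [] := mv k.
  exact: cI.
have := integrable_ae measurableT iS; apply: filterS => x /(_ I) Sx /=.
have Ax : A x by rewrite /A/= -ge0_fin_numE.
have vu k : v k x = u k x by rewrite /v indicE mem_set// mul1r.
have := cR x; have := cI x; under eq_fun do rewrite vu; move=> ?.
by under eq_fun do rewrite vu.
Qed.

Lemma L2norm2_liminf (u : nat -> T -> C) g (e : \bar R) : (forall k, cmeasurable (u k)) ->
  cmeasurable g -> pointwise_ae u g -> (\forall k \near \oo, (L2norm2 mu (u k) <= e)%E) ->
  (L2norm2 mu g <= e)%E.
Proof.
move=> mu_ mg ug ue.
apply: (@le_trans _ _ (\int[mu]_x limn_einf (fun k => (abs2 (u k x))%:E))%E).
  apply: ae_le_lower_integral => [x|x|].
  - by rewrite lee_fin abs2_ge0.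
  - rewrite limn_einf_lim; apply: lime_ge; first exact: is_cvg_einfs.
    apply: nearW => n; apply: le_ereal_inf_tmp => _ [m _ <-].
    by rewrite lee_fin abs2_ge0.
  apply: filterS ug => x [ur ui].
  have cu : (abs2 (u k x))%:E @[k --> \oo] --> (abs2 (g x))%:E.
    apply: cvg_EFin; first exact: nearW.
    have sq (a : nat -> R) (l : R) : a k @[k --> \oo] --> l -> a k ^+ 2 @[k --> \oo] --> l ^+ 2.
      by move=> al; rewrite expr2; under eq_fun do rewrite expr2; exact: cvgM.
    by rewrite /comp /abs2; apply: cvgD; exact: sq.
  by rewrite (cvg_limn_einf_sup cu).1.
apply: (@le_trans _ _ (limn_einf (fun k => L2norm2 mu (u k)))).
  apply: fatou => //; first by move=> k; exact: measurable_abs2.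
  by move=> k x _; rewrite lee_fin abs2_ge0.
rewrite limn_einf_lim; apply: lime_le; first exact: is_cvg_einfs.
apply: filterS ue => n ne; apply: le_trans ne.
by apply: ereal_inf_lbound; exists n => //=.
Qed.

(** The almost everywhere convergence along [phi] is returned as well, because pointwise properties
    such as antisymmetry are passed to the limit through it. *)
Lemma L2_complete (u : nat -> T -> C) : (forall k, L2fun mu (u k)) ->
  (forall e : R, 0 < e -> exists N, forall i j, (N <= i)%N -> (N <= j)%N ->
     (L2norm2 mu (fun x => (u i x - u j x)%R) <= e%:E)%E) ->
  exists g (phi : nat -> nat), [/\ L2fun mu g, pointwise_ae (u \o phi) g &
    forall e : R, 0 < e -> exists N, forall k, (N <= k)%N ->
     (L2norm2 mu (fun x => (u k x - g x)%R) <= e%:E)%E].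
Proof.
move=> Lu uC.
have mu_ k : cmeasurable (u k) by have [] := Lu k.
pose e k : R := (2 ^+ k)^-1 * (1 / (2 ^ (k + 1))%:R).
have e0 k : 0 < e k by rewrite /e mulr_gt0// ?invr_gt0 ?exprn_gt0// divr_gt0// ltr0n expn_gt0.
have /choice[N NP] := fun k => uC (e k) (e0 k).
(* Taking the maximum over all earlier indices puts both [phi k] and [phi k.+1] beyond [N k];
   including [i] itself makes [phi] unbounded. *)
pose phi k := (\max_(i < k.+1) maxn (N i) i)%N.
have Nphi k i : (i <= k)%N -> (N i <= phi k)%N.
  move=> ik; apply: leq_trans (leq_maxl (N i) i) _.
  by rewrite (leq_bigmax (Ordinal (ik : i < k.+1)%N)).
have phik k : (k <= phi k)%N.
  apply: leq_trans (leq_maxr (N k) k) _.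
  by rewrite (leq_bigmax (Ordinal (leqnn k.+1))).
have [k|k|g [mg ug]] := @fast_cauchy_cvg_ae (u \o phi).
- exact: mu_.
- by apply: NP; exact: Nphi.
(* Fatou's lemma in [j], with [k] fixed, for the differences of [u k] and [u (phi j)]: the whole
   sequence converges, not only the subsequence. *)
have ulim (r : R) : 0 < r -> exists M, forall k, (M <= k)%N ->
    (L2norm2 mu (fun x => (u k x - g x)%R) <= r%:E)%E.
  move=> /uC[M MP]; exists M => k Mk.
  apply: (@L2norm2_liminf (fun j x => u k x - (u \o phi) j x)).
  - by move=> j; exact: (cmeasurableB (mu_ k) (mu_ (phi j))).
  - exact: cmeasurableB.
  - apply: filterS ug => x [ur ui]; split.
      under eq_fun do rewrite cReD cReN; rewrite cReD cReN.
      by apply: cvgB => //; exact: cvg_cst.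
    under eq_fun do rewrite cImD cImN; rewrite cImD cImN.
    by apply: cvgB => //; exact: cvg_cst.
  - exists M => // j /= Mj; apply: MP => //; exact: leq_trans Mj (phik j).
exists g, phi; split => //.
have [M MP] := ulim 1 ltr01.
have [_ uMoo] := Lu M; split => //.
rewrite (@eq_L2norm2 _ _ _ mu g (fun x => (g x - u M x) + u M x)); last first.
  by move=> x; rewrite subrK.
rewrite (le_lt_trans (L2norm2D _ (cmeasurableB mg (mu_ M)) (mu_ M)))//.
rewrite lte_add_pinfty// lte_mul_pinfty// ?lee_fin//.
by rewrite L2norm2BC (le_lt_trans (MP M (leqnn _)))// ltry.
Qed.

End L2_complete.

(** * Integration over tuples *)

Section tuple_integration.
Context d (T : measurableType d) (R : realType).
Variable m : {sigma_finite_measure set T -> \bar R}.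
Local Notation lam := (tuple_measure m).
Local Notation C := R[i].

Lemma measurable_tcons n : measurable_fun setT (@tcons d T n).
Proof. exact: measurable_cons. Qed.

Lemma measurable_tconsr n (x : T) :
  measurable_fun setT (fun t : n.-tuple T => tcons (x, t)).
Proof.
apply: (@measurable_cons _ _ _ _ (fun=> x) n id); last exact: measurable_id.
exact: measurable_cst.
Qed.

Lemma measurable_tconsl n (t : n.-tuple T) :
  measurable_fun setT (fun x : T => tcons (x, t)).
Proof.
apply: (@measurable_cons _ _ _ _ id n (fun=> t)); first exact: measurable_id.
exact: measurable_cst.
Qed.

Lemma measurable_thead n : measurable_fun setT (fun u : n.+1.-tuple T => thead u).
Proof. exact: measurable_tnth. Qed.

Definition tbehead n (u : n.+1.-tuple T) : n.-tuple T := [tuple of behead u].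

Lemma measurable_tbehead n : measurable_fun setT (@tbehead n).
Proof. exact: measurable_behead. Qed.

Lemma tcons_eta n (u : n.+1.-tuple T) : tcons (thead u, tbehead u) = u.
Proof. by rewrite [RHS]tuple_eta; exact: val_inj. Qed.

Lemma thead_tcons n x (t : n.-tuple T) : thead (tcons (x, t)) = x.
Proof. by []. Qed.

Lemma tbehead_tcons n x (t : n.-tuple T) : tbehead (tcons (x, t)) = t.
Proof. exact: val_inj. Qed.

Lemma tnth_tcons_lift n x (t : n.-tuple T) i : tnth (tcons (x, t)) (lift ord0 i) = tnth t i.
Proof. by rewrite tnthS. Qed.

Lemma lamSE n A : lam n.+1 A = (m \x lam n)%E (@tcons d T n @^-1` A).
Proof. by []. Qed.

Lemma ge0_integral_tcons n (f : n.+1.-tuple T -> \bar R) :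
  measurable_fun setT f -> (forall u, (0 <= f u)%E) ->
  (\int[lam n.+1]_u f u = \int[m \x lam n]_p f (tcons p))%E.
Proof.
move=> mf f0.
pose pf : {measure set _ -> \bar R} :=
  measure_function_pushforward__canonical__measure_function_Measure
    (m \x lam n)%E (@measurable_tcons n).
transitivity (\int[pushforward (m \x lam n)%E (@tcons d T n)]_u f u)%E.
  exact: (@eq_measure_integral _ _ _ _ pf (lam n.+1)).
by rewrite (ge0_integral_pushforward (@measurable_tcons n)).
Qed.

Lemma tonelli1 n (f : n.+1.-tuple T -> \bar R) :
  measurable_fun setT f -> (forall u, (0 <= f u)%E) ->
  (\int[lam n.+1]_u f u = \int[m]_x \int[lam n]_t f (tcons (x, t)))%E.
Proof.
move=> mf f0; rewrite ge0_integral_tcons// fubini_tonelli1//.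
exact: measurableT_comp mf (@measurable_tcons n).
Qed.

Lemma tonelli2 n (f : n.+1.-tuple T -> \bar R) :
  measurable_fun setT f -> (forall u, (0 <= f u)%E) ->
  (\int[lam n.+1]_u f u = \int[lam n]_t \int[m]_x f (tcons (x, t)))%E.
Proof.
move=> mf f0; rewrite ge0_integral_tcons// fubini_tonelli2//.
exact: measurableT_comp mf (@measurable_tcons n).
Qed.

Lemma measurable_tonelli1 n (f : n.+1.-tuple T -> \bar R) :
  measurable_fun setT f -> (forall u, (0 <= f u)%E) ->
  measurable_fun setT (fun x => \int[lam n]_t f (tcons (x, t)))%E.
Proof.
move=> mf f0; apply: (@measurable_fun_fubini_tonelli_F _ _ _ _ _ _ (f \o @tcons d T n)).
  exact: measurableT_comp mf (@measurable_tcons n).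
by move=> p; exact: f0.
Qed.

Lemma ae_thead n (P : T -> Prop) : (\forall x \ae m, P x) ->
  \forall u \ae lam n.+1, P (thead u).
Proof.
move=> [N [mN N0 PN]]; exists [set u | N (thead u)]; split.
- by rewrite -[X in measurable X]setTI; exact: measurable_thead.
- rewrite lamSE (_ : _ @^-1` _ = N `*` setT); last first.
    by apply/seteqP; split => [[x t]|[x t] []].
  transitivity (m N * lam n setT)%E; first exact: product_measure1E.
  by rewrite N0 mul0e.
- by move=> u Pu; exact: PN.
Qed.

Lemma ae_tbehead n (P : n.-tuple T -> Prop) : (\forall t \ae lam n, P t) ->
  \forall u \ae lam n.+1, P (tbehead u).
Proof.
move=> [N [mN N0 PN]]; exists [set u | N (tbehead u)]; split.
- by rewrite -[X in measurable X]setTI; exact: measurable_tbehead.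
- rewrite lamSE (_ : _ @^-1` _ = setT `*` N); last first.
    by apply/seteqP; split => [[x t]|[x t] []]; rewrite /= ?tbehead_tcons.
  transitivity (m setT * lam n N)%E; first exact: product_measure1E.
  by rewrite N0 mule0.
- by move=> u Pu; exact: PN.
Qed.

(** By Tonelli the measures of the slices of a null set integrate to 0, hence almost all of them
    vanish. *)
Lemma ae_slice n (P : n.+1.-tuple T -> Prop) : (\forall u \ae lam n.+1, P u) ->
  \forall x \ae m, \forall t \ae lam n, P (tcons (x, t)).
Proof.
move=> [N [mN N0 PN]].
have m1 : measurable_fun setT (fun u : n.+1.-tuple T => (\1_N u)%:E : \bar R).
  by apply/measurable_EFinP; exact: measurable_indic.
have mF := measurable_tonelli1 m1 (fun u => ltac:(by rewrite lee_fin)).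
have : (\int[m]_x `|\int[lam n]_t (\1_N (tcons (x, t)))%:E| = 0)%E.
  rewrite -N0 -[in RHS](setIT N) -integral_indic// tonelli1//.
  apply: eq_integral => x _; rewrite gee0_abs//.
  by apply: integral_ge0 => t _; rewrite lee_fin.
move/(ae_eq_integral_abs _ measurableT mF).1; apply: filterS => x /(_ I).
have mx : measurable [set t | N (tcons (x, t))].
  by rewrite -[X in measurable X]setTI; exact: measurable_tconsr.
rewrite (_ : (fun t => _) = (fun t => (\1_[set t | N (tcons (x, t))] t)%:E)); last first.
  apply/funext => t; rewrite !indicE; congr (_%:R%:E).
rewrite integral_indic// setIT => Nx; exists [set t | N (tcons (x, t))]; split => //.
by move=> t /PN.
Qed.

Definition tuple_box n (B : 'I_n -> set T) : set (n.-tuple T) :=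
  [set t | forall i, B i (tnth t i)].

Lemma measurable_tuple_box n (B : 'I_n -> set T) : (forall i, measurable (B i)) ->
  measurable (tuple_box B).
Proof.
move=> mB; rewrite (_ : tuple_box B = \bigcap_(i in [set: 'I_n]) [set t | B i (tnth t i)]).
  apply: fin_bigcap_measurable; first exact: finite_finset.
  move=> i _; rewrite -[X in measurable X]setTI; exact: measurable_tnth.
by apply/seteqP; split => t /= Bt i; [move=> _; exact: Bt|exact: Bt].
Qed.

Lemma lam_tuple_box n (B : 'I_n -> set T) : (forall i, measurable (B i)) ->
  lam n (tuple_box B) = \big[mule/1%E]_(i < n) m (B i).
Proof.
elim: n B => [|n ih] B mB.
  rewrite big_ord0 /= diracE mem_set//.
  by move=> -[].
rewrite lamSE big_ord_recl.
rewrite (_ : _ @^-1` _ = B ord0 `*` tuple_box (fun i => B (lift ord0 i))).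
  by rewrite product_measure1E// ?ih//; exact: measurable_tuple_box.
apply/seteqP; split => [[x t] Bt|[x t] [/= Bx Bt] i].
  split => [|i]; first exact: (Bt ord0).
  by have := Bt (lift ord0 i); rewrite tnth_tcons_lift.
case: (unliftP ord0 i) => [j ->|->//]; rewrite tnth_tcons_lift; exact: Bt.
Qed.

Definition tuple_boxes n : set (set (n.-tuple T)) :=
  [set A | exists B, (forall i, measurable (B i)) /\ A = @tuple_box n B].

Lemma measurable_tupleE n : @measurable _ (n.-tuple T) = <<s @tuple_boxes n >>.
Proof.
apply/seteqP; split.
  apply: smallest_sub; first exact: smallest_sigma_algebra.
  rewrite -bigcup_seq; apply: bigcup_sub => i _ A [A' mA' <-].
  apply: sub_sigma_algebra; exists (fun j => if j == i then A' else setT); split.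
    by move=> j; case: ifP.
  rewrite setTI; apply/seteqP; split => t /= At.
    by move=> j; case: eqP => // ->.
  by have := At i; rewrite eqxx.
apply: smallest_sub; first exact: sigma_algebra_measurable.
by move=> _ [B [mB ->]]; exact: measurable_tuple_box.
Qed.

(** Boxes are stable under intersection and generate the measurable sets, and an exhaustion by sets
    of finite measure in one variable yields an exhaustion by boxes of finite measure. *)
Lemma lam_unique n (mu : {measure set (n.-tuple T) -> \bar R}) :
  (forall B, (forall i, measurable (B i)) ->
    mu (tuple_box B) = \big[mule/1%E]_(i < n) m (B i)) ->
  forall A, measurable A -> lam n A = mu A.
Proof.
move=> muB A mA.
have /sigma_finiteP[F [FT ndF Foo]] := sigma_finiteT m.
have mF k : measurable (F k) by have [] := Foo k.
apply: (measure_unique (@tuple_boxes n) (fun k => tuple_box (fun=> F k))) => //.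
- exact: measurable_tupleE.
- move=> _ _ [B [mB ->]] [B' [mB' ->]].
  exists (fun i => B i `&` B' i); split; first by move=> i; exact: measurableI.
  by apply/seteqP; split => t /= => [[Bt B't] i|BB']; split => // i; have [] := BB' i.
- by move=> k; exists (fun=> F k).
- apply/seteqP; split => // t _.
  have /choice[k kP] : forall i : 'I_n, exists k, F k (tnth t i).
    by move=> i; have : setT (tnth t i) by []; rewrite FT => -[k _ ?]; exists k.
  exists (\max_i k i)%N => // i; apply: subsetPset (kP i).
  by apply/ndF; exact: leq_bigmax.
- by move=> _ [B [mB ->]]; exact: etrans (lam_tuple_box mB) (esym (muB _ mB)).
- move=> k; apply: (@le_lt_trans _ _ (\big[mule/1%E]_(i < n) m (F k))).
    by rewrite le_eqVlt; apply/orP; left; apply/eqP; exact: lam_tuple_box.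
  suff /andP[] : (0 <= \big[mule/1%E]_(i < n) m (F k) < +oo)%E by [].
  elim/big_ind : _ => [|x y /andP[x0 xoo] /andP[y0 yoo]|i _].
  + by rewrite lee01 ltry.
  + by rewrite mule_ge0//= lte_mul_pinfty// ge0_fin_numE.
  + by have [_ ->] := Foo k; rewrite measure_ge0.
Qed.

Lemma measurable_tperm n (s : 'S_n) : measurable_fun setT (@tperm_tuple d T n s).
Proof.
apply/measurable_fun_tnthP => i.
rewrite (_ : _ \o _ = fun t => tnth t (s i)); first exact: measurable_tnth.
by apply/funext => t /=; rewrite tnth_mktuple.
Qed.

Lemma tperm_tupleM n (s r : 'S_n) (t : n.-tuple T) :
  tperm_tuple s (tperm_tuple r t) = tperm_tuple (s * r)%g t.
Proof. by apply: eq_from_tnth => i; rewrite !tnth_mktuple permM. Qed.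

(** The measure is built by prepending one coordinate at a time, so its symmetry is not visible. On
    boxes it is a product over the coordinates, which does not depend on their order. *)
Lemma lam_tperm n (s : 'S_n) A : measurable A ->
  lam n (@tperm_tuple d T n s @^-1` A) = lam n A.
Proof.
move=> mA.
pose pf : {measure set _ -> \bar R} :=
  measure_function_pushforward__canonical__measure_function_Measure
    (lam n) (@measurable_tperm n s).
rewrite -[LHS]/(pf A); apply/esym/lam_unique => // B mB.
rewrite -[LHS]/(lam n (@tperm_tuple d T n s @^-1` tuple_box B)).
rewrite (_ : _ @^-1` _ = tuple_box (fun i => B ((s^-1)%g i))).
  rewrite lam_tuple_box// (reindex_inj (@perm_inj _ s))/=.
  by apply: eq_bigr => i _; rewrite permK.
apply/seteqP; split => t /= Bt i; have := Bt; rewrite /tuple_box/=.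
  by move=> /(_ ((s^-1)%g i)); rewrite tnth_mktuple permKV.
by move=> /(_ (s i)); rewrite tnth_mktuple permK.
Qed.

Lemma ae_tperm n (s : 'S_n) (P : n.-tuple T -> Prop) : (\forall t \ae lam n, P t) ->
  \forall t \ae lam n, P (tperm_tuple s t).
Proof.
move=> [N [mN N0 PN]]; exists (@tperm_tuple d T n s @^-1` N); split.
- by rewrite -[X in measurable X]setTI; exact: measurable_tperm.
- by rewrite lam_tperm.
- by move=> t /= Pt; exact: PN.
Qed.

Lemma ge0_integral_tperm n (s : 'S_n) (f : n.-tuple T -> \bar R) :
  measurable_fun setT f -> (forall t, (0 <= f t)%E) ->
  (\int[lam n]_t f (tperm_tuple s t) = \int[lam n]_t f t)%E.
Proof.
move=> mf f0.
pose pf : {measure set _ -> \bar R} :=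
  measure_function_pushforward__canonical__measure_function_Measure
    (lam n) (@measurable_tperm n s).
transitivity (\int[pushforward (lam n) (@tperm_tuple d T n s)]_t f t)%E.
  by rewrite (ge0_integral_pushforward (@measurable_tperm n s)).
by apply: (@eq_measure_integral _ _ _ _ (lam n) pf) => A mA _; exact: lam_tperm.
Qed.

Lemma integral_tperm n (s : 'S_n) (f : n.-tuple T -> \bar R) :
  measurable_fun setT f ->
  (\int[lam n]_t f (tperm_tuple s t) = \int[lam n]_t f t)%E.
Proof.
move=> mf; rewrite integralE [RHS]integralE; congr (_ - _)%E.
  rewrite -[RHS](@ge0_integral_tperm n s (f^\+)%E (measurable_funepos mf))//.
  by apply: eq_integral => t _; rewrite !funeposE.
rewrite -[RHS](@ge0_integral_tperm n s (f^\-)%E (measurable_funeneg mf))//.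
by apply: eq_integral => t _; rewrite !funenegE.
Qed.

Lemma cintegral_tperm n (s : 'S_n) (f : n.-tuple T -> C) : cmeasurable f ->
  cintegral (lam n) (fun t => f (tperm_tuple s t)) = cintegral (lam n) f.
Proof.
move=> [fr fi]; rewrite /cintegral /Rintegral; congr (Complex (fine _) (fine _)).
  by rewrite (@integral_tperm _ s (fun t => (complex.Re (f t))%:E))//; exact/measurable_EFinP.
by rewrite (@integral_tperm _ s (fun t => (complex.Im (f t))%:E))//; exact/measurable_EFinP.
Qed.

Lemma cmeasurable_tperm n (s : 'S_n) (f : n.-tuple T -> C) : cmeasurable f ->
  cmeasurable (fun t => f (tperm_tuple s t)).
Proof. by move=> mf; exact: (cmeasurable_comp (measurable_tperm s) mf). Qed.

Lemma L2norm2_tperm n (s : 'S_n) (f : n.-tuple T -> C) : cmeasurable f ->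
  L2norm2 (lam n) (fun t => f (tperm_tuple s t)) = L2norm2 (lam n) f.
Proof.
move=> mf; rewrite /L2norm2 (@ge0_integral_tperm n s (fun t => (abs2 (f t))%:E))//.
  exact: measurable_abs2.
by move=> t; rewrite lee_fin abs2_ge0.
Qed.

Lemma L2fun_tperm n (s : 'S_n) (f : n.-tuple T -> C) : L2fun (lam n) f ->
  L2fun (lam n) (fun t => f (tperm_tuple s t)).
Proof.
by move=> [mf foo]; split; [exact: cmeasurable_tperm|rewrite L2norm2_tperm].
Qed.

End tuple_integration.

Section fubini_complex.
Context d1 d2 (T1 : measurableType d1) (T2 : measurableType d2) (R : realType).
Variables (m1 : {sigma_finite_measure set T1 -> \bar R})
  (m2 : {sigma_finite_measure set T2 -> \bar R}).
Local Notation C := R[i].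

(** The inner integral may be infinite for some [y], where [fine] replaces it by 0; this happens on
    a null set only. *)
Lemma Rfubini2 (f : T1 * T2 -> R) : (m1 \x m2)%E.-integrable setT (EFin \o f) ->
  Rintegral (m1 \x m2)%E setT f =
    Rintegral m2 setT (fun y => Rintegral m1 setT (fun x => f (x, y))).
Proof.
move=> fi; rewrite /Rintegral -(integral21_prod_meas1 fi); congr fine.
apply: ae_eq_integral => //.
- exact: measurable_fubini_G fi.
- by apply/measurable_EFinP/measurableT_comp => //; exact: measurable_fubini_G fi.
- apply: filterS (ae_integrable2 fi) => x xf _.
  by rewrite fineK//; exact: integrable_fin_num xf.
Qed.

Lemma cfubini2 (f : T1 * T2 -> C) : cintegrable (m1 \x m2)%E f ->
  cintegral (m1 \x m2)%E f = cintegral m2 (fun y => cintegral m1 (fun x => f (x, y))).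
Proof. by move=> [fr fi]; rewrite /cintegral (Rfubini2 fr) (Rfubini2 fi). Qed.

End fubini_complex.

(** * Antisymmetrization *)

Section antisymmetrization.
Context d (T : measurableType d) (R : realType).
Variable m : {sigma_finite_measure set T -> \bar R}.
Local Notation lam := (tuple_measure m).
Local Notation C := R[i].

Lemma sgnM n (s r : 'S_n) : (-1) ^+ (s * r)%g = (-1) ^+ s * (-1) ^+ r :> C.
Proof. by rewrite odd_permM signr_addb. Qed.

Lemma sgnV n (s : 'S_n) : (-1) ^+ (s^-1)%g = (-1) ^+ s :> C.
Proof. by rewrite odd_permV. Qed.

Lemma sgnK n (s : 'S_n) : (-1) ^+ s * (-1) ^+ s = 1 :> C.
Proof. by rewrite -expr2 sqrr_sign. Qed.

Lemma conj_sgn n (s : 'S_n) : conjc ((-1) ^+ s) = (-1) ^+ s :> C.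
Proof. by rewrite rmorph_sign. Qed.

Lemma antisymmetrize_tperm n (f : n.-tuple T -> C) (s : 'S_n) t :
  antisymmetrize f (tperm_tuple s t) = (-1) ^+ s * antisymmetrize f t.
Proof.
rewrite /antisymmetrize mulrCA; congr (_ * _).
rewrite mulr_sumr (reindex_inj (mulIg s^-1%g))/=; apply: eq_bigr => r _.
by rewrite tperm_tupleM -mulgA mulVg mulg1 sgnM sgnV [(-1) ^+ r * _]mulrC -mulrA.
Qed.

Lemma antisymmetrizeZD n (a : C) (f g : n.-tuple T -> C) t :
  antisymmetrize (fun t => a * f t + g t) t =
  a * antisymmetrize f t + antisymmetrize g t.
Proof.
rewrite /antisymmetrize [in RHS]mulrCA -[in RHS]mulrDr [in RHS]mulr_sumr -big_split/=.
congr (_ * _).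
by apply: eq_bigr => s _; rewrite mulrDr mulrCA.
Qed.

Lemma L2fun_antisymmetrize n (f : n.-tuple T -> C) : L2fun (lam n) f ->
  L2fun (lam n) (antisymmetrize f).
Proof.
move=> Lf; apply: L2funZ; apply: L2fun_sum => s; apply: L2funZ.
exact: L2fun_tperm.
Qed.

Lemma Lambda_antisymmetrize n (f : n.-tuple T -> C) : L2fun (lam n) f ->
  Lambda m (antisymmetrize f).
Proof.
move=> Lf; split; first exact: L2fun_antisymmetrize.
by move=> s; apply/nearW => t; exact: antisymmetrize_tperm.
Qed.

Lemma ae_all_perm n (P : 'S_n -> n.-tuple T -> Prop) :
  (forall s, \forall t \ae lam n, P s t) -> \forall t \ae lam n, forall s, P s t.
Proof. by move=> Ps; exact: filter_forall. Qed.

Lemma ae_eq_antisymmetrize n (f g : n.-tuple T -> C) :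
  (\forall t \ae lam n, f t = g t) ->
  \forall t \ae lam n, antisymmetrize f t = antisymmetrize g t.
Proof.
move=> fg; have : \forall t \ae lam n, forall s : 'S_n, f (tperm_tuple s t) = g (tperm_tuple s t).
  by apply: ae_all_perm => s; exact: (ae_tperm s fg).
apply: filterS => t fgt; rewrite /antisymmetrize; congr (_ * _).
by apply: eq_bigr => s _; rewrite fgt.
Qed.

Lemma ldot_tperm n (f g : n.-tuple T -> C) (s : 'S_n) : L2fun (lam n) f -> Lambda m g ->
  ldot (lam n) (fun t => f (tperm_tuple s t)) g = (-1) ^+ s * ldot (lam n) f g.
Proof.
move=> Lf [Lg ag]; have Lfs := L2fun_tperm s Lf.
rewrite /ldot (@ae_eq_cintegral _ _ _ _ _ (fun t => (-1) ^+ s *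
    (conjc (f (tperm_tuple s t)) * g (tperm_tuple s t)))).
- rewrite cintegralZ; last exact: (L2fun_prod Lfs (L2fun_tperm s Lg)).
  rewrite (@cintegral_tperm _ _ _ m n s (fun t => conjc (f t) * g t))//.
  exact: cintegrable_meas (L2fun_prod Lf Lg).
- exact: cintegrable_meas (L2fun_prod Lfs Lg).
- apply: cmeasurableM; first exact: cmeasurable_cst.
  exact: cintegrable_meas (L2fun_prod Lfs (L2fun_tperm s Lg)).
- apply: filterS (ag s) => t ->.
  by rewrite [in RHS]mulrCA [X in _ = _ * X]mulrA sgnK mul1r.
Qed.

(* Both antisymmetrization and its version fixing the first variable are
   averages of this kind. *)
Lemma ldot_average n (r : nat) (sigma : 'S_r -> 'S_n) (f g : n.-tuple T -> C) :
  (forall s, (-1) ^+ sigma s = (-1) ^+ s :> C) ->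
  L2fun (lam n) f -> Lambda m g ->
  ldot (lam n) (fun t => r`!%:R^-1 * \sum_(s : 'S_r)
    (-1) ^+ s * f (tperm_tuple (sigma s) t)) g = ldot (lam n) f g.
Proof.
move=> sgn_sigma Lf Lg; rewrite {1}/ldot.
rewrite (_ : (fun t => _) = (fun t => r`!%:R^-1 * \sum_(s : 'S_r)
    ((-1) ^+ s * (conjc (f (tperm_tuple (sigma s) t)) * g t)))); last first.
  apply/funext => t; rewrite conjcM conjc_inv conjc_nat -mulrA.
  rewrite conjc_sum mulr_suml; congr (_ * _); apply: eq_bigr => s _.
  by rewrite conjcM conj_sgn mulrA.
have ifg (s : 'S_r) : cintegrable (lam n)
    (fun t => conjc (f (tperm_tuple (sigma s) t)) * g t).
  by apply: L2fun_prod; [exact: L2fun_tperm|have [] := Lg].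
rewrite cintegralZ; last first.
  by apply: cintegrable_sum => s; exact: cintegrableZ.
rewrite cintegral_sum; last by move=> s; exact: cintegrableZ.
rewrite (eq_bigr (fun=> ldot (lam n) f g)); last first.
  move=> s _; rewrite cintegralZ// -/(ldot _ (fun t => f (tperm_tuple (sigma s) t)) g).
  by rewrite ldot_tperm// sgn_sigma mulrA sgnK mul1r.
by rewrite sumr_const card_Sn -(mulr_natl (ldot _ f g)) mulrA mulVf ?mul1r.
Qed.

Lemma ldot_antisymmetrize n (f g : n.-tuple T -> C) : L2fun (lam n) f -> Lambda m g ->
  ldot (lam n) (antisymmetrize f) g = ldot (lam n) f g.
Proof. by move=> Lf Lg; rewrite -(@ldot_average n n id f g). Qed.

Lemma ldot_sumr n I (s : seq I) (f : n.-tuple T -> C) (a : I -> C)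
    (g : I -> n.-tuple T -> C) :
  L2fun (lam n) f -> (forall i, L2fun (lam n) (g i)) ->
  ldot (lam n) f (fun t => \sum_(i <- s) a i * g i t) =
  \sum_(i <- s) a i * ldot (lam n) f (g i).
Proof.
move=> Lf Lg; rewrite /ldot.
under [RHS]eq_bigr => i _ do rewrite -(cintegralZ _ (L2fun_prod Lf (Lg i))).
rewrite -cintegral_sum; last by move=> i; apply: cintegrableZ; exact: L2fun_prod.
congr cintegral; apply/funext => t; rewrite mulr_sumr.
by apply: eq_bigr => i _; rewrite mulrCA.
Qed.

(** Antisymmetrization is an orthogonal projection P, so |P f|^2 = <f, P f>; expanding P f leaves
    one inner product per permutation, to be estimated separately. *)
Lemma L2norm2_antisymmetrize n (f : n.-tuple T -> C) : L2fun (lam n) f ->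
  (((fine (L2norm2 (lam n) (antisymmetrize f)))%:C)%C : C) =
  n`!%:R^-1 * \sum_(s : 'S_n) (-1) ^+ s * ldot (lam n) f (fun t => f (tperm_tuple s t)).
Proof.
move=> Lf; rewrite -ldotxx; last exact: L2fun_antisymmetrize.
rewrite ldot_antisymmetrize//; last exact: Lambda_antisymmetrize.
have Lfs (s : 'S_n) := L2fun_tperm s Lf.
rewrite -ldot_sumr// /ldot -cintegralZ.
  by congr cintegral; apply/funext => t; rewrite mulrCA.
apply: L2fun_prod => //; apply: L2fun_sum => s; exact: L2funZ.
Qed.

End antisymmetrization.

(** * Kernels antisymmetric in all variables but the first *)

Section stabilizer.
Context d (T : measurableType d) (R : realType).
Variable m : {sigma_finite_measure set T -> \bar R}.
Local Notation lam := (tuple_measure m).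
Local Notation C := R[i].
Variable n : nat.

Definition stab_antisymmetric (W : n.+1.-tuple T -> C) : Prop :=
  forall s : 'S_n.+1, s ord0 = ord0 ->
    \forall t \ae lam n.+1, W (tperm_tuple s t) = (-1) ^+ s * W t.

(** Composition with the transposition of 0 and [i] reduces to [i = 0], where the permutations are
    those supported on the remaining n indices. *)
Lemma card_stab (i : 'I_n.+1) : #|[pred s : 'S_n.+1 | s ord0 == i]| = n`!.
Proof.
have -> : #|[pred s : 'S_n.+1 | s ord0 == i]| = #|[pred s : 'S_n.+1 | s ord0 == ord0]|.
  rewrite -(fintype.card_image (mulIg (tperm ord0 i))); apply: eq_card => s.
  apply/fintype.imageP/idP => [[r]|/eqP s0].
    by rewrite inE => /eqP ri ->; apply/eqP; rewrite permM ri tpermR.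
  exists (s * tperm ord0 i)%g; last by rewrite -mulgA tperm2 mulg1.
  by rewrite inE permM s0 tpermL.
rewrite -[in RHS](card_ord n) -[in RHS](fintype.card_image (@lift_inj _ (@ord0 n))).
have -> : #|[seq lift (@ord0 n) x | x in 'I_n]| = #|[set~ ord0 : 'I_n.+1]%SET|.
  apply: eq_card => j; rewrite !inE; apply/fintype.imageP/idP => [[k _ ->]|].
    by rewrite eq_sym neq_lift.
  by case: (unliftP ord0 j) => [k ->|->]; [exists k|rewrite eqxx].
rewrite -card_perm; apply: eq_card => s; rewrite !inE.
rewrite unfold_in /perm_on; apply/eqP/fintype.subsetP => [s0 j|sP].
  by rewrite !inE; apply: contraNneq => ->; rewrite s0.
by apply/eqP; apply: contraTT isT => s0; have := sP ord0; rewrite !inE s0 eqxx => /(_ isT).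
Qed.

Lemma sum_stab (V : nmodType) (i : 'I_n.+1) (c : V) :
  \sum_(s : 'S_n.+1 | s ord0 == i) c = c *+ n`!.
Proof. by rewrite -(card_stab i) -sumr_const; apply: eq_bigl => s; rewrite inE. Qed.

Variable W : n.+1.-tuple T -> C.
Hypotheses (LW : L2fun (lam n.+1) W) (aW : stab_antisymmetric W).

Lemma ldot_stab (s : 'S_n.+1) : s ord0 = ord0 ->
  (-1) ^+ s * ldot (lam n.+1) W (fun t => W (tperm_tuple s t)) = ldot (lam n.+1) W W.
Proof.
move=> s0; rewrite /ldot -cintegralZ; last exact: L2fun_prod (L2fun_tperm s LW).
apply: ae_eq_cintegral.
- apply: cmeasurableM; first exact: cmeasurable_cst.
  exact: cintegrable_meas (L2fun_prod LW (L2fun_tperm s LW)).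
- exact: cintegrable_meas (L2fun_prod LW LW).
- apply: filterS (aW s0) => t ->.
  by rewrite mulrCA [X in _ * X = _]mulrA sgnK mul1r.
Qed.

(** The n! permutations fixing the head each contribute |W|^2, and (n+1) n!/(n+1)! = 1; what remains
    is assumed nonpositive. This version serves the norm of creation operators, the one with
    equality the Ito isometry. *)
Lemma L2norm2_antisymmetrize_le :
  (forall s : 'S_n.+1, s ord0 != ord0 ->
     complex.Re ((-1) ^+ s * ldot (lam n.+1) W (fun t => W (tperm_tuple s t))) <= 0) ->
  n.+1%:R * fine (L2norm2 (lam n.+1) (antisymmetrize W)) <= fine (L2norm2 (lam n.+1) W).
Proof.
move=> Ws; have /(congr1 (@complex.Re R))/= -> := L2norm2_antisymmetrize LW.
have -> : (n.+1)`!%:R^-1 = (((n.+1)`!%:R^-1)%:C)%C :> C by rewrite fmorphV rmorph_nat.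
rewrite cReMl cRe_sum (bigID (fun s : 'S_n.+1 => s ord0 == ord0)).
rewrite mulrA factS natrM invfM mulrA mulfV ?pnatr_eq0// mul1r mulrC.
rewrite ler_pdivrMr ?ltr0n ?fact_gt0//.
rewrite -[leRHS]addr0 lerD//; last by apply: sumr_le0 => s; exact: Ws.
under eq_bigr => s /eqP s0 do rewrite ldot_stab// ldotxx//.
by rewrite sum_stab mulr_natr.
Qed.

Lemma L2norm2_antisymmetrize_eq :
  (forall s : 'S_n.+1, s ord0 != ord0 ->
     ldot (lam n.+1) W (fun t => W (tperm_tuple s t)) = 0) ->
  n.+1%:R * fine (L2norm2 (lam n.+1) (antisymmetrize W)) = fine (L2norm2 (lam n.+1) W).
Proof.
move=> Ws; have /(congr1 (@complex.Re R))/= -> := L2norm2_antisymmetrize LW.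
have -> : (n.+1)`!%:R^-1 = (((n.+1)`!%:R^-1)%:C)%C :> C by rewrite fmorphV rmorph_nat.
rewrite cReMl cRe_sum (bigID (fun s : 'S_n.+1 => s ord0 == ord0))/=.
rewrite mulrA factS natrM invfM mulrA mulfV ?pnatr_eq0// mul1r.
rewrite [X in _ + X]big1 ?addr0; last by move=> s s0; rewrite Ws// mulr0.
under eq_bigr => s /eqP s0 do rewrite ldot_stab// ldotxx//.
by rewrite sum_stab -[X in _ * X]mulr_natl mulKf.
Qed.

End stabilizer.

(** * Tensor products and the norm bound for creation operators *)

Section tensor_product.
Variable R : realType.
Local Notation T := (measurableTypeR R).
Variable m : {sigma_finite_measure set T -> \bar R}.
Local Notation lam := (tuple_measure m).
Local Notation C := R[i].

Lemma tensorE n (z : T -> C) (f : n.-tuple T -> C) u :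
  tensor z f u = z (thead u) * f (tbehead u).
Proof. by []. Qed.

Lemma cmeasurable_tensor n (z : T -> C) (f : n.-tuple T -> C) :
  cmeasurable z -> cmeasurable f -> cmeasurable (tensor z f).
Proof.
move=> mz mf; apply: cmeasurableM.
  exact: (cmeasurable_comp (@measurable_thead _ _ n) mz).
exact: (cmeasurable_comp (@measurable_tbehead _ _ n) mf).
Qed.

Lemma L2norm2_tcons n (f : n.+1.-tuple T -> C) : cmeasurable f ->
  L2norm2 (lam n.+1) f = (\int[m]_x L2norm2 (lam n) (fun t => f (tcons (x, t))))%E.
Proof.
move=> mf; rewrite /L2norm2 tonelli1//; first exact: measurable_abs2.
by move=> u; rewrite lee_fin abs2_ge0.
Qed.

Lemma L2norm2_tensor n (z : T -> C) (f : n.-tuple T -> C) :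
  cmeasurable z -> cmeasurable f ->
  L2norm2 (lam n.+1) (tensor z f) = (L2norm2 m z * L2norm2 (lam n) f)%E.
Proof.
move=> mz mf; rewrite L2norm2_tcons; last exact: cmeasurable_tensor.
under eq_integral.
  move=> x _; rewrite (_ : (fun t => _) = (fun t => z x * f t)).
    by rewrite L2norm2Z//; over.
  by apply/funext => t; rewrite tensorE thead_tcons tbehead_tcons.
rewrite ge0_integralZr//.
- exact: measurable_abs2.
- by move=> x _; rewrite lee_fin abs2_ge0.
- exact: L2norm2_ge0.
Qed.

Lemma L2fun_tensor n (z : T -> C) (f : n.-tuple T -> C) :
  L2fun m z -> L2fun (lam n) f -> L2fun (lam n.+1) (tensor z f).
Proof.
move=> Lz Lf; have [mz _] := Lz; have [mf _] := Lf; split; first exact: cmeasurable_tensor.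
rewrite L2norm2_tensor// lte_mul_pinfty ?L2norm2_ge0//; first exact: L2norm2_fin.
by have [] := Lf.
Qed.

Lemma sgn_lift0 n (s : 'S_n) : (-1) ^+ lift0_perm s = (-1) ^+ s :> C.
Proof. by rewrite odd_lift_perm addbb. Qed.

Lemma thead_tperm_lift n (s : 'S_n) (u : n.+1.-tuple T) :
  thead (tperm_tuple (lift0_perm s) u) = thead u.
Proof. by rewrite /thead tnth_mktuple lift_perm_id. Qed.

Lemma tnth_tbehead n (u : n.+1.-tuple T) i : tnth (tbehead u) i = tnth u (lift ord0 i).
Proof. by rewrite -[in RHS](tcons_eta u) tnth_tcons_lift. Qed.

Lemma tbehead_tperm_lift n (s : 'S_n) (u : n.+1.-tuple T) :
  tbehead (tperm_tuple (lift0_perm s) u) = tperm_tuple s (tbehead u).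
Proof.
apply: eq_from_tnth => i.
by rewrite tnth_tbehead !tnth_mktuple lift_perm_lift tnth_tbehead.
Qed.

Lemma tperm_lift_tcons n (s : 'S_n) x (t : n.-tuple T) :
  tperm_tuple (lift0_perm s) (tcons (x, t)) = tcons (x, tperm_tuple s t).
Proof.
by rewrite -[LHS]tcons_eta thead_tperm_lift tbehead_tperm_lift thead_tcons tbehead_tcons.
Qed.

Lemma lift0_permP n (s : 'S_n.+1) : s ord0 = ord0 -> exists r, s = lift0_perm r.
Proof.
move=> s0; pose f k := odflt k (unlift ord0 (s (lift ord0 k))).
have fP k : lift ord0 (f k) = s (lift ord0 k).
  rewrite /f; case: unliftP => [j ->//|/eqP].
  by rewrite -[X in _ == X]s0 (inj_eq perm_inj) eq_sym (negbTE (neq_lift _ _)).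
have f_inj : injective f.
  by move=> j k /(congr1 (lift ord0)); rewrite !fP => /perm_inj/lift_inj.
exists (perm f_inj); apply/permP => k; case: (unliftP ord0 k) => [j ->|->].
  by rewrite lift_perm_lift permE fP.
by rewrite lift_perm_id.
Qed.

Lemma stab_antisymmetric_tensor n (z : T -> C) (f : n.-tuple T -> C) :
  antisymmetric_fun m f -> stab_antisymmetric m (tensor z f).
Proof.
move=> af s /lift0_permP[r ->]; apply: filterS (ae_tbehead (af r)) => u fu.
by rewrite !tensorE thead_tperm_lift tbehead_tperm_lift fu sgn_lift0 mulrCA.
Qed.

(** Antisymmetrizing the tail is an average over the permutations fixing the head, and an
    antisymmetric [f] does not see such an average. *)
Lemma ldot_tensor_antisymmetrize n (z : T -> C) (g : n.-tuple T -> C) f :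
  L2fun m z -> L2fun (lam n) g -> Lambda m f ->
  ldot (lam n.+1) (tensor z (antisymmetrize g)) f = ldot (lam n.+1) (tensor z g) f.
Proof.
move=> Lz Lg Lf; rewrite -(@ldot_average _ _ _ m n.+1 n (@lift0_perm n) (tensor z g))//.
- congr ldot; apply/funext => u; rewrite tensorE /antisymmetrize mulrCA; congr (_ * _).
  rewrite mulr_sumr; apply: eq_bigr => s _.
  by rewrite tensorE thead_tperm_lift tbehead_tperm_lift mulrCA.
- exact: sgn_lift0.
- exact: L2fun_tensor.
Qed.

Lemma Lambda_slice n (f : n.+1.-tuple T -> C) : Lambda m f ->
  \forall x \ae m, Lambda m (fun t : n.-tuple T => f (tcons (x, t))).
Proof.
move=> [[mf foo] af].
have ma : measurable_fun setT (fun u => (abs2 (f u))%:E) := measurable_abs2 mf.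
have a0 u : (0 <= (abs2 (f u))%:E)%E by rewrite lee_fin abs2_ge0.
have i1 : m.-integrable setT (fun x => L2norm2 (lam n) (fun t => f (tcons (x, t)))).
  apply/integrableP; split; first exact: (@measurable_tonelli1 _ _ _ m n _ ma a0).
  under eq_integral do rewrite gee0_abs ?L2norm2_ge0//.
  by rewrite -L2norm2_tcons.
have as_ : \forall x \ae m, forall s : 'S_n, \forall t \ae lam n,
    f (tcons (x, tperm_tuple s t)) = (-1) ^+ s * f (tcons (x, t)).
  apply: filter_forall => s; have := ae_slice (af (lift0_perm s)).
  apply: filterS => x; apply: filterS => t.
  by rewrite tperm_lift_tcons sgn_lift0.
apply: filterS2 as_ (integrable_ae measurableT i1) => x ax /(_ I) fx.
split => //; split; first exact: (cmeasurable_comp (@measurable_tconsr _ _ n x) mf).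
by rewrite -ge0_fin_numE ?L2norm2_ge0.
Qed.

Lemma cintegrable_tcons n (f : n.+1.-tuple T -> C) : cintegrable (lam n.+1) f ->
  cintegrable (m \x lam n)%E (fun p => f (tcons p)).
Proof.
have key (g : n.+1.-tuple T -> R) : (lam n.+1).-integrable setT (EFin \o g) ->
    (m \x lam n)%E.-integrable setT (EFin \o (fun p => g (tcons p))).
  move=> /integrableP[mg goo]; apply/integrableP; split.
    exact: measurableT_comp mg (@measurable_tcons _ _ n).
  rewrite -(@ge0_integral_tcons _ _ _ m n (fun u => `|(g u)%:E|%E))//.
  exact: measurableT_comp mg.
by move=> [fr fi]; split; [exact: (key _ fr)|exact: (key _ fi)].
Qed.

Lemma cintegral_tcons n (f : n.+1.-tuple T -> C) : cintegrable (lam n.+1) f ->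
  cintegral (lam n.+1) f = cintegral (m \x lam n)%E (fun p => f (tcons p)).
Proof.
have key (g : n.+1.-tuple T -> R) : (lam n.+1).-integrable setT (EFin \o g) ->
    Rintegral (lam n.+1) setT g = Rintegral (m \x lam n)%E setT (fun p => g (tcons p)).
  move=> /measurable_int mg; rewrite /Rintegral integralE [in RHS]integralE.
  congr (fine (_ - _)%E).
    rewrite (@ge0_integral_tcons _ _ _ m n)//; last exact: measurable_funepos.
    by apply: eq_integral => p _; rewrite !funeposE.
  rewrite (@ge0_integral_tcons _ _ _ m n)//; last exact: measurable_funeneg.
  by apply: eq_integral => p _; rewrite !funenegE.
by move=> [fr fi]; rewrite /cintegral (key _ fr) (key _ fi).
Qed.

Lemma cintegrable_fubini2 d1 d2 (T1 : measurableType d1) (T2 : measurableType d2)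
    (m1 : {sigma_finite_measure set T1 -> \bar R})
    (m2 : {sigma_finite_measure set T2 -> \bar R}) (f : T1 * T2 -> C) :
  cintegrable (m1 \x m2)%E f ->
  cintegrable m2 (fun y => cintegral m1 (fun x => f (x, y))).
Proof.
have key (g : T1 * T2 -> R) : (m1 \x m2)%E.-integrable setT (EFin \o g) ->
    m2.-integrable setT (EFin \o (fun y => Rintegral m1 setT (fun x => g (x, y)))).
  move=> gi; have mG := measurable_fubini_G gi.
  apply/integrableP; split.
    by apply/measurable_EFinP/measurableT_comp.
  have /(integrable21ltyP _ _ (measurable_int _ gi)) := gi; apply: le_lt_trans.
  apply: ge0_le_integral => //.
  - by apply: measurableT_comp => //; apply/measurable_EFinP/measurableT_comp.
  - apply: (measurable_fun_fubini_tonelli_G (m1 := m1) (abse \o (EFin \o g))).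
      by apply: measurableT_comp => //; exact: measurable_int gi.
    by move=> p; exact: abse_ge0.
  - move=> y _ /=; rewrite /Rintegral.
    have [h|h] := boolP (\int[m1]_x (g (x, y))%:E \is a fin_num)%E.
      rewrite -[leLHS]/(`|(fine _)%:E|%E) fineK//; apply: le_abse_integral => //.
      apply: (measurableT_comp (measurable_int _ gi)).
      by apply: measurable_fun_pair; [exact: measurable_id|exact: measurable_cst].
    (* Where the inner integral is not finite, [fine] gives 0 and the domination is trivial, so no
       exceptional set has to be removed. *)
    suff -> : fine (\int[m1]_x (g (x, y))%:E)%E = 0.
      by rewrite normr0; apply: integral_ge0.
    by move: h; case: (integral _ _ _).
by move=> [fr fi]; split; [exact: (key _ fr)|exact: (key _ fi)].
Qed.

Lemma cintegral_Re_ge0 d1 (T1 : measurableType d1) (m1 : {measure set T1 -> \bar R})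
    (f : T1 -> C) : (\forall x \ae m1, 0 <= complex.Re (f x)) ->
  0 <= complex.Re (cintegral m1 f).
Proof.
move=> f0; rewrite /= /Rintegral integralE.
rewrite (_ : (\int[m1]_x (fun x => (complex.Re (f x))%:E)^\- x)%E = 0%E).
  by rewrite sube0 fine_ge0// integral_ge0.
transitivity (\int[m1]_x (cst 0%E) x)%E; last by rewrite integral0.
apply: ae_eq_lower_integral => //.
by apply: filterS f0 => x fx; rewrite funenegE -EFinN -EFin_max max_r// oppr_le0.
Qed.

(** Exchanging the first two variables decouples them: for a fixed tail t the double integral is
    |<z, f(., t)>|^2. The integral over t is, up to a combinatorial factor, the squared norm of the
    vector obtained by annihilating [z] in [f]. *)
Lemma ldot_swap_ge0 n (z : T -> C) (f : n.+1.-tuple T -> C) :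
  L2fun m z -> L2fun (lam n.+1) f ->
  0 <= complex.Re (ldot (lam n.+2) (tensor z f)
    (fun u => tensor z f (tperm_tuple (tperm ord0 (lift ord0 ord0)) u))).
Proof.
move=> Lz Lf; set c := tperm _ _.
have LW := L2fun_tensor Lz Lf.
have iF := L2fun_prod LW (L2fun_tperm c LW).
pose F (x y : T) (t : n.-tuple T) : C :=
  conjc (z x * f (tcons (y, t))) * (z y * f (tcons (x, t))).
have FE x y t : conjc (tensor z f (tcons (x, tcons (y, t)))) *
    tensor z f (tperm_tuple c (tcons (x, tcons (y, t)))) = F x y t.
  rewrite !tensorE thead_tcons tbehead_tcons; congr (_ * (z _ * f _)).
    by rewrite /thead tnth_mktuple tpermL tnth_tcons_lift.
  apply: eq_from_tnth => i; rewrite tnth_tbehead tnth_mktuple.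
  case: (unliftP ord0 i) => [j ->|->].
    rewrite tpermD; [|by []|by rewrite (inj_eq lift_inj)].
    by rewrite !tnth_tcons_lift.
  by rewrite tpermR.
rewrite /ldot cintegral_tcons// (cfubini2 (cintegrable_tcons iF)).
have iG := cintegrable_fubini2 (cintegrable_tcons iF).
rewrite cintegral_tcons// (cfubini2 (cintegrable_tcons iG)).
apply: cintegral_Re_ge0.
have [mf foo] := Lf.
have ma : measurable_fun setT (fun u => (abs2 (f u))%:E) := measurable_abs2 mf.
have a0 u : (0 <= (abs2 (f u))%:E)%E by rewrite lee_fin abs2_ge0.
have i2 : (lam n).-integrable setT (fun t => L2norm2 m (fun x => f (tcons (x, t)))).
  apply/integrableP; split.
    apply: (@measurable_fun_fubini_tonelli_G _ _ _ _ _ m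
      (fun p => (abs2 (f (tcons p)))%:E)) => //.
    exact: (measurableT_comp ma (@measurable_tcons _ _ n)).
  under eq_integral do rewrite gee0_abs ?L2norm2_ge0//.
  by rewrite /L2norm2 -(@tonelli2 _ _ _ m n (fun u => (abs2 (f u))%:E)).
have := integrable_ae measurableT i2; apply: filterS => t /(_ I) ft.
have Lft : L2fun m (fun x => f (tcons (x, t))).
  split; first exact: (cmeasurable_comp (@measurable_tconsl _ _ n t) mf).
  by rewrite -ge0_fin_numE ?L2norm2_ge0.
have izf := L2fun_prod Lz Lft; have ifz := L2fun_prod Lft Lz.
rewrite (_ : cintegral m _ = conjc (ldot m z (fun x => f (tcons (x, t)))) *
    ldot m z (fun x => f (tcons (x, t)))).
  by rewrite mulJ_abs2/= abs2_ge0.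
rewrite -ldotC// mulrC /ldot -cintegralZ//; congr cintegral; apply/funext => y.
rewrite [in RHS]mulrC -cintegralZ//; congr cintegral; apply/funext => x.
by rewrite FE /F conjcM; ring.
Qed.

(** The stabilizer of the head has only two double cosets, so every permutation moving the head
    reduces to the exchange of the first two variables. *)
Lemma double_coset n (s : 'S_n.+2) : s ord0 != ord0 -> exists s1 r : 'S_n.+2,
  [/\ s1 ord0 = ord0, r ord0 = ord0 & s = (s1 * tperm ord0 (lift ord0 ord0) * r)%g].
Proof.
move=> s0; pose i1 : 'I_n.+2 := lift ord0 ord0.
pose r := tperm i1 (s ord0).
have r0 : r ord0 = ord0 by rewrite tpermD// eq_sym.
exists (s * r^-1 * (tperm ord0 i1)^-1)%g, r; split => //.
  by rewrite !permM !tpermV tpermR tpermR.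
by rewrite !mulgVK.
Qed.

(** This is the fermionic bound |b^*(z)| <= |z|, the factor n+1 being the ratio of the weights
    (n+1)! and n!. A permutation s1 c r moving the head has sign -sgn(s1) sgn(r), while antisymmetry
    of the tail extracts sgn(s1) sgn(r) from the inner product; what is left is minus the
    nonnegative quantity of [ldot_swap_ge0]. *)
Lemma creation_bound n (z : T -> C) (f : n.-tuple T -> C) :
  L2fun m z -> Lambda m f ->
  n.+1%:R * fine (L2norm2 (lam n.+1) (antisymmetrize (tensor z f))) <=
  fine (L2norm2 m z) * fine (L2norm2 (lam n) f).
Proof.
move=> Lz [Lf af]; have LW := L2fun_tensor Lz Lf.
have aW := stab_antisymmetric_tensor z af.
rewrite -fineM ?L2norm2_fin// -L2norm2_tensor; [|by case: Lz|by case: Lf].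
apply: L2norm2_antisymmetrize_le => // s s0.
(* With a single variable no permutation moves the head; the exchange of two variables requires at
   least two. *)
case: n f Lf af LW aW s s0 => [|n] f Lf af LW aW s s0.
  by move: s0; rewrite (ord1 (s ord0)).
have [s1 [r [s10 r0 ->]]] := double_coset s0; set c := tperm _ _.
set W := tensor z f in LW aW *.
suff -> : ldot (lam n.+2) W (fun u => W (tperm_tuple (s1 * c * r) u)) =
    (-1) ^+ s1 * (-1) ^+ r * ldot (lam n.+2) W (fun u => W (tperm_tuple c u)).
  rewrite !sgnM odd_tperm (_ : ord0 != _)// expr1.
  set a := (-1) ^+ s1; set b := (-1) ^+ r.
  rewrite (_ : _ * _ = - (a * a * (b * b) * ldot (lam n.+2) W
    (fun u => W (tperm_tuple c u)))); last by ring.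
  by rewrite !sgnK !mul1r cReN oppr_le0 ldot_swap_ge0.
rewrite /ldot -cintegralZ; last exact: L2fun_prod (L2fun_tperm c LW).
have mWW : cmeasurable (fun u => (-1) ^+ s1 * (-1) ^+ r * (conjc (W u) * W (tperm_tuple c u))).
  apply: cmeasurableM; first exact: cmeasurable_cst.
  exact: cintegrable_meas (L2fun_prod LW (L2fun_tperm c LW)).
rewrite -[RHS](cintegral_tperm m r mWW).
apply: ae_eq_cintegral.
- exact: cintegrable_meas (L2fun_prod LW (L2fun_tperm _ LW)).
- exact: (cmeasurable_tperm r mWW).
apply: filterS2 (aW r r0) (ae_tperm (c * r)%g (aW s1 s10)) => u Wr Ws1.
rewrite -mulgA -tperm_tupleM Ws1 -tperm_tupleM Wr [conjc (_ * W u)]conjcM conj_sgn.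
set a := (-1) ^+ s1; set b := (-1) ^+ r.
rewrite [in RHS](_ : _ * _ = (b * b) * (conjc (W u) * (a * W (tperm_tuple c (tperm_tuple r u))))).
  by rewrite sgnK mul1r.
by ring.
Qed.

End tensor_product.

(** * The Ito isometry for kernels *)

Section ordering.
Variable R : realType.
Local Notation T := (measurableTypeR R).
Variable m : {sigma_finite_measure set T -> \bar R}.
Hypothesis m_atomless : forall x : R, m [set x] = 0%E.
Local Notation lam := (tuple_measure m).
Local Notation C := R[i].

Lemma ae_neq_thead n (i : 'I_n) :
  \forall u \ae lam n.+1, tnth (tbehead u) i != thead u.
Proof.
have mE : measurable [set u : n.+1.-tuple T | tnth (tbehead u) i == thead u].
  rewrite -[X in measurable X]setTI.
  have : measurable_fun setT (fun u : n.+1.-tuple T => tnth (tbehead u) i == thead u :> R).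
    apply: measurable_fun_eqr; last exact: measurable_thead.
    by apply: measurableT_comp (@measurable_tnth _ _ n i) (@measurable_tbehead _ _ n).
  by move=> /(_ measurableT [set true]); apply.
exists [set u : n.+1.-tuple T | tnth (tbehead u) i == thead u]; split => //.
  rewrite -[X in lam n.+1 X]setIT -integral_indic// tonelli2//.
  - apply: integral0_eq => t _.
    rewrite (_ : (fun x => _) = (fun x => (\1_[set tnth t i] x)%:E)).
      by rewrite integral_indic// setIT; exact: m_atomless.
    apply/funext => x; rewrite !indicE; congr ((nat_of_bool _)%:R%:E).
    apply/idP/idP; rewrite !inE/= tbehead_tcons thead_tcons; first by move=> /eqP.
    by move=> ->; rewrite eqxx.
  - by apply/measurable_EFinP; exact: measurable_indic.
by move=> u /negP; rewrite negbK.
Qed.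

(** The diagonals are null because the measure has no atoms. The largest entry of a tuple is thus
    almost everywhere attained at one position only. *)
Lemma ae_injective n : \forall t \ae lam n, injective (tnth t).
Proof.
elim: n => [|n ih]; first by apply/nearW => t [].
have H : \forall u \ae lam n.+1, forall i, tnth (tbehead u) i != thead u.
  by apply: filter_forall => i; exact: ae_neq_thead.
apply: filterS2 (ae_tbehead ih) H => u uinj u0 i j.
case: (unliftP ord0 i) (unliftP ord0 j) => [i' ->|->] [j' ->|->] //.
- by rewrite -!tnth_tbehead => /uinj ->.
- by rewrite -tnth_tbehead => /eqP; rewrite (negbTE (u0 _)).
- by rewrite -tnth_tbehead => /esym/eqP; rewrite (negbTE (u0 _)).
Qed.

Lemma sgn_cancel n (s : 'S_n) (a b c : C) :
  (-1) ^+ s * (a * (b * ((-1) ^+ s * c))) = b * (a * c).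
Proof.
have := sgnK R s; move: (_ ^+ _ : C) => e ee.
by rewrite -[RHS]mul1r -ee; ring.
Qed.

Definition headmax n (u : n.+1.-tuple T) : bool :=
  [forall i, (tnth u i : R) <= thead u].

Lemma measurable_headmax n : measurable [set u : n.+1.-tuple T | headmax u].
Proof.
rewrite (_ : [set u | _] = \bigcap_(i in [set: 'I_n.+1]) [set u : n.+1.-tuple T | (tnth u i : R) <= thead u]).
  apply: fin_bigcap_measurable; first exact: finite_finset.
  move=> i _; rewrite -[X in measurable X]setTI.
  have : measurable_fun setT (fun u : n.+1.-tuple T => (tnth u i : R) <= thead u).
    by apply: measurable_fun_ler; exact: measurable_tnth.
  by move=> /(_ measurableT [set true]); apply.
apply/seteqP; split => u /=; first by move=> /forallP ui i _; exact: ui.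
by move=> ui; apply/forallP => i; exact: ui.
Qed.

Lemma tperm_headmax n (s : 'S_n.+1) (u : n.+1.-tuple T) :
  headmax (tperm_tuple s u) = [forall i, (tnth u i : R) <= tnth u (s ord0)].
Proof.
rewrite /headmax /thead tnth_mktuple; apply/forallP/forallP => su i.
  by have := su ((s^-1)%g i); rewrite tnth_mktuple permKV.
by rewrite tnth_mktuple.
Qed.

(* A kernel carried by the tuples whose head is the largest entry is orthogonal
   to its rearrangements by permutations moving the head, so that
   antisymmetrization divides its squared norm by the number of variables: this
   is the Ito isometry. *)
Lemma ito_isometry n (W : n.+1.-tuple T -> C) : L2fun (lam n.+1) W ->
  stab_antisymmetric m W -> (\forall u \ae lam n.+1, W u != 0 -> headmax u) ->
  n.+1%:R * fine (L2norm2 (lam n.+1) (antisymmetrize W)) = fine (L2norm2 (lam n.+1) W).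
Proof.
move=> LW aW hW; apply: L2norm2_antisymmetrize_eq => // s s0.
rewrite -(cintegral0 (lam n.+1)); apply: ae_eq_cintegral.
- exact: cintegrable_meas (L2fun_prod LW (L2fun_tperm s LW)).
- exact: cmeasurable_cst.
have [inj hs] := (ae_injective n.+1, ae_tperm s hW).
apply: filterS3 inj hW hs => u uinj hu hsu.
have [->|Wu] := eqVneq (W u) 0; first by rewrite conjc0 mul0r.
have [->|Wsu] := eqVneq (W (tperm_tuple s u)) 0; first by rewrite mulr0.
have := hsu Wsu; rewrite tperm_headmax => /forallP/(_ ord0) h0.
have /forallP/(_ (s ord0)) h1 := hu Wu.
have /uinj s00 : tnth u (s ord0) = tnth u ord0.
  by apply/eqP; rewrite eq_le h0 andbT; exact: h1.
by rewrite s00 eqxx in s0.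
Qed.

(** For a tuple with distinct entries exactly n! permutations bring the largest entry to the head,
    each contributing (n+1) f(u), and (n+1) n!/(n+1)! = 1. The factor n+1 is the one produced by the
    derivative. *)
Lemma antisymmetrize_headmax n (f : n.+1.-tuple T -> C) : antisymmetric_fun m f ->
  \forall u \ae lam n.+1,
    antisymmetrize (fun u => n.+1%:R * ((headmax u)%:R * f u)) u = f u.
Proof.
move=> /ae_all_perm af; apply: filterS2 (ae_injective n.+1) af => u uinj fu.
have [j jP] : exists j, forall i, (tnth u i : R) <= tnth u j.
  exists [arg max_(i > ord0) (tnth u i : R)]%O.
  by case: arg_maxP => // j _ jP i; exact: jP.
have hE (s : 'S_n.+1) : headmax (tperm_tuple s u) = (s ord0 == j).
  rewrite tperm_headmax; apply/forallP/eqP => [hs|-> //].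
  by apply: uinj; apply/eqP; rewrite eq_le jP hs.
rewrite /antisymmetrize.
under eq_bigr => s _.
  rewrite hE fu (_ : (-1) ^+ s * (n.+1%:R * ((s ord0 == j)%:R * ((-1) ^+ s * f u))) =
    (s ord0 == j)%:R * (n.+1%:R * f u)); last exact: sgn_cancel.
  over.
rewrite (bigID (fun s : 'S_n.+1 => s ord0 == j))/= [X in _ + X]big1 ?addr0; last first.
  by move=> s /negbTE ->; rewrite mul0r.
under eq_bigr => s -> do rewrite mul1r.
rewrite sum_stab -[_ *+ n`!]mulr_natl factS natrM invfM.
have n0 : n.+1%:R != 0 :> C by rewrite pnatr_eq0.
have f0 : n`!%:R != 0 :> C by rewrite pnatr_eq0 -lt0n fact_gt0.
by move: (n.+1%:R : C) (n`!%:R : C) n0 f0 => p q p0 q0; field; rewrite p0 q0.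
Qed.

(** Open on the left, so that it vanishes on the times up to [a] and equals exactly the difference
    of the indicators of [0, b] and [0, a] when [0 <= a <= b]. *)
Definition itv_ind (a b : R) : T -> C := fun x => (nat_of_bool (a < (x : R) <= b))%:R.

Lemma abs2_bool (b : bool) : abs2 (b%:R : C) = b%:R.
Proof. by case: b; rewrite /abs2/= ?expr1n ?expr0n addr0. Qed.

Lemma cmeasurable_ind d' (T' : measurableType d') (A : set T') : measurable A ->
  cmeasurable (fun x => (x \in A)%:R : C).
Proof.
move=> mA; rewrite (_ : (fun x => _) = (fun x => ((\1_A x)%:C)%C)).
  by apply: cmeasurable_real; exact: measurable_indic.
by apply/funext => x; rewrite indicE rmorph_nat.
Qed.

Lemma L2norm2_ind d' (T' : measurableType d') (mu : {measure set T' -> \bar R})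
  (A : set T') : measurable A -> L2norm2 mu (fun x => (x \in A)%:R : C) = mu A.
Proof.
move=> mA; rewrite -[A in RHS]setIT -integral_indic//.
by apply: eq_integral => x _; rewrite abs2_bool indicE.
Qed.

Lemma L2fun_ind d' (T' : measurableType d') (mu : {measure set T' -> \bar R})
  (A : set T') : measurable A -> (mu A < +oo)%E -> L2fun mu (fun x => (x \in A)%:R : C).
Proof. by move=> mA Aoo; split; [exact: cmeasurable_ind|rewrite L2norm2_ind]. Qed.

Lemma itv_indE a b : itv_ind a b = (fun x => (x \in `]a, b]%classic)%:R).
Proof. by apply/funext => x; rewrite mem_setE in_itv. Qed.

(** The sets over which the integral of [h] vanishes form a Dynkin system; the vanishing of the
    total integral is what gives stability under complements. *)
Lemma dynkin_null d' (T' : measurableType d') (mu : {measure set T' -> \bar R})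
  (G : set (set T')) (h : T' -> \bar R) : mu.-integrable setT h ->
  measurable = <<s G >> -> setI_closed G -> (\int[mu]_x h x = 0)%E ->
  (forall S, G S -> \int[mu]_(x in S) h x = 0)%E -> \forall x \ae mu, h x = 0%E.
Proof.
move=> ih GE GI hT hG.
have hS S : measurable S -> (\int[mu]_(x in S) h x = 0)%E.
  rewrite GE; move: S; apply: (@dynkin_induction _ T' G) => //.
    move=> A mA hA; move: hT; rewrite -(setUv A) integral_setU//.
    - by rewrite hA add0e.
    - exact: measurableC.
    - by rewrite setUv; exact: measurable_int ih.
    - by apply/disj_setPS; rewrite setICr.
  move=> F mF tF hF; rewrite integral_bigcup//; first by rewrite eseries0.
  by apply: integrableS ih => //; exact: bigcup_measurable.
have := @integral_ae_eq _ _ _ mu setT measurableT (cst 0%E) h ih (measurable_cst _).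
have H (A : set T') : A `<=` setT -> measurable A -> (\int[mu]_(x in A) h x = \int[mu]_(x in A) cst 0 x)%E.
  by move=> _ mA; rewrite hS// integral0.
by move=> /(_ H); apply: filterS => x /(_ Logic.I).
Qed.

Definition head_rectangles n : set (set (n.+1.-tuple T)) :=
  [set S | exists (c e : R) B, measurable B /\
    S = [set u | (c < (thead u : R) <= e) /\ B (tbehead u)]].

Lemma setI_head_rectangles n : setI_closed (@head_rectangles n).
Proof.
move=> _ _ [c [e [B [mB ->]]]] [c' [e' [B' [mB' ->]]]].
exists (Num.max c c'), (Num.min e e'), (B `&` B'); split; first exact: measurableI.
apply/seteqP; split => u /=; rewrite gt_max le_min.
  by move=> [[/andP[-> ->] Bu] [/andP[-> ->] B'u]].
by move=> [/andP[/andP[-> ->] /andP[-> ->]] [? ?]].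
Qed.

Lemma measurable_head_rectangle n (c e : R) (B : set (n.-tuple T)) : measurable B ->
  measurable [set u : n.+1.-tuple T | (c < (thead u : R) <= e) /\ B (tbehead u)].
Proof.
move=> mB; apply: measurableI.
  rewrite -[X in measurable X]setTI.
  have := @measurable_thead _ _ n measurableT _ (@measurable_itv R `]c, e]).
  by congr (measurable (_ `&` _)); apply/seteqP; split => u /=; rewrite in_itv.
by rewrite -[X in measurable X]setTI; exact: measurable_tbehead.
Qed.

(** A condition on a tail coordinate is a union of rectangles whose heads range over ]-k, k]; for
    the head, the Borel sets with a good preimage form a sigma-algebra containing the half-open
    intervals. *)
Lemma measurable_head_rectangles n : @measurable _ (n.+1.-tuple T) = <<s @head_rectangles n >>.
Proof.
apply/seteqP; split; last first.
  apply: smallest_sub; first exact: sigma_algebra_measurable.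
  by move=> _ [c [e [B [mB ->]]]]; exact: measurable_head_rectangle.
apply: smallest_sub; first exact: smallest_sigma_algebra.
rewrite -bigcup_seq; apply: bigcup_sub => i _ A [A' mA' <-]; rewrite setTI.
case: (unliftP ord0 i) => [j ->|->].
  rewrite (_ : _ @^-1` _ = \bigcup_k [set u | (- k%:R < (thead u : R) <= k%:R) /\
      ((fun t => tnth t j) @^-1` A') (tbehead u)]).
    apply: sigma_algebra_bigcup => k; apply: sub_sigma_algebra.
    exists (- k%:R), k%:R, ((fun t => tnth t j) @^-1` A'); split => //.
    by rewrite -[X in measurable X]setTI; exact: measurable_tnth.
  apply/seteqP; split => u /=; last by move=> [k _ []]; rewrite tnth_tbehead.
  move=> Au; have [k uk] : exists k : nat, `|thead u : R| < k%:R.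
    by exists (Num.truncn `|thead u : R|).+1; rewrite truncnS_gt.
  exists k => //=; rewrite tnth_tbehead; split => //.
  by move: uk; rewrite ltr_norml => /andP[-> /ltW ->].
pose Q : set (set R) := [set A | <<s @head_rectangles n >> [set u | A (thead u : R)]].
suff : <<s @ocitv R >> `<=` Q by apply; exact: mA'.
apply: smallest_sub.
  split.
  - rewrite /Q/= (_ : [set u | _] = set0); first exact: sigma_algebra0.
    by apply/seteqP; split.
  - move=> B QB; rewrite /Q/=.
    rewrite (_ : [set u | _] = setT `\` [set u : n.+1.-tuple T | B (thead u : R)]).
      exact: sigma_algebraCD.
    by apply/seteqP; split => u /= [].
  - move=> B QB; rewrite /Q/=.
    rewrite (_ : [set u | _] = \bigcup_k [set u : n.+1.-tuple T | B k (thead u : R)]).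
      exact: sigma_algebra_bigcup.
    by apply/seteqP; split.
move=> _ [[c e] _ <-]; rewrite /Q/=; apply: sub_sigma_algebra.
exists c, e, setT; split => //.
by apply/seteqP; split => u /=; rewrite in_itv//= => -[].
Qed.

Definition below n (a : R) : set (n.-tuple T) := [set t | forall i, (tnth t i : R) <= a].

Lemma belowE n a : @below n a = tuple_box (fun=> `]-oo, a]%classic).
Proof. by apply/seteqP; split => t ta i; have := ta i; rewrite /= in_itv. Qed.

Lemma measurable_below n a : measurable (@below n a).
Proof. by rewrite belowE; apply: measurable_tuple_box => i; exact: measurable_itv. Qed.

Definition above_below n (q e : R) (u : n.+1.-tuple T) : bool :=
  (q < (thead u : R) <= e) && (tbehead u \in below q).

Hypothesis m_neg : m `]-oo, 0]%classic = 0%E.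
Hypothesis m_fin : forall a : R, (m `]-oo, a]%classic < +oo)%E.

Lemma lam_below n a : (lam n (below a) < +oo)%E.
Proof.
rewrite belowE lam_tuple_box; last by move=> i; exact: measurable_itv.
suff /andP[] : (0 <= \big[mule/1%E]_(i < n) m `]-oo, a]%classic < +oo)%E by [].
elim/big_ind : _ => [|x y /andP[x0 xoo] /andP[y0 yoo]|i _].
+ by rewrite lee01 ltry.
+ by rewrite mule_ge0//= lte_mul_pinfty// ge0_fin_numE.
+ by rewrite measure_ge0 m_fin.
Qed.

Lemma L2fun_itv_ind a b : L2fun m (itv_ind a b).
Proof.
rewrite itv_indE; apply: L2fun_ind; first exact: measurable_itv.
apply: le_lt_trans (m_fin b); apply: le_measure; rewrite ?inE; try exact: measurable_itv.
by move=> x /=; rewrite !in_itv/= => /andP[].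
Qed.

Lemma L2fun_ind_below n q B : measurable B ->
  L2fun (lam n) (fun t => (t \in B `&` below q)%:R : C).
Proof.
have mb := @measurable_below n q.
move=> mB; apply: L2fun_ind; first exact: measurableI.
apply: le_lt_trans (@lam_below n q); apply: le_measure; rewrite ?inE//; exact: measurableI.
Qed.

Lemma above_belowE n q e : [set u | @above_below n q e u] =
  [set u | (q < (thead u : R) <= e) /\ below q (tbehead u)].
Proof. apply/seteqP; split => u /=; rewrite /above_below.
  by move=> /andP[-> /set_mem].
by move=> [-> /mem_set]. Qed.

Lemma L2fun_above_below n q e : L2fun (lam n.+1) (fun u => (@above_below n q e u)%:R : C).
Proof.
have mb := @measurable_below n q.
have mA : measurable [set u | @above_below n q e u].
  by rewrite above_belowE; exact: measurable_head_rectangle.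
have fA : (lam n.+1 [set u | @above_below n q e u] < +oo)%E.
  have -> : lam n.+1 [set u | @above_below n q e u] = (m `]q, e]%classic * lam n (below q))%E.
    rewrite lamSE (_ : _ @^-1` _ = `]q, e]%classic `*` below q).
      by apply: product_measure1E => //; exact: measurable_itv.
    by rewrite above_belowE; apply/seteqP; split => -[x t] /=; rewrite in_itv/= tbehead_tcons thead_tcons.
  rewrite lte_mul_pinfty//.
    rewrite ge0_fin_numE//; apply: le_lt_trans (m_fin e).
    apply: le_measure; rewrite ?inE; try exact: measurable_itv.
    by move=> x /=; rewrite !in_itv/= => /andP[].
  exact: lam_below.
have := L2fun_ind mA fA; congr L2fun; apply/funext => u.
by congr ((nat_of_bool _)%:R); apply/idP/idP; rewrite inE.
Qed.

(* The kernels 1_]a,b] (x) g are tested against the rectangles ]a,b] x B with a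
   above all of B; these generate the measurable subsets of the region
   {s <= a < t}, and countably many regions cover the region {s < t}. *)
Lemma headmax_total n (T0 : R) (f : n.+1.-tuple T -> C) : Lambda m f ->
  (forall a b, 0 <= a -> a <= b -> b <= T0 -> forall g : n.-tuple T -> C,
     Lambda m g -> (forall t, g t != 0 -> below a t) ->
     ldot (lam n.+1) (antisymmetrize (tensor (itv_ind a b) g)) f = 0) ->
  \forall u \ae lam n.+1, below T0 u -> f u = 0.
Proof.
move=> Lf ortho; have [Lf2 af] := Lf; have [mf _] := Lf2.
have iSh q : cintegrable (lam n.+1) (fun u => (above_below q T0 u)%:R * f u).
  have := L2fun_prod (L2fun_above_below n q T0) Lf2; congr cintegrable.
  by apply/funext => u; rewrite conjc_nat.
have rect (q : R) : 0 <= q -> forall c e (B : set (n.-tuple T)), measurable B ->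
    cintegral (lam n.+1) (fun u => ((above_below q T0 u)%:R *
      ((c < (thead u : R) <= e) && (tbehead u \in B))%:R) * f u) = 0.
  move=> q0 c e B mB.
  (* The head lies in ]q, T0] on the region and in ]c, e] on the rectangle; ]a, b] is the
     intersection, and [a >= q] puts the tails below [q] among those up to [a], as the hypothesis
     requires. *)
  pose a := Num.max c q; pose b := Num.min e T0.
  have ind_eq u : above_below q T0 u && ((c < (thead u : R) <= e) && (tbehead u \in B)) =
      (a < (thead u : R) <= b) && (tbehead u \in B `&` below q).
    rewrite /above_below /a /b gt_max le_min in_setI.
    by case: (q < _); case: (_ <= T0); case: (c < _); case: (_ <= e); case: (_ \in B);
      case: (_ \in _).
  under [X in cintegral _ X]eq_fun => u do rewrite -natrM mulnb ind_eq.
  have [ab|ba] := leP a b; last first.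
    rewrite -[RHS](cintegral0 (lam n.+1)); congr cintegral; apply/funext => u.
    case: (boolP (a < _ <= b)) => [/andP[au ub]|_]; last by rewrite mul0r.
    by have := lt_le_trans au ub; rewrite ltNge (ltW ba).
  have a0 : 0 <= a by rewrite le_max q0 orbT.
  have bT : b <= T0 by rewrite ge_min lexx orbT.
  have LB := L2fun_ind_below q mB.
  have := ortho a b a0 ab bT _ (Lambda_antisymmetrize LB).
  (* The test kernel must be antisymmetric, so the indicator of the tails was antisymmetrized;
     against the antisymmetric [f] both this and the outer antisymmetrization can be removed. *)
  rewrite ldot_antisymmetrize//; last first.
    by apply: L2fun_tensor; [exact: L2fun_itv_ind | exact: L2fun_antisymmetrize LB].
  rewrite ldot_tensor_antisymmetrize//; last exact: L2fun_itv_ind.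
  move=> gz; rewrite -[RHS]gz; last first.
    move=> t gt0 i; apply: contrapT => ti; move/negP: gt0; apply; apply/eqP.
    rewrite /antisymmetrize big1 ?mulr0// => s _.
    rewrite memNset ?mulr0// => -[_ /(_ ((s^-1)%g i))].
    rewrite tnth_mktuple permKV => tq; apply: ti; rewrite (le_trans tq)//.
    by rewrite le_max lexx orbT.
  congr cintegral; apply/funext => u; rewrite tensorE conjcM !conjc_nat.
  by rewrite /itv_ind -natrM mulnb.
have f0Sh q : 0 <= q -> \forall u \ae lam n.+1, above_below q T0 u -> f u = 0.
  move=> q0; have [ir ii] := iSh q.
  have key (p : C -> R) : (forall (b : bool) z, p (b%:R * z) = b%:R * p z) ->
      (forall g, cintegral (lam n.+1) g = 0 -> Rintegral (lam n.+1) setT (fun u => p (g u)) = 0) ->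
      (lam n.+1).-integrable setT (EFin \o (fun u => p ((above_below q T0 u)%:R * f u))) ->
      \forall u \ae lam n.+1, p ((above_below q T0 u)%:R * f u) = 0.
    move=> pM p0 ip.
    have rect0 c e B : measurable B -> (\int[lam n.+1]_(u in
        [set u | ((c < (thead u : R) <= e) /\ B (tbehead u))%R])
        (p ((above_below q T0 u)%:R * f u)%R)%:E = 0)%E.
      move=> mB; have mS := measurable_head_rectangle c e mB.
      apply/eqP; rewrite -fine_eq0; last by apply: integrable_fin_num => //; apply: integrableS ip.
      rewrite integral_mkcond; apply/eqP; rewrite -[RHS](p0 _ (rect q q0 c e B mB)).
      congr fine; apply: eq_integral => u _; rewrite /patch [_ * _%:R]mulrC -mulrA !pM.
      case: ifPn => [|/negP]; rewrite inE/=.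
        by move=> [-> Bu]; rewrite mem_set// mul1r.
      move=> h; case: andP => [[h1]|_]; last by rewrite mul0r.
      by rewrite inE => h2; case: h.
    (* The integrand is carried by heads in ]q, T0], so its total integral is the one over the
       rectangle with this head and an arbitrary tail. *)
    have intT : (\int[lam n.+1]_u (p ((above_below q T0 u)%:R * f u)%R)%:E = 0)%E.
      rewrite -[RHS](rect0 q T0 setT measurableT) [RHS]integral_mkcond.
      apply: eq_integral => u _; rewrite /patch; case: ifPn => [//|/negP]; rewrite inE/=.
      move=> h; rewrite pM (_ : above_below q T0 u = false) ?mul0r//.
      by apply/negP => /andP[h1 _]; apply: h.
    have := dynkin_null ip (measurable_head_rectangles n) (@setI_head_rectangles n) intT.
    have H S : head_rectangles S -> (\int[lam n.+1]_(u in S) (p ((above_below q T0 u)%:R * f u)%R)%:E = 0)%E.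
      by move=> [c [e [B [mB ->]]]]; exact: rect0.
    by move=> /(_ H); apply: filterS => u [].
  have kr : \forall u \ae lam n.+1, complex.Re ((above_below q T0 u)%:R * f u) = 0.
    apply: key => // [b z|g]; first by case: b; rewrite ?mul1r ?mul0r.
    by move=> /(congr1 (@complex.Re R)).
  have ki : \forall u \ae lam n.+1, complex.Im ((above_below q T0 u)%:R * f u) = 0.
    apply: key => // [b z|g]; first by case: b; rewrite ?mul1r ?mul0r.
    by move=> /(congr1 (@complex.Im R)).
  apply: filterS2 kr ki => u + + su; rewrite su mul1r => fr fi.
  exact: complex_ext.
have fhead : \forall u \ae lam n.+1, headmax u -> (thead u : R) <= T0 -> f u = 0.
  have q_ae : \forall u \ae lam n.+1, forall k,
      0 <= (ratr (odflt 0%Q (unpickle k)) : R) ->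
      above_below (ratr (odflt 0%Q (unpickle k))) T0 u -> f u = 0.
    apply: ae_foralln => k; have [q0|q0] := boolP (0 <= (ratr (odflt 0%Q (unpickle k)) : R)).
      by apply: filterS (f0Sh _ q0) => u + _.
    by apply: nearW.
  have pos : \forall u \ae lam n.+1, 0 < (thead u : R).
    apply: (@ae_thead _ _ _ m n (fun x => 0 < (x : R))).
    exists `]-oo, 0]%classic; split => //.
    by move=> x /= /negP; rewrite -leNgt in_itv.
  apply: filterS3 (ae_injective n.+1) pos q_ae => u uinj u0 uq /forallP hu uT.
  (* The default 0 makes [M] nonnegative and does not spoil [M < thead u], heads being almost
     everywhere positive. A rational between [M] and the head puts [u] in one of countably many
     regions. *)
  pose M := \big[Num.max/0]_(i < n) (tnth (tbehead u) i : R).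
  have Mu : M < thead u.
    rewrite /M; elim/big_ind : _ => [//|x y xu yu|i _]; first by rewrite gt_max xu.
    rewrite lt_neqAle tnth_tbehead hu andbT; apply/eqP => /uinj.
    by move=> /(congr1 val).
  have M0 : 0 <= M by rewrite /M; elim/big_rec: _ => // i x _ x0; rewrite le_max x0 orbT.
  have [q] := rat_in_itvoo Mu; rewrite in_itv/= => /andP[Mq qu].
  apply: (uq (pickle q)); rewrite pickleK/=; first exact: le_trans M0 (ltW Mq).
  rewrite /above_below qu uT/= inE => i; apply: le_trans (ltW Mq).
  by rewrite /M (bigD1 i)//= le_max lexx.
have fperm := ae_all_perm af.
(* Antisymmetry extends the vanishing to all tuples: the transposition of the head with the position
   of the largest entry leads back to the region just treated, at the cost of a sign. *)
have sperm : \forall u \ae lam n.+1, forall s : 'S_n.+1,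
    headmax (tperm_tuple s u) -> (thead (tperm_tuple s u) : R) <= T0 -> f (tperm_tuple s u) = 0.
  by apply: filter_forall => s; exact: (ae_tperm s fhead).
apply: filterS2 fperm sperm => u fu su uT.
have [j jP] : exists j, forall i, (tnth u i : R) <= tnth u j.
  exists [arg max_(i > ord0) (tnth u i : R)]%O.
  by case: arg_maxP => // j _ jP i; exact: jP.
have := su (tperm ord0 j); rewrite tperm_headmax fu /thead tnth_mktuple tpermL => /(_ _ _)/eqP.
rewrite mulf_eq0 signr_eq0/= => h; apply/eqP/h => //.
by apply/forallP.
Qed.

End ordering.

(** * The Fock space as an L^2 space *)

Lemma nneseries_term_le (R : realType) (a : nat -> \bar R) n :
  (forall n, (0 <= a n)%E) -> (a n <= \sum_(0 <= n <oo) a n)%E.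
Proof.
move=> a0; rewrite (@nneseriesD1 _ a n xpredT)//.
by apply: leeDl; apply: nneseries_ge0.
Qed.

Section fock_measure.
Variable R : realType.
Local Notation C := R[i].
Local Notation T := (measurableTypeR R).
Local Notation lam := (tuple_measure (lebRp R)).

(* The Fock space is realized as a closed subspace of L^2 of the measure
   sum_n n! lam_n on finite sequences. *)
Definition fseq : Type := seq T.

HB.instance Definition _ := Choice.on fseq.
HB.instance Definition _ := isPointed.Build fseq [::].

Definition level n (A : set fseq) : set (n.-tuple T) := [set t | A (tval t)].
Arguments level n A : clear implicits.

Definition measurable_fseq : set (set fseq) := [set A | forall n, measurable (level n A)].

Lemma measurable_fseq0 : measurable_fseq set0.
Proof. by move=> n; rewrite (_ : level n _ = set0)//; apply/seteqP; split. Qed.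

Lemma measurable_fseqC A : measurable_fseq A -> measurable_fseq (~` A).
Proof. by move=> mA n; exact: measurableC (mA n). Qed.

Lemma measurable_fseq_bigcup (F : (set fseq)^nat) : (forall i, measurable_fseq (F i)) ->
  measurable_fseq (\bigcup_i F i).
Proof.
move=> mF n; rewrite (_ : level n _ = \bigcup_i level n (F i)).
  by apply: bigcup_measurable => i _; exact: mF.
by apply/seteqP; split.
Qed.

HB.instance Definition _ := @isMeasurable.Build default_measure_display fseq
  measurable_fseq measurable_fseq0 measurable_fseqC measurable_fseq_bigcup.

Definition of_tuple n (t : n.-tuple T) : fseq := tval t.

Lemma measurable_of_tuple n : measurable_fun setT (@of_tuple n).
Proof. by move=> _ A mA; rewrite setTI; exact: mA. Qed.

Definition fock_level n : {measure set fseq -> \bar R} :=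
  measure_function_pushforward__canonical__measure_function_Measure (lam n) (@measurable_of_tuple n).

Definition fock_measure : {measure set fseq -> \bar R} :=
  mseries (fun n => mscale (n`!%:R)%:nng (fock_level n)) 0.

Local Notation mu := fock_measure.

Lemma fock_measureE A : mu A = (\sum_(0 <= n <oo) (n`!%:R)%:E * lam n (level n A))%E.
Proof. by []. Qed.

Lemma ge0_integral_fock (f : fseq -> \bar R) : measurable_fun setT f ->
  (forall s, (0 <= f s)%E) ->
  (\int[mu]_s f s = \sum_(0 <= n <oo) (n`!%:R)%:E * \int[lam n]_t f (of_tuple t))%E.
Proof.
move=> mf f0; rewrite ge0_integral_measure_series//.
apply: eq_eseriesr => n _; rewrite ge0_integral_mscale//; congr (_ * _)%E.
exact: (ge0_integral_pushforward (@measurable_of_tuple n) (lam n) measurableT mf).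
Qed.

Lemma measurable_fseqP d' (T' : measurableType d') (f : fseq -> T') :
  measurable_fun setT f <-> forall n, measurable_fun setT (f \o @of_tuple n).
Proof.
split=> [mf n|mf _ A mA]; first exact: measurableT_comp mf (@measurable_of_tuple n).
by rewrite setTI; change (measurable_fseq (f @^-1` A)) => n; have := mf n measurableT A mA; rewrite setTI.
Qed.

(** All weights n! are positive, so a null set is null on each level; conversely the null sets
    chosen on the levels are glued along the length of a sequence. *)
Lemma ae_fockP (P : fseq -> Prop) : (\forall s \ae mu, P s) <->
  (forall n, \forall t \ae lam n, P (of_tuple t)).
Proof.
split=> [[N [mN N0 NP]] n|H].
  exists (level n N); split; [exact: mN| |by move=> t; exact: NP].
  have : (mu N <= 0)%E by rewrite N0.
  move=> N0'; apply/eqP; rewrite eq_le measure_ge0 andbT.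
  have : ((n`!%:R)%:E * lam n (level n N) <= 0)%E.
    apply: le_trans N0'; rewrite fock_measureE.
    by apply: (@nneseries_term_le _ (fun n => _)) => k; rewrite mule_ge0.
  by rewrite pmule_rle0// lte_fin ltr0n fact_gt0.
pose N n := projT1 (cid (H n)).
have NP n : [/\ measurable (N n), lam n (N n) = 0%E & ~` [set t | P (of_tuple t)] `<=` N n].
  exact: (projT2 (cid (H n))).
pose M : set fseq := [set s | exists n (t : n.-tuple T), s = of_tuple t /\ N n t].
have ME n : level n M = N n.
  apply/seteqP; split => [t [k [t' [tt' Nt']]]|t Nt]; last by exists n, t.
  have kn : k = n by rewrite -(size_tuple t') -(size_tuple t); congr size.
  by subst k; rewrite (_ : t = t')//; exact: val_inj.
exists M; split.
- by move=> n; rewrite ME; have [] := NP n.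
- by rewrite fock_measureE eseries0// => n _ _; rewrite ME; have [_ -> _] := NP n; rewrite mule0.
- by move=> s Ps; exists (size s), (in_tuple s); split => //; have [_ _ +] := NP (size s); apply.
Qed.

Lemma fine_series (a : nat -> \bar R) : (forall n, (0 <= a n)%E) ->
  (\sum_(0 <= n <oo) a n < +oo)%E ->
  \sum_(n < N) fine (a n) @[N --> \oo] --> fine (\sum_(0 <= n <oo) a n)%E.
Proof.
move=> a0 aoo; have afin n : a n \is a fin_num.
  rewrite ge0_fin_numE//; apply: le_lt_trans aoo.
  exact: nneseries_term_le.
have := @is_cvg_nneseries R a xpredT 0%N (fun n _ _ => a0 n).
move=> /cvg_ex[l al]; have lE : l = (\sum_(0 <= n <oo) a n)%E by apply/esym/cvg_lim.
rewrite -lE in aoo *.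
have l0 : (0 <= l)%E by rewrite lE; exact: nneseries_ge0.
have lfin : l \is a fin_num by rewrite ge0_fin_numE.
have /fine_cvgP[_] : (\sum_(0 <= n < N) a n)%E @[N --> \oo] --> (fine l)%:E by rewrite fineK.
apply: cvg_trans; apply: near_eq_cvg; apply: nearW => N /=.
rewrite -sum_fine ?big_mkord//.
Qed.

Lemma fine_mul_gt0 (c : R) (x : \bar R) : 0 < c -> fine (c%:E * x)%E = c * fine x.
Proof.
move=> c0; case: x => [r| |] //=.
- by rewrite gt0_muley ?lte_fin//= mulr0.
- by rewrite gt0_muleNy ?lte_fin//= mulr0.
Qed.

Lemma ge0_Rintegral_fock (f : fseq -> \bar R) : measurable_fun setT f ->
  (forall s, (0 <= f s)%E) -> (\int[mu]_s f s < +oo)%E ->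
  \sum_(n < N) n`!%:R * fine (\int[lam n]_t f (of_tuple t))%E @[N --> \oo] -->
    fine (\int[mu]_s f s)%E.
Proof.
move=> mf f0; rewrite ge0_integral_fock// => foo.
have := fine_series (fun n => _) foo.
move=> h; have -> : (fun N => \sum_(n < N) n`!%:R * fine (\int[lam n]_t f (of_tuple t))%E) =
    (fun N => \sum_(n < N) fine ((n`!%:R)%:E * \int[lam n]_t f (of_tuple t))%E).
  apply/funext => N; apply: eq_bigr => n _.
  by rewrite fine_mul_gt0 ?ltr0n ?fact_gt0.
by apply: h => n; rewrite mule_ge0// integral_ge0.
Qed.

Lemma integrable_fock_level (f : fseq -> R) n : mu.-integrable setT (EFin \o f) ->
  (lam n).-integrable setT (EFin \o (fun t => f (of_tuple t))).
Proof.
move=> /integrableP[mf foo]; apply/integrableP; split.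
  exact: (measurableT_comp mf (@measurable_of_tuple n)).
move: foo; rewrite ge0_integral_fock//; last exact: measurableT_comp.
have g0 k : (0 <= (k`!%:R)%:E * \int[lam k]_t `|(f (of_tuple t))%:E|)%E.
  by rewrite mule_ge0// integral_ge0.
move=> /(le_lt_trans (nneseries_term_le n g0)).
rewrite -!ge0_fin_numE ?integral_ge0//; move: (\int[_]__ _)%E => -[r| |]//=.
by rewrite gt0_muley ?lte_fin ?ltr0n ?fact_gt0.
by rewrite gt0_muleNy ?lte_fin ?ltr0n ?fact_gt0.
Qed.

Lemma Rintegral_fock (f : fseq -> R) : mu.-integrable setT (EFin \o f) ->
  \sum_(n < N) n`!%:R * Rintegral (lam n) setT (fun t => f (of_tuple t)) @[N --> \oo] -->
    Rintegral mu setT f.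
Proof.
move=> intf; have [mf foo] := integrableP _ _ _ intf.
rewrite /Rintegral integralE fineB; last 2 first.
- exact: integrable_pos_fin_num.
- exact: integrable_neg_fin_num.
have := cvgB (ge0_Rintegral_fock (measurable_funepos mf) _ _)
  (ge0_Rintegral_fock (measurable_funeneg mf) _ _).
have p0 := @funepos_ge0 fseq R (EFin \o f).
have n0 := @funeneg_ge0 fseq R (EFin \o f).
have poo : (\int[mu]_s (EFin \o f)^\+ s < +oo)%E.
  by rewrite -ge0_fin_numE ?integral_ge0//; exact: integrable_pos_fin_num.
have noo : (\int[mu]_s (EFin \o f)^\- s < +oo)%E.
  by rewrite -ge0_fin_numE ?integral_ge0//; exact: integrable_neg_fin_num.
move=> /(_ _ p0 poo n0 noo); apply: cvg_trans; apply: near_eq_cvg; apply: nearW => N /=.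
rewrite [LHS](_ : _ = \sum_(n < N) n`!%:R * fine (\int[lam n]_t (EFin \o f)^\+ (of_tuple t))%E -
  \sum_(n < N) n`!%:R * fine (\int[lam n]_t (EFin \o f)^\- (of_tuple t))%E)//.
rewrite -sumrB; apply: eq_bigr => n _; rewrite -mulrBr; congr (_ * _).
have il := integrable_fock_level n intf.
rewrite [X in _ = fine X]integralE [RHS]fineB; last 2 first.
- exact: integrable_pos_fin_num.
- exact: integrable_neg_fin_num.
congr (fine _ - fine _); apply: eq_integral => t _; rewrite ?funeposE ?funenegE//.
Qed.

Lemma cmeasurable_fseqP (f : fseq -> C) :
  cmeasurable f <-> forall n, cmeasurable (f \o @of_tuple n).
Proof.
split=> [[/measurable_fseqP mr /measurable_fseqP mi] n|mf].
  by split; [exact: mr|exact: mi].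
by split; apply/measurable_fseqP => n; have [] := mf n.
Qed.

Lemma L2norm2_fock (f : fseq -> C) : cmeasurable f -> L2norm2 mu f = prefock_norm2 f.
Proof.
move=> mf; rewrite /L2norm2 ge0_integral_fock//; first exact: measurable_abs2.
by move=> s; rewrite lee_fin abs2_ge0.
Qed.

(** This identifies the inner product of Fock space, defined by limits of partial sums over the
    levels, with a single L^2 inner product, to which the Hilbert space properties of L^2 apply. *)
Lemma cintegral_fock (f : fseq -> C) : cintegrable mu f ->
  let S N := \sum_(n < N) n`!%:R * cintegral (lam n) (fun t => f (of_tuple t)) in
  cintegral mu f = (limn (fun N => complex.Re (S N)) +i* limn (fun N => complex.Im (S N)))%C.
Proof.
move=> [ir ii] S; have [cr ci] := (Rintegral_fock ir, Rintegral_fock ii).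
have nE n (z : C) : n`!%:R * z = ((n`!%:R : R)%:C)%C * z by rewrite rmorph_nat.
rewrite /cintegral; congr (_ +i* _)%C; apply/esym/cvg_lim => //.
  move: cr; apply: cvg_trans; apply: near_eq_cvg; apply: nearW => N /=.
  by rewrite /S cRe_sum; apply: eq_bigr => n _; rewrite nE cReMl.
move: ci; apply: cvg_trans; apply: near_eq_cvg; apply: nearW => N /=.
by rewrite /S cIm_sum; apply: eq_bigr => n _; rewrite nE cImMl.
Qed.

End fock_measure.

Section fock_hilbert.
Variable R : realType.
Local Notation C := R[i].
Local Notation T := (measurableTypeR R).
Local Notation lam := (tuple_measure (lebRp R)).
Local Notation mu := (fock_measure R).
Local Notation fock := (fock R).

Lemma prefock_predP (h : fseq R -> C) : h \in @prefock_pred R <->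
  (forall n, antisymmetric_fun (lebRp R) (@chaos_comp R h n)) /\ L2fun mu h.
Proof.
split=> [/asboolP[Lh hoo]|[ah [mh hoo]]].
  split=> [n|]; first by have [] := Lh n.
  have mh : cmeasurable h by apply/cmeasurable_fseqP => n; have [[]] := Lh n.
  by split => //; rewrite L2norm2_fock.
apply/asboolP; rewrite -L2norm2_fock//; split => // n; split => //; split.
  by move/cmeasurable_fseqP: mh; apply.
have : (L2norm2 mu h < +oo)%E by [].
rewrite L2norm2_fock// /prefock_norm2 => hoo'.
have h0 k : (0 <= (k`!%:R)%:E * L2norm2 (lam k) (@chaos_comp R h k))%E.
  by rewrite mule_ge0// L2norm2_ge0.
have := le_lt_trans (nneseries_term_le n h0) hoo'.
have := L2norm2_ge0 (lam n) (@chaos_comp R h n).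
case: (L2norm2 _ _) => [r| |]//=; first by rewrite !ltry.
by rewrite gt0_muley ?lte_fin ?ltr0n ?fact_gt0.
Qed.

Lemma fock_L2fun (x : fock) : L2fun mu (repr x : fseq R -> C).
Proof. by case: (repr x) => h /= /prefock_predP[]. Qed.

Lemma fock_comp_Lambda (x : fock) n : Lambda (lebRp R) (@fock_comp R x n).
Proof. by rewrite /fock_comp; case: (repr x) => h /= /asboolP[]. Qed.

Lemma fock_dotE (x y : fock) :
  fock_dot x y = ldot mu (repr x : fseq R -> C) (repr y : fseq R -> C).
Proof.
rewrite /ldot cintegral_fock//; exact: L2fun_prod (fock_L2fun x) (fock_L2fun y).
Qed.

Lemma ae_repr_pi (f : prefock R) : \forall s \ae mu, (repr (\pi_fock f)%qT : fseq R -> C) s = (f : fseq R -> C) s.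
Proof.
apply/ae_fockP => n.
by have /eqmodP/asboolP/(_ n) : repr (\pi_fock f)%qT = f %[mod fock]%qT by rewrite reprK.
Qed.

Lemma fock_eqP (x y : fock) : x = y <->
  \forall s \ae mu, (repr x : fseq R -> C) s = (repr y : fseq R -> C) s.
Proof.
split=> [->|/ae_fockP xy]; first exact: nearW.
by rewrite -[x]reprK -[y]reprK; apply/eqmodP/asboolP.
Qed.

Lemma ae_reprZD (a : C) (x y : fock) : \forall s \ae mu,
  (repr (a *: x + y) : fseq R -> C) s =
  a * (repr x : fseq R -> C) s + (repr y : fseq R -> C) s.
Proof.
have -> : a *: x + y = (\pi_fock (a *: repr x + repr y))%qT.
  by rewrite -fock_addE -fock_scaleE !reprK.
exact: ae_repr_pi.
Qed.

Lemma ae_repr0 : \forall s \ae mu, (repr (0 : fock) : fseq R -> C) s = 0.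
Proof. exact: (ae_repr_pi 0). Qed.

Lemma fock_dotC (x y : fock) : fock_dot y x = conjc (fock_dot x y).
Proof. by rewrite !fock_dotE ldotC//; exact: fock_L2fun. Qed.

Lemma fock_dotZD (a : C) (x y z : fock) :
  fock_dot x (a *: y + z) = a * fock_dot x y + fock_dot x z.
Proof.
rewrite !fock_dotE -ldotZD; try exact: fock_L2fun.
have [[mx _] [[my _] [mz _]]] := (fock_L2fun x, (fock_L2fun y, fock_L2fun z)).
have [mw _] := fock_L2fun (a *: y + z).
apply: ae_eq_cintegral.
- exact: cmeasurableM (cmeasurable_conj mx) mw.
- by apply: cmeasurableM (cmeasurable_conj mx) _; exact: cmeasurableZD.
by apply: filterS (ae_reprZD a y z) => s ->.
Qed.

Lemma fock_dotxx (x : fock) :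
  fock_dot x x = ((fine (L2norm2 mu (repr x : fseq R -> C)))%:C)%C.
Proof. by rewrite fock_dotE ldotxx//; exact: fock_L2fun. Qed.

Lemma fock_dot_ge0 (x : fock) : 0 <= fock_dot x x.
Proof. by rewrite fock_dotxx lecR fine_ge0// L2norm2_ge0. Qed.

Lemma fock_dot_eq0 (x : fock) : fock_dot x x = 0 -> x = 0.
Proof.
rewrite fock_dotxx => /(congr1 (@complex.Re R))/= n0; apply/fock_eqP.
have [mx xoo] := fock_L2fun x.
have x0 : L2norm2 mu (repr x : fseq R -> C) = 0%E.
  by rewrite -[LHS]fineK ?n0//; apply: L2norm2_fin; split.
by apply: filterS2 (L2norm2_eq0 mx x0) ae_repr0 => s -> ->.
Qed.

Lemma fock_normE (x : fock) : fock_norm x = dot_norm (@fock_dot R) x.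
Proof.
rewrite /dot_norm fock_dotxx /fock_norm/= L2norm2_fock//.
by have [] := fock_L2fun x.
Qed.

Lemma fock_dist2 (x y : fock) : fine (L2norm2 mu (fun s =>
    (repr x : fseq R -> C) s - (repr y : fseq R -> C) s)) = complex.Re (fock_dot (x - y) (x - y)).
Proof.
rewrite fock_dotxx/=; congr fine; apply: ae_eq_L2norm2.
have := ae_reprZD (-1) y x; rewrite scaleN1r addrC.
by apply: filterS => s ->; rewrite mulN1r addrC.
Qed.

(** Fock space is closed in L^2 of [fock_measure], hence complete, because antisymmetry survives
    almost everywhere limits; null sets stay null under permutation of the variables. *)
Lemma antisymmetric_pointwise_ae (u : nat -> fseq R -> C) (g : fseq R -> C) n :
  (forall k, antisymmetric_fun (lebRp R) (@chaos_comp R (u k) n)) ->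
  pointwise_ae mu u g -> antisymmetric_fun (lebRp R) (@chaos_comp R g n).
Proof.
move=> au /ae_fockP/(_ n) ug s.
have aus : \forall t \ae lam n, forall k, chaos_comp (u k) (tperm_tuple s t) = (-1) ^+ s * chaos_comp (u k) t.
  by apply: ae_foralln => k; exact: au.
apply: filterS3 aus ug (ae_tperm s ug) => t ut [tr ti] [str sti].
have sE : ((-1) ^+ s : C) = (((-1) ^+ s : R)%:C)%C by rewrite rmorphXn rmorphN1.
apply: complex_ext; rewrite sE ?cReMl ?cImMl.
  apply: (cvg_unique (@Rhausdorff R) str).
  rewrite (_ : (fun k => _) = (fun k => (-1) ^+ s * complex.Re (u k (of_tuple t)))).
    by apply: cvgZr; exact: tr.
  by apply/funext => k; have := ut k; rewrite /chaos_comp /of_tuple => ->; rewrite sE cReMl.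
apply: (cvg_unique (@Rhausdorff R) sti).
rewrite (_ : (fun k => _) = (fun k => (-1) ^+ s * complex.Im (u k (of_tuple t)))).
  by apply: cvgZr; exact: ti.
by apply/funext => k; have := ut k; rewrite /chaos_comp /of_tuple => ->; rewrite sE cImMl.
Qed.

Lemma fock_complete (u : nat -> fock) :
  (forall e : R, 0 < e -> exists N, forall i j, (N <= i)%N -> (N <= j)%N ->
     dot_norm (@fock_dot R) (u i - u j) < e) ->
  exists l, dot_norm (@fock_dot R) (u k - l) @[k --> \oo] --> 0.
Proof.
move=> uC; pose v k : fseq R -> C := repr (u k).
have Lv k : L2fun mu (v k) := fock_L2fun (u k).
have dE (x y : fock) : (L2norm2 mu (fun s => ((repr x : fseq R -> C) s - (repr y : fseq R -> C) s)%R) =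
    (complex.Re (fock_dot (x - y) (x - y)))%:E)%E.
  rewrite -fock_dist2 fineK// L2norm2_fin//; exact: L2funB (fock_L2fun _) (fock_L2fun _).
have [|g [phi [Lg vg vlim]]] := L2_complete Lv.
  move=> e e0; have := uC (Num.sqrt e); rewrite sqrtr_gt0 => /(_ e0)[N NP].
  exists N => i j Ni Nj; rewrite dE lee_fin.
  by have := NP i j Ni Nj; rewrite /dot_norm ltr_sqrt// => /ltW.
have gP : g \in @prefock_pred R.
  apply/prefock_predP; split => // n.
  apply: antisymmetric_pointwise_ae vg => k; rewrite /v/=.
  by have [] := fock_comp_Lambda (u (phi k)) n.
pose l : fock := (\pi_fock (Prefock gP))%qT; exists l.
have lg : \forall s \ae mu, (repr l : fseq R -> C) s = g s := ae_repr_pi (Prefock gP).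
apply/cvgrPdist_lt => e e0; have := vlim (e ^+ 2 / 2); rewrite divr_gt0// ?exprn_gt0// => /(_ isT)[N NP].
exists N => // k /= /NP; rewrite sub0r normrN ger0_norm ?sqrtr_ge0//.
rewrite (_ : L2norm2 _ _ = L2norm2 mu (fun s => (repr (u k) : fseq R -> C) s - (repr l : fseq R -> C) s)).
  rewrite dE lee_fin => h; rewrite /dot_norm -[X in _ < X]ger0_norm ?(ltW e0)// -sqrtr_sqr ltr_sqrt ?exprn_gt0//.
  apply: le_lt_trans h _.
  by rewrite ltr_pdivrMr// ltr_pMr ?exprn_gt0// ltr1n.
by apply: ae_eq_L2norm2; apply: filterS lg => s ->.
Qed.

(* Locked, as the unifier would otherwise unfold the integrals. *)
Definition fock_inner : fock -> fock -> C := locked (@fock_dot R).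

Lemma fock_innerE : fock_inner = @fock_dot R.
Proof. by rewrite /fock_inner -lock. Qed.

Lemma fock_innerC (x y : fock) : fock_inner y x = conjc (fock_inner x y).
Proof. by rewrite fock_innerE fock_dotC. Qed.

Lemma fock_innerZD (a : C) (x y z : fock) :
  fock_inner x (a *: y + z) = a * fock_inner x y + fock_inner x z.
Proof. by rewrite fock_innerE fock_dotZD. Qed.

Lemma fock_inner_ge0 (x : fock) : 0 <= fock_inner x x.
Proof. by rewrite fock_innerE fock_dot_ge0. Qed.

Lemma fock_inner_eq0 (x : fock) : fock_inner x x = 0 -> x = 0.
Proof. by rewrite fock_innerE; exact: fock_dot_eq0. Qed.

Lemma fock_inner_complete (u : nat -> fock) :
  (forall e : R, 0 < e -> exists N, forall i j, (N <= i)%N -> (N <= j)%N ->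
     dot_norm fock_inner (u i - u j) < e) ->
  exists l, dot_norm fock_inner (u k - l) @[k --> \oo] --> 0.
Proof. by rewrite fock_innerE; exact: fock_complete. Qed.

HB.instance Definition _ := isHilbert.Build R fock
  fock_innerC fock_innerZD fock_inner_ge0 fock_inner_eq0 fock_inner_complete.

Lemma fock_dot_hdot (x y : fock) : fock_dot x y = hdot x y.
Proof. by rewrite -[RHS]/(fock_inner x y) fock_innerE. Qed.

Lemma fock_norm_hnorm (x : fock) : fock_norm x = hnorm x.
Proof. by rewrite fock_normE /hnorm -[hdot]/fock_inner fock_innerE. Qed.

End fock_hilbert.

Lemma sum_ord_widen (V : nmodType) (F : nat -> V) N M : (N <= M)%N ->
  \sum_(n < N) F n = \sum_(n < M) if (n < N)%N then F n else 0.
Proof. by move=> NM; rewrite (big_ord_widen _ F NM) big_mkcond. Qed.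

(** * Vectors of Fock space as classes of functions, and the operators induced on them *)

Section fock_classes.
Variable R : realType.
Local Notation C := R[i].
Local Notation T := (measurableTypeR R).
Local Notation lam := (tuple_measure (lebRp R)).
Local Notation mu := (fock_measure R).
Local Notation fock := (fock R).
Implicit Types (h g : fseq R -> C) (x y : fock).

(* Locked, as the unifier would otherwise unfold the quotient. *)
Definition fock_class : (fseq R -> C) -> fock :=
  locked (fun h => \pi_fock (insubd (0 : prefock R) h))%qT.

Definition fock_fun : fock -> fseq R -> C := locked (fun x => repr x).

Lemma fock_funE x : fock_fun x = repr x.
Proof. by rewrite /fock_fun -lock. Qed.

Local Notation Fp h := (is_true ((h : seq T -> C) \in @prefock_pred R)).

Lemma fock_fun_pred x : Fp (fock_fun x).
Proof. by rewrite fock_funE; case: (repr x). Qed.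

Lemma fock_fun_L2 x : L2fun mu (fock_fun x).
Proof. by rewrite fock_funE; exact: fock_L2fun. Qed.

Lemma prefock_L2 h : Fp h -> L2fun mu h.
Proof. by move=> /prefock_predP[]. Qed.

Lemma fock_class_fun x : fock_class (fock_fun x) = x.
Proof.
rewrite /fock_class -lock (_ : insubd _ _ = repr x) ?reprK//.
by apply: val_inj; rewrite insubdK ?fock_funE// -fock_funE; exact: fock_fun_pred.
Qed.

Lemma ae_fock_class h : Fp h -> \forall s \ae mu, fock_fun (fock_class h) s = h s.
Proof.
move=> Fh; apply: filterS (ae_repr_pi (insubd (0 : prefock R) h)) => s.
by rewrite fock_funE /fock_class -lock => ->; rewrite [X in X s](insubdK (0 : prefock R) Fh).
Qed.

Lemma fock_funP x y : x = y <-> \forall s \ae mu, fock_fun x s = fock_fun y s.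
Proof. by rewrite !fock_funE; exact: fock_eqP. Qed.

Lemma ae_fock_funZD (a : C) x y : \forall s \ae mu,
  fock_fun (a *: x + y) s = a * fock_fun x s + fock_fun y s.
Proof. by rewrite !fock_funE; exact: ae_reprZD. Qed.

Lemma ae_fock_fun0 : \forall s \ae mu, fock_fun 0 s = 0.
Proof. by rewrite !fock_funE; exact: ae_repr0. Qed.

Lemma fock_class_eq h g : Fp h -> Fp g -> (\forall s \ae mu, h s = g s) ->
  fock_class h = fock_class g.
Proof.
move=> Fh Fg hg; apply/fock_funP.
by apply: filterS3 hg (ae_fock_class Fh) (ae_fock_class Fg) => s e -> ->.
Qed.

Lemma fock_class_eq0 h : Fp h -> (\forall s \ae mu, h s = 0) -> fock_class h = 0.
Proof.
by move=> Fh h0; apply/fock_funP; apply: filterS3 h0 (ae_fock_class Fh) ae_fock_fun0 => s h0 -> ->.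
Qed.

Lemma prefock_ZD (a : C) h g : Fp h -> Fp g -> Fp (fun s => a * h s + g s).
Proof.
move=> Fh Fg; have [_ H] := prefock_submod_closed R.
exact: (H a _ _ Fh Fg).
Qed.

Lemma fock_classZD (a : C) h g : Fp h -> Fp g ->
  fock_class (fun s => a * h s + g s) = a *: fock_class h + fock_class g.
Proof.
move=> Fh Fg; apply/fock_funP; have H := ae_fock_class (prefock_ZD a Fh Fg).
apply: filterS3 (filterI (ae_fock_class Fh) (ae_fock_class Fg)) H
  (ae_fock_funZD a (fock_class h) (fock_class g)).
by move=> s [eh eg] -> ->; rewrite eh eg.
Qed.

Lemma hdotE x y : hdot x y = ldot mu (fock_fun x) (fock_fun y).
Proof. by rewrite !fock_funE -fock_dot_hdot; exact: fock_dotE. Qed.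

Lemma ae_eq_ldot h g h' g' : L2fun mu h -> L2fun mu g -> L2fun mu h' -> L2fun mu g' ->
  (\forall s \ae mu, h s = h' s) -> (\forall s \ae mu, g s = g' s) -> ldot mu h g = ldot mu h' g'.
Proof.
move=> [mh _] [mg _] [mh' _] [mg' _] hh gg; apply: ae_eq_cintegral.
- exact: cmeasurableM (cmeasurable_conj mh) mg.
- exact: cmeasurableM (cmeasurable_conj mh') mg'.
by apply: filterS2 hh gg => s -> ->.
Qed.

Lemma hdot_class h g : Fp h -> Fp g -> hdot (fock_class h) (fock_class g) = ldot mu h g.
Proof.
move=> Fh Fg; rewrite hdotE; apply: ae_eq_ldot; try exact: ae_fock_class;
  by [exact: fock_fun_L2|exact: prefock_L2].
Qed.

Lemma hn2E x : hn2 x = fine (L2norm2 mu (fock_fun x)).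
Proof. by rewrite hn2_hdot hdotE ldotxx//; exact: fock_fun_L2. Qed.

Lemma hn2_class h : Fp h -> hn2 (fock_class h) = fine (L2norm2 mu h).
Proof. by move=> Fh; rewrite hn2_hdot hdot_class// ldotxx//; exact: prefock_L2. Qed.

Lemma bounded_opP (u : op R) : bounded_op u <->
  linear u /\ exists M : R, 0 <= M /\ forall x, hn2 (u x) <= M * hn2 x.
Proof.
split=> -[lu [M]].
  move=> uM; split => //; exists (M ^+ 2); split; first exact: sqr_ge0.
  move=> x; have := uM x; rewrite !fock_norm_hnorm -!sqr_hnorm -exprMn => h.
  by rewrite lerXn2r ?nnegrE ?hnorm_ge0//; exact: le_trans (hnorm_ge0 _) h.
move=> [M0 uM]; split => //; exists (Num.sqrt M) => x.
by rewrite !fock_norm_hnorm !hnormE -sqrtrM// ler_wsqrtr.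
Qed.

Lemma bounded_op_linear (u : op R) (a : C) x y : bounded_op u ->
  u (a *: x + y) = a *: u x + u y.
Proof. by move=> [lu _]; exact: lu. Qed.

Lemma bounded_opB (u : op R) x y : bounded_op u -> u (x - y) = u x - u y.
Proof.
by move=> bu; rewrite addrC -scaleN1r (bounded_op_linear _ _ _ bu) scaleN1r addrC.
Qed.

Lemma bounded_op0 : bounded_op (0 : op R).
Proof.
apply/bounded_opP; split; first by move=> a x y; rewrite scaler0 addr0.
by exists 0; split => // x; rewrite mul0r [_ x]/(0 : fock) hn20.
Qed.

Lemma bounded_opZD (a : C) (u v : op R) : bounded_op u -> bounded_op v ->
  bounded_op (a *: u + v).
Proof.
move=> /bounded_opP[lu [M [M0 uM]]] /bounded_opP[lv [N [N0 vN]]].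
have E x : (a *: u + v) x = a *: u x + v x by [].
apply/bounded_opP; split.
  move=> b x y; rewrite !E lu lv !scalerDr !scalerA [b * a]mulrC.
  by rewrite addrACA.
exists (2 * abs2 a * M + 2 * N); split; first by rewrite addr_ge0 ?mulr_ge0 ?abs2_ge0.
move=> x; rewrite [X in hn2 X]E (le_trans (hn2D_le _ _))//.
rewrite hn2Z [X in _ <= X]mulrDl; apply: lerD.
  by rewrite -!mulrA ler_wpM2l// ler_wpM2l ?abs2_ge0.
by rewrite -mulrA ler_wpM2l.
Qed.

Lemma bounded_opM (u v : op R) : bounded_op u -> bounded_op v -> bounded_op (u \o v).
Proof.
move=> /bounded_opP[lu [M [M0 uM]]] /bounded_opP[lv [N [N0 vN]]].
apply/bounded_opP; split; first by move=> a x y /=; rewrite lv lu.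
exists (M * N); split; first exact: mulr_ge0.
by move=> x /=; apply: le_trans (uM _) _; rewrite -mulrA ler_wpM2l.
Qed.

Lemma bounded_op_id : bounded_op (idfun : op R).
Proof. by apply/bounded_opP; split => //; exists 1; split => // x; rewrite mul1r. Qed.

(** A choice of representatives enters here; it becomes immaterial once [Phi] respects almost
    everywhere equality. Cutoffs and creation operators are obtained in this way. *)
Definition class_op (Phi : (fseq R -> C) -> fseq R -> C) : op R :=
  fun x => fock_class (Phi (fock_fun x)).

Section class_op.
Variable Phi : (fseq R -> C) -> fseq R -> C.
Hypothesis PhiF : forall h, Fp h -> Fp (Phi h).
Hypothesis PhiZD : forall (a : C) h g s, Phi (fun s => a * h s + g s) s = a * Phi h s + Phi g s.
Hypothesis Phi_ae : forall h g, (\forall s \ae mu, h s = g s) -> \forall s \ae mu, Phi h s = Phi g s.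

Lemma class_opE h : Fp h -> class_op Phi (fock_class h) = fock_class (Phi h).
Proof.
move=> Fh; apply: fock_class_eq; [|exact: PhiF|exact/Phi_ae/ae_fock_class].
exact/PhiF/fock_fun_pred.
Qed.

Lemma class_op_bounded (M : R) : 0 <= M ->
  (forall h, Fp h -> (L2norm2 mu (Phi h) <= M%:E * L2norm2 mu h)%E) -> bounded_op (class_op Phi).
Proof.
move=> M0 PhiM; have Fx x := fock_fun_pred x.
apply/bounded_opP; split.
  move=> a x y; rewrite -[x]fock_class_fun -[y]fock_class_fun -fock_classZD// !class_opE//.
    rewrite -fock_classZD//; try exact: PhiF.
    congr fock_class; apply/funext => s; exact: PhiZD.
  exact: prefock_ZD.
exists M; split => // x; have := PhiM _ (Fx x).
rewrite hn2_class ?hn2E//; last exact: PhiF.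
rewrite -lee_fin EFinM !fineK//; first exact/L2norm2_fin/fock_fun_L2.
exact/L2norm2_fin/prefock_L2/PhiF.
Qed.

End class_op.

Definition chaos_fun n (f : n.-tuple T -> C) : fseq R -> C := fun s => oapp f 0 (insub (s : seq T)).

Lemma chaosE n (f : n.-tuple T -> C) : chaos f = fock_class (chaos_fun f).
Proof. by rewrite /fock_class -lock. Qed.

Lemma chaos_fun_tuple n (f : n.-tuple T -> C) (t : n.-tuple T) : chaos_fun f (of_tuple t) = f t.
Proof. by rewrite /chaos_fun /of_tuple valK. Qed.

Lemma chaos_fun_neq n k (f : n.-tuple T -> C) (t : k.-tuple T) : k != n ->
  chaos_fun f (of_tuple t) = 0.
Proof. by move=> kn; rewrite /chaos_fun /of_tuple insubF//= size_tuple (negbTE kn). Qed.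

Lemma chaos_fun_pred n (f : n.-tuple T -> C) : Lambda (lebRp R) f -> Fp (chaos_fun f).
Proof.
move=> [[mf foo] af].
have E k : k = n \/ k != n by have [->|] := eqVneq k n; [left|right].
have mh : cmeasurable (chaos_fun f).
  apply/cmeasurable_fseqP => k; have [->|kn] := E k.
    by rewrite (_ : _ \o _ = f)//; apply/funext => t; exact: chaos_fun_tuple.
  rewrite (_ : _ \o _ = fun=> 0); first exact: cmeasurable_cst.
  by apply/funext => t; exact: chaos_fun_neq.
apply/prefock_predP; split.
  move=> k s; have [kE|kn] := E k.
    subst k; apply: filterS (af s) => t ft.
    by rewrite /chaos_comp -!/(of_tuple _) !chaos_fun_tuple.
  apply: nearW => t; rewrite /chaos_comp -!/(of_tuple _) !chaos_fun_neq ?mulr0//.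
split => //; rewrite L2norm2_fock// /prefock_norm2 (@nneseriesD1 _ _ n xpredT)//; last first.
  by move=> k _; rewrite mule_ge0// L2norm2_ge0.
rewrite eseries0 ?adde0; last first.
  move=> k _ /andP[_ kn]; have -> : @chaos_comp R (chaos_fun f) k = (fun=> 0 : C).
    by apply/funext => t; exact: chaos_fun_neq.
  by rewrite L2norm20 mule0.
have -> : @chaos_comp R (chaos_fun f) n = f by apply/funext => t; exact: chaos_fun_tuple.
by rewrite lte_mul_pinfty.
Qed.

Lemma chaosZD n (a : C) (f g : n.-tuple T -> C) : Lambda (lebRp R) f -> Lambda (lebRp R) g ->
  chaos (fun t => a * f t + g t) = a *: chaos f + chaos g.
Proof.
move=> Lf Lg; rewrite !chaosE -fock_classZD; try exact: chaos_fun_pred.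
congr fock_class; apply/funext => s; rewrite /chaos_fun; case: insubP => //= _.
by rewrite mulr0 addr0.
Qed.

Lemma LambdaZD n (a : C) (f g : n.-tuple T -> C) : Lambda (lebRp R) f -> Lambda (lebRp R) g ->
  Lambda (lebRp R) (fun t => a * f t + g t).
Proof.
move=> [Lf af] [Lg ag]; split; first exact: L2funZD.
move=> s; apply: filterS2 (af s) (ag s) => t -> ->.
by rewrite mulrDr !mulrA; congr (_ * _ + _); rewrite mulrC.
Qed.

Lemma Lambda0 n : Lambda (lebRp R) (fun _ : n.-tuple T => 0).
Proof. by split; [exact: L2fun0|move=> s; apply: nearW => t; rewrite mulr0]. Qed.

Lemma chaos_eq n (f g : n.-tuple T -> C) : Lambda (lebRp R) f -> Lambda (lebRp R) g ->
  (\forall t \ae lam n, f t = g t) -> chaos f = chaos g.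
Proof.
move=> Lf Lg fg; rewrite !chaosE; apply: fock_class_eq; try exact: chaos_fun_pred.
apply/ae_fockP => k; have [kE|kn] := eqVneq k n.
  by subst k; apply: filterS fg => t e; rewrite !chaos_fun_tuple.
by apply: nearW => t; rewrite !chaos_fun_neq.
Qed.

Lemma chaos0 n : chaos (fun _ : n.-tuple T => 0 : C) = 0.
Proof.
rewrite chaosE; apply: fock_class_eq0; first exact/chaos_fun_pred/Lambda0.
by apply: nearW => s; rewrite /chaos_fun; case: insubP.
Qed.

Lemma hdot_chaos n (f : n.-tuple T -> C) x : Lambda (lebRp R) f ->
  hdot (chaos f) x = n`!%:R * ldot (lam n) f (fun t => fock_fun x (of_tuple t)).
Proof.
move=> Lf; have Ff := chaos_fun_pred Lf; have Lx := fock_fun_L2 x.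
rewrite chaosE hdotE (@ae_eq_ldot _ _ (chaos_fun f) (fock_fun x))//; last 4 first.
- exact: fock_fun_L2.
- exact: prefock_L2.
- exact: ae_fock_class.
- exact: nearW.
rewrite /ldot cintegral_fock; last exact: L2fun_prod (prefock_L2 Ff) Lx.
have SE N : (n < N)%N -> \sum_(k < N) k`!%:R * cintegral (lam k) (fun t =>
    conjc (chaos_fun f (of_tuple t)) * fock_fun x (of_tuple t)) =
    n`!%:R * cintegral (lam n) (fun t => conjc (f t) * fock_fun x (of_tuple t)).
  move=> nN; rewrite (bigD1 (Ordinal nN))//= big1 ?addr0.
    by congr (_ * cintegral _ _); apply/funext => t; rewrite chaos_fun_tuple.
  move=> k kn; rewrite (_ : (fun t => _) = fun=> 0) ?cintegral0 ?mulr0//.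
  apply/funext => t; rewrite chaos_fun_neq ?conjc0 ?mul0r//.
apply: complex_ext => /=; apply: lim_near_cst => //; exists n.+1 => // N /= nN; by rewrite SE.
Qed.

Lemma Lambda_fock_fun x n : Lambda (lebRp R) (fun t : n.-tuple T => fock_fun x (of_tuple t)).
Proof. by rewrite fock_funE; exact: fock_comp_Lambda. Qed.

Lemma hdot_chaos2 n (f g : n.-tuple T -> C) : Lambda (lebRp R) f -> Lambda (lebRp R) g ->
  hdot (chaos f) (chaos g) = n`!%:R * ldot (lam n) f g.
Proof.
move=> Lf Lg; rewrite hdot_chaos//; congr (_ * _).
have [[[mf _] _] [[mg _] _]] := (Lf, Lg).
have [[mG _] _] := Lambda_fock_fun (chaos g) n.
apply: ae_eq_cintegral.
- exact: cmeasurableM (cmeasurable_conj mf) mG.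
- exact: cmeasurableM (cmeasurable_conj mf) mg.
have /ae_fockP/(_ n) := ae_fock_class (chaos_fun_pred Lg).
by apply: filterS => t; rewrite -chaosE => ->; rewrite chaos_fun_tuple.
Qed.

(** Testing against the level-n component of [x] itself gives n! times its squared norm. *)
Lemma ae_slices0 x : (forall n (f : n.-tuple T -> C), Lambda (lebRp R) f -> hdot (chaos f) x = 0) ->
  x = 0.
Proof.
move=> x0; apply/fock_funP; apply: filterS2 _ ae_fock_fun0 => [s xs e|]; first by rewrite e; exact: xs.
apply/ae_fockP => n; have Lx := Lambda_fock_fun x n; have := x0 n _ Lx.
rewrite hdot_chaos// => /eqP; rewrite mulf_eq0 pnatr_eq0 gtn_eqF ?fact_gt0//=.
have [Lx2 _] := Lx; have [mx _] := Lx2.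
rewrite ldotxx// => /eqP/(congr1 (@complex.Re R))/= n0; apply: L2norm2_eq0 => //.
by rewrite -[LHS]fineK ?n0// L2norm2_fin.
Qed.

Definition finite_chaos : set fock := [set x | exists N (v : forall n, n.-tuple T -> C),
  (forall n, Lambda (lebRp R) (v n)) /\ x = \sum_(n < N) chaos (v n)].

Lemma finite_chaos1 n (f : n.-tuple T -> C) : Lambda (lebRp R) f -> finite_chaos (chaos f).
Proof.
move=> Lf; exists n.+1.
pose v k : k.-tuple T -> C := fun t => chaos_fun f (of_tuple t).
have vn : v n = f by apply/funext => t; exact: chaos_fun_tuple.
have v0 k : k != n -> v k = fun=> 0 by move=> kn; apply/funext => t; exact: chaos_fun_neq.
exists v; split.
  by move=> k; have [->|kn] := eqVneq k n; [rewrite vn|rewrite v0//; exact: Lambda0].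
rewrite big_ord_recr/= vn big1 ?add0r// => k _.
by rewrite v0 ?chaos0// neq_ltn ltn_ord.
Qed.

Lemma finite_chaos_widen N M (v : forall n, n.-tuple T -> C) : (N <= M)%N ->
  \sum_(n < N) chaos (v n) =
  \sum_(n < M) chaos (fun t : n.-tuple T => if (n < N)%N then v n t else 0).
Proof.
move=> NM; rewrite (sum_ord_widen (fun n => chaos (v n)) NM).
apply: eq_bigr => n _; case: ifP => nN //.
by rewrite chaos0.
Qed.

Lemma subspace_finite_chaos : @lin_subspace R fock finite_chaos.
Proof.
split.
  by exists 0%N, (fun _ _ => 0); split; [move=> n; exact: Lambda0|rewrite big_ord0].
move=> a _ _ [N [v [Lv ->]]] [M [w [Lw ->]]].
have L K (u : forall n, n.-tuple T -> C) : (forall n, Lambda (lebRp R) (u n)) ->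
    forall n, Lambda (lebRp R) (fun t : n.-tuple T => if (n < K)%N then u n t else 0).
  by move=> Lu n; case: (n < K)%N; [exact: Lu|exact: Lambda0].
rewrite (finite_chaos_widen v (leq_maxl N M)) (finite_chaos_widen w (leq_maxr N M)).
exists (maxn N M), (fun n t => a * (if (n < N)%N then v n t else 0) + (if (n < M)%N then w n t else 0)).
split=> [n|]; first exact: LambdaZD (L _ _ Lv n) (L _ _ Lw n).
rewrite scaler_sumr -big_split/=; apply: eq_bigr => n _.
by rewrite -chaosZD; [|exact: L|exact: L].
Qed.

Lemma finite_chaos_dense x : @hclosure R fock finite_chaos x.
Proof.
apply: (@dense_of_ortho R fock); first exact: subspace_finite_chaos.
move=> y y0; apply: ae_slices0 => n f Lf.
exact: y0 (finite_chaos1 Lf).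
Qed.

(** Finite chaos expansions are dense and the difference of two bounded operators is continuous.
    This uniqueness determines [creation], which is specified only on vectors of a single level. *)
Lemma bounded_op_ext (u v : op R) : bounded_op u -> bounded_op v ->
  (forall n (f : n.-tuple T -> C), Lambda (lebRp R) f -> u (chaos f) = v (chaos f)) -> u = v.
Proof.
move=> bu bv uv; apply/funext => x.
have bw := bounded_opZD (-1) bu bv.
have /bounded_opP[lw [M [M0 wM]]] := bw; set w : op R := -1 *: u + v in lw wM.
have wE y : w y = v y - u y by rewrite addrC -scaleN1r.
have w0 y : finite_chaos y -> w y = 0.
  move=> [N [f [Lf ->]]].
  have ws : w (\sum_(n < N) chaos (f n)) = \sum_(n < N) w (chaos (f n)).
    have w00 : w 0 = 0.
      by apply: hn2_eq0; apply/eqP; rewrite eq_le hn2_ge0 andbT -[X in _ <= X](mulr0 M) -(hn20 fock).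
    have wD y1 y2 : w (y1 + y2) = w y1 + w y2 by have := lw 1 y1 y2; rewrite !scale1r.
    by elim/big_rec2 : _ => // i y1 y2 _ <-.
  by rewrite ws big1// => n _; rewrite wE uv// subrr.
suff : w x = 0 by rewrite wE => /eqP; rewrite subr_eq0 => /eqP.
apply: hnorm_eq0; apply: eps_eq0 => [e e0|]; last exact: hnorm_ge0.
have c0 : 0 < Num.sqrt M + 1 by rewrite ltr_wpDl ?sqrtr_ge0.
have [y [/w0 y0 yx]] := finite_chaos_dense x (divr_gt0 e0 c0).
have wyx : w (y - x) = - w x 
  by have h := lw (-1) x y; rewrite [y - x]addrC -[- x]scaleN1r h y0 scaleN1r; exact: addr0.
have -> : hnorm (w x) = hnorm (w (y - x)) by rewrite wyx; exact: esym (@hnorm_opp R fock (w x)).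
rewrite hnormE; apply: le_trans (ler_wsqrtr (wM _)) _.
rewrite sqrtrM// -hnormE; apply: le_trans (_ : (Num.sqrt M + 1) * hnorm (y - x) <= _).
  by rewrite ler_wpM2r ?hnorm_ge0// lerDl.
by move: (ltW yx); rewrite ler_pdivlMr// mulrC.
Qed.

End fock_classes.

(** * Cutoffs and creation operators *)

Section fock_operators.
Variable R : realType.
Local Notation C := R[i].
Local Notation T := (measurableTypeR R).
Local Notation lam := (tuple_measure (lebRp R)).
Local Notation mu := (fock_measure R).
Local Notation fock := (fock R).
Implicit Types (h g : fseq R -> C) (x y : fock) (t : R).
Local Notation Fp h := (is_true ((h : seq T -> C) \in @prefock_pred R)).

Definition upto t (s : fseq R) : bool := all (fun r : R => r <= t) s.

Lemma upto_tuple n t (u : n.-tuple T) : upto t (of_tuple u) <-> below t u.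
Proof.
rewrite /upto /of_tuple; split=> [/allP h i|h]; first by apply: h; exact: mem_tnth.
by apply/allP => r /tnthP[i ->]; exact: h.
Qed.

Lemma measurable_upto t : measurable [set s | upto t s].
Proof.
change (measurable_fseq [set s | upto t s]) => n.
rewrite (_ : level _ = below t); first exact: measurable_below.
by apply/seteqP; split => u; rewrite /level /= -/(of_tuple u) upto_tuple.
Qed.

Lemma upto_perm n t (s : 'S_n) (u : n.-tuple T) :
  upto t (of_tuple (tperm_tuple s u)) = upto t (of_tuple u).
Proof.
apply/idP/idP => /upto_tuple h; apply/upto_tuple => i; last by rewrite tnth_mktuple.
by have := h ((s^-1)%g i); rewrite tnth_mktuple permKV.
Qed.

Definition cut_fun t h : fseq R -> C := fun s => (upto t s)%:R * h s.

Lemma cmeasurable_cut t h : cmeasurable h -> cmeasurable (cut_fun t h).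
Proof.
move=> mh; apply: cmeasurableM => //.
have := cmeasurable_ind R (measurable_upto t); congr cmeasurable; apply/funext => s.
by congr ((nat_of_bool _)%:R); apply/idP/idP; rewrite inE.
Qed.

Lemma abs2_cut t h s : abs2 (cut_fun t h s) <= abs2 (h s).
Proof. by rewrite /cut_fun; case: (upto t s); rewrite ?mul1r// mul0r abs20 abs2_ge0. Qed.

Lemma prefock_cut t h : Fp h -> Fp (cut_fun t h).
Proof.
move=> /prefock_predP[ah Lh]; have [mh _] := Lh; apply/prefock_predP; split.
  move=> n s; apply: filterS (ah n s) => u; rewrite /chaos_comp /cut_fun.
  by rewrite -!/(of_tuple _) upto_perm => ->; rewrite mulrCA.
by apply: (L2fun_le Lh); [exact: cmeasurable_cut|exact: abs2_cut].
Qed.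

Definition cutoff t : op R := class_op (cut_fun t).

Lemma cut_funZD t (a : C) h g s : cut_fun t (fun s => a * h s + g s) s = a * cut_fun t h s + cut_fun t g s.
Proof. by rewrite /cut_fun mulrDr mulrCA. Qed.

Lemma ae_cut_fun t h g : (\forall s \ae mu, h s = g s) -> \forall s \ae mu, cut_fun t h s = cut_fun t g s.
Proof. by apply: filterS => s; rewrite /cut_fun => ->. Qed.

Lemma cutoff_class t h : Fp h -> cutoff t (fock_class h) = fock_class (cut_fun t h).
Proof. by apply: class_opE; [exact: prefock_cut|exact: ae_cut_fun]. Qed.

Lemma L2norm2_cut t h : cmeasurable h -> (L2norm2 mu (cut_fun t h) <= L2norm2 mu h)%E.
Proof.
move=> mh; apply: ge0_le_integral => //.
- by move=> s _; rewrite lee_fin abs2_ge0.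
- exact/measurable_abs2/cmeasurable_cut.
- exact: measurable_abs2.
- by move=> s _; rewrite lee_fin abs2_cut.
Qed.

Lemma cutoff_bounded t : bounded_op (cutoff t).
Proof.
apply: (class_op_bounded (@prefock_cut t) (@cut_funZD t) (@ae_cut_fun t) ler01) => h Fh.
by rewrite mul1e L2norm2_cut//; have [] := prefock_L2 Fh.
Qed.

Lemma ae_cutoff t x : \forall s \ae mu, fock_fun (cutoff t x) s = (upto t s)%:R * fock_fun x s.
Proof. exact/ae_fock_class/prefock_cut/fock_fun_pred. Qed.

Lemma cutoffZD t (a : C) x y : cutoff t (a *: x + y) = a *: cutoff t x + cutoff t y.
Proof. exact: bounded_op_linear (cutoff_bounded t). Qed.

Lemma cutoff0 t : cutoff t 0 = 0.
Proof.
apply/fock_funP; apply: filterS2 (ae_cutoff t 0) (ae_fock_fun0 R) => s -> ->.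
by rewrite mulr0.
Qed.

Lemma hn2_cutoff t x : hn2 (cutoff t x) <= hn2 x.
Proof.
have Fx := fock_fun_pred x; have [mx _] := prefock_L2 Fx.
rewrite /cutoff hn2_class ?hn2E; last exact: prefock_cut.
rewrite fine_le ?L2norm2_cut//; first exact/L2norm2_fin/prefock_L2/prefock_cut.
exact/L2norm2_fin/fock_fun_L2.
Qed.

Lemma hnorm_cutoff t x : hnorm (cutoff t x) <= hnorm x.
Proof. by rewrite !hnormE ler_wsqrtr// hn2_cutoff. Qed.

Lemma hdot_cutoff t x y : hdot (cutoff t x) y = hdot x (cutoff t y).
Proof.
have [mx _] := fock_fun_L2 x; have [my _] := fock_fun_L2 y.
have [mcx _] := fock_fun_L2 (cutoff t x); have [mcy _] := fock_fun_L2 (cutoff t y).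
rewrite !hdotE; apply: ae_eq_cintegral.
- exact: cmeasurableM (cmeasurable_conj mcx) my.
- exact: cmeasurableM (cmeasurable_conj mx) mcy.
apply: filterS2 (ae_cutoff t x) (ae_cutoff t y) => s -> ->.
by rewrite conjcM conjc_nat mulrCA mulrA.
Qed.

Lemma cutoff_comp t t' x : cutoff t (cutoff t' x) = cutoff (Num.min t t') x.
Proof.
apply/fock_funP.
apply: filterS3 (ae_cutoff t (cutoff t' x)) (ae_cutoff t' x) (ae_cutoff (Num.min t t') x) => s -> -> ->.
rewrite mulrA -natrM mulnb; congr ((nat_of_bool _)%:R * _).
by rewrite /upto -all_predI; apply: eq_all => r /=; rewrite le_min.
Qed.

Definition upto_space t : set fock := [set x | cutoff t x = x].

Lemma upto_spaceP t x : upto_space t x <-> \forall s \ae mu, ~~ upto t s -> fock_fun x s = 0.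
Proof.
split=> [/fock_funP xx|x0].
  apply: filterS2 xx (ae_cutoff t x) => s <- -> /negbTE ->.
  by rewrite mul0r.
apply/fock_funP; apply: filterS2 x0 (ae_cutoff t x) => s x0 ->.
by have [//|us] := boolP (upto t s); [rewrite mul1r|rewrite x0// mulr0].
Qed.

Lemma upto_space_cutoff t x : upto_space t (cutoff t x).
Proof. by rewrite /upto_space/= cutoff_comp minxx. Qed.

Lemma upto_space_le t t' x : t <= t' -> upto_space t x -> upto_space t' x.
Proof.
move=> tt' xt; rewrite /upto_space/= -[X in cutoff t' X]xt cutoff_comp.
by rewrite min_r.
Qed.

Lemma lin_subspace_upto_space t : @lin_subspace R fock (upto_space t).
Proof.
split; first exact: cutoff0.
by move=> a x y xt yt; rewrite /upto_space/= cutoffZD xt yt.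
Qed.

Lemma hclosure_upto_space t x : @hclosure R fock (upto_space t) x -> upto_space t x.
Proof.
apply: hclosure_fixed; first by move=> y z; exact: bounded_opB (cutoff_bounded t).
exact: hnorm_cutoff.
Qed.

Lemma cutoff_chaos t n (f : n.-tuple T -> C) : Lambda (lebRp R) f ->
  cutoff t (chaos f) = chaos (fun u : n.-tuple T => (upto t (of_tuple u))%:R * f u).
Proof.
move=> Lf; rewrite !chaosE cutoff_class; last exact: chaos_fun_pred.
congr fock_class; apply/funext => s; rewrite /cut_fun /chaos_fun.
by case: insubP => [u _ <-|_]/=; [|rewrite mulr0].
Qed.

Lemma Lambda_cut t n (f : n.-tuple T -> C) : Lambda (lebRp R) f ->
  Lambda (lebRp R) (fun u : n.-tuple T => (upto t (of_tuple u))%:R * f u).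
Proof.
move=> [Lf af]; have [mf _] := Lf; split.
  apply: (L2fun_le Lf).
    apply: cmeasurableM => //.
    have := cmeasurable_ind R (@measurable_below R n t); congr cmeasurable; apply/funext => u.
    congr ((nat_of_bool _)%:R); apply/idP/idP; first by rewrite inE => /upto_tuple.
    by move=> /upto_tuple; rewrite inE.
  by move=> u; case: (upto t _); rewrite ?mul1r// mul0r abs20 abs2_ge0.
move=> s; apply: filterS (af s) => u ->.
by rewrite upto_perm mulrCA.
Qed.

(* Dominated convergence. *)
Lemma cutoff_cvg (t_ : nat -> R) t x : (forall k, t <= t_ k) ->
  (forall r, t < r -> \forall k \near \oo, t_ k < r) ->
  hnorm (cutoff (t_ k) x - cutoff t x) @[k --> \oo] --> 0.
Proof.
move=> tt_ tlim; have [mx xoo] := fock_fun_L2 x.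
pose d k s : C := ((upto (t_ k) s)%:R - (upto t s)%:R) * fock_fun x s.
have md k : cmeasurable (d k).
  rewrite (_ : d k = fun s => cut_fun (t_ k) (fock_fun x) s - cut_fun t (fock_fun x) s).
    by apply: cmeasurableB; exact: cmeasurable_cut.
  by apply/funext => s; rewrite /d mulrBl.
have dE k : hn2 (cutoff (t_ k) x - cutoff t x) = fine (L2norm2 mu (d k)).
  rewrite hn2E; congr fine; apply: ae_eq_L2norm2.
  have := ae_fock_funZD (-1) (cutoff t x) (cutoff (t_ k) x).
  rewrite scaleN1r [- _ + _]addrC.
  apply: filterS3 (ae_cutoff t x) (ae_cutoff (t_ k) x) => s e1 e2 ->.
  by rewrite e1 e2 /d mulrBl mulN1r addrC.
have dx k s : abs2 (d k s) <= abs2 (fock_fun x s).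
  rewrite /d; case: (upto _ _); case: (upto _ _);
    by rewrite ?subrr ?subr0 ?sub0r ?mulN1r ?abs2N ?mul1r ?mul0r ?abs20 ?abs2_ge0.
have d0 : L2norm2 mu (d k) @[k --> \oo] --> 0%E.
  have := @dominated_cvg _ _ _ mu setT measurableT (fun k s => (abs2 (d k s))%:E) (cst 0%E) (fun s => (abs2 (fock_fun x s))%:E).
  rewrite integral_cst//= mul0e; apply.
  - by move=> k; exact: measurable_abs2.
  (* At a given finite sequence the difference is eventually 0: either all entries are at most [t],
     hence at most every [t_ k], or one entry exceeds [t] and eventually also [t_ k]. Approaching
     [t] from above is essential here. *)
  - move=> s _; apply/EFin_cvg0; apply: cvg_near_cst.
    have [ut|/allPn[r rs rt]] := boolP (upto t s).
      apply: nearW => k; rewrite /d ut (_ : upto (t_ k) s) ?subrr ?mul0r ?abs20//.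
      by apply: sub_all ut => r /= rt; exact: le_trans rt (tt_ k).
    move: rt; rewrite -ltNge => tr; near=> k.
    have tk : t_ k < r by near: k; exact: tlim.
    have ut : upto t s = false by apply/negbTE/allPn; exists r => //; rewrite -ltNge.
    have utk : upto (t_ k) s = false by apply/negbTE/allPn; exists r => //; rewrite -ltNge.
    by rewrite /d ut utk subrr mul0r abs20.
  - by [].
  - exact: L2fun_integrable (fock_fun_L2 x).
  - by move=> k s _; rewrite ger0_norm ?lee_fin ?abs2_ge0.
have /fine_cvgP[_ fd] := d0.
have := cvg_comp _ _ fd (@sqrt_continuous R 0); rewrite sqrtr0.
apply: cvg_trans; apply: near_eq_cvg; apply: nearW => k /=.
by rewrite hnormE dE.
Unshelve. all: by end_near. Qed.

(** The empty sequence gets 0, created vectors having no vacuum component. On a sequence of length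
    n+1 the tensor product is antisymmetrized as a function of n+1 variables before being
    evaluated. *)
Definition creation_fun (z : T -> C) h : fseq R -> C := fun s =>
  match (s : seq T) with
  | [::] => 0
  | x :: s' => antisymmetrize (tensor z (@chaos_comp R h (size s'))) (in_tuple (x :: s'))
  end.

Lemma creation_funE (z : T -> C) h n (u : n.+1.-tuple T) : creation_fun z h (of_tuple u) =
  antisymmetrize (tensor z (fun t : n.-tuple T => h (of_tuple t))) u.
Proof.
case: u => [[|x s'] us]; first by [].
have e : n = size s' by move: us => /eqP[].
by subst n; rewrite /creation_fun /=; congr antisymmetrize; exact: val_inj.
Qed.

Lemma creation_fun0 (z : T -> C) h (u : 0.-tuple T) : creation_fun z h (of_tuple u) = 0.
Proof. by case: u => -[]. Qed.

Section creation.
Variable z : T -> C.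
Hypothesis Lz : L2fun (lebRp R) z.

Lemma Lambda_creation h n : Fp h -> Lambda (lebRp R)
  (antisymmetrize (tensor z (fun t : n.-tuple T => h (of_tuple t)))).
Proof.
move=> Fh; apply: Lambda_antisymmetrize; apply: L2fun_tensor => //.
by have /asboolP[/(_ n)[]] := Fh.
Qed.

(** Level n of [h] feeds level n+1 of the result, and [creation_bound] multiplied by n! compares the
    weighted norms of these two levels. The shift of the index is made on partial sums, where the
    term of level 0 vanishes. *)
Lemma L2norm2_creation h : Fp h -> (L2norm2 mu (creation_fun z h) <=
  (fine (L2norm2 (lebRp R) z))%:E * L2norm2 mu h)%E.
Proof.
move=> Fh; have [mh hoo] := prefock_L2 Fh; have Lh n := (asboolW Fh).1 n.
have m1 : cmeasurable (creation_fun z h).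
  apply/cmeasurable_fseqP => -[|n].
    rewrite (_ : _ \o _ = fun=> 0); first exact: cmeasurable_cst.
    by apply/funext => u; exact: creation_fun0.
  rewrite (_ : _ \o _ = antisymmetrize (tensor z (fun t : n.-tuple T => h (of_tuple t)))).
    by have [[]] := Lambda_creation n Fh.
  by apply/funext => u; exact: creation_funE.
rewrite !L2norm2_fock//; set c := fine _.
have c0 : 0 <= c by rewrite fine_ge0// L2norm2_ge0.
pose b n := ((n`!%:R)%:E * L2norm2 (lam n) (@chaos_comp R h n))%E.
have b0 n : (0 <= b n)%E by rewrite mule_ge0// L2norm2_ge0.
apply: lime_le.
  by apply: is_cvg_nneseries => n _ _; rewrite mule_ge0// L2norm2_ge0.
apply: nearW => -[|N]; first by rewrite big_geq//; apply: mule_ge0 => //; apply: nneseries_ge0 => n _ _; exact: b0.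
rewrite big_nat_recl//= (_ : @chaos_comp R (creation_fun z h) 0 = fun=> 0); last first.
  by apply/funext => u; exact: creation_fun0.
rewrite L2norm20 mule0 add0e.
apply: (@le_trans _ _ (\sum_(0 <= n < N) c%:E * b n)%E).
  apply: lee_sum => n _.
  rewrite (_ : @chaos_comp R _ n.+1 = antisymmetrize (tensor z (fun t : n.-tuple T => h (of_tuple t)))); last first.
    by apply/funext => u; exact: creation_funE.
  have [LA _] := Lambda_creation n Fh; have [Lhn _] := Lh n.
  rewrite /b -(fineK (L2norm2_fin LA)) -(fineK (L2norm2_fin Lhn)) -!EFinM lee_fin.
  rewrite factS natrM [X in X * _]mulrC -mulrA [X in _ <= X]mulrCA.
  by apply: ler_wpM2l => //; exact: (creation_bound Lz (Lh n)).
rewrite -ge0_sume_distrr// lee_wpmul2l ?lee_fin//.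
by apply: nneseries_lim_ge => n _ _; exact: b0.
Qed.

Lemma prefock_creation h : Fp h -> Fp (creation_fun z h).
Proof.
move=> Fh; apply/prefock_predP; split.
  move=> [|n] s.
    by apply: nearW => u; rewrite /chaos_comp -!/(of_tuple _) !creation_fun0 mulr0.
  have [_ /(_ s)] := Lambda_creation n Fh; apply: filterS => u e.
  by rewrite /chaos_comp -!/(of_tuple _) !creation_funE.
split.
  apply/cmeasurable_fseqP => -[|n].
    rewrite (_ : _ \o _ = fun=> 0); first exact: cmeasurable_cst.
    by apply/funext => u; exact: creation_fun0.
  rewrite (_ : _ \o _ = antisymmetrize (tensor z (fun t : n.-tuple T => h (of_tuple t)))).
    by have [[]] := Lambda_creation n Fh.
  by apply/funext => u; exact: creation_funE.
apply: le_lt_trans (L2norm2_creation Fh) _.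
have Lh := prefock_L2 Fh.
by rewrite -(fineK (L2norm2_fin Lh)) -EFinM ltry.
Qed.

Lemma tensorZD n (a : C) (f g : n.-tuple T -> C) :
  tensor z (fun t : n.-tuple T => a * f t + g t) =
  (fun u : n.+1.-tuple T => a * tensor z f u + tensor z g u).
Proof. by apply/funext => u; rewrite /tensor mulrDr mulrCA. Qed.

Lemma creation_funZD (a : C) h g s :
  creation_fun z (fun s => a * h s + g s) s = a * creation_fun z h s + creation_fun z g s.
Proof.
case: s => [|x s]; first by rewrite /= mulr0 addr0.
by rewrite -antisymmetrizeZD -tensorZD.
Qed.

Lemma ae_creation_fun h g : (\forall s \ae mu, h s = g s) ->
  \forall s \ae mu, creation_fun z h s = creation_fun z g s.
Proof.
move=> /ae_fockP hg; apply/ae_fockP => -[|n].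
  by apply: nearW => u; rewrite !creation_fun0.
have : \forall u \ae lam n.+1, tensor z (fun t : n.-tuple T => h (of_tuple t)) u =
    tensor z (fun t : n.-tuple T => g (of_tuple t)) u.
  by apply: filterS (ae_tbehead (hg n)) => u e; rewrite !tensorE e.
by move=> /ae_eq_antisymmetrize; apply: filterS => u; rewrite !creation_funE.
Qed.

Definition creation_op : op R := class_op (creation_fun z).

Lemma creation_op_bounded : bounded_op creation_op.
Proof.
apply: (class_op_bounded prefock_creation creation_funZD ae_creation_fun _ L2norm2_creation).
by rewrite fine_ge0// L2norm2_ge0.
Qed.

Lemma creation_op_chaos n (f : n.-tuple T -> C) : Lambda (lebRp R) f ->
  creation_op (chaos f) = chaos (antisymmetrize (tensor z f)).
Proof.
move=> Lf; have Ff := chaos_fun_pred Lf.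
rewrite !chaosE /creation_op (class_opE prefock_creation ae_creation_fun Ff).
congr fock_class; apply/funext => s; rewrite -[s]/(of_tuple (in_tuple s)).
move: (in_tuple s); case: (size s) => [|k] u.
  by rewrite creation_fun0 chaos_fun_neq.
rewrite creation_funE; have [kn|kn] := eqVneq k n.
  subst k; rewrite chaos_fun_tuple; congr (antisymmetrize (tensor z _) u).
  by apply/funext => t; rewrite chaos_fun_tuple.
rewrite chaos_fun_neq ?eqSS// /antisymmetrize big1 ?mulr0// => r _.
by rewrite tensorE chaos_fun_neq ?mulr0.
Qed.

Lemma creation_opE : creation z = creation_op.
Proof.
rewrite /creation; case: xgetP => [u _ [bu uE]|/(_ creation_op) []]; last first.
  by split; [exact: creation_op_bounded|exact: creation_op_chaos].
apply: (bounded_op_ext bu creation_op_bounded) => n f Lf.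
by rewrite uE// creation_op_chaos.
Qed.

End creation.

Lemma creation_chaos (z : T -> C) n (f : n.-tuple T -> C) : L2fun (lebRp R) z ->
  Lambda (lebRp R) f -> creation z (chaos f) = chaos (antisymmetrize (tensor z f)).
Proof. by move=> Lz Lf; rewrite creation_opE// creation_op_chaos. Qed.

(** No condition on [z]: if no operator satisfies the specification, the default is the zero
    operator, which is bounded too. *)
Lemma creation_bounded (z : T -> C) : bounded_op (creation z).
Proof.
by rewrite /creation; case: xgetP => [u _ []//|_]; exact: bounded_op0.
Qed.

End fock_operators.

(** * The Clifford algebra *)

Section lebRp.
Variable R : realType.
Local Notation T := (measurableTypeR R).

Lemma lebRpE (A : set T) : lebRp R A = lebesgue_measure (A `&` `[0, +oo[%classic).
Proof. by []. Qed.

Lemma lebRp_atomless (x : R) : lebRp R [set x] = 0%E.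
Proof.
apply/eqP; rewrite eq_le measure_ge0 andbT lebRpE -(lebesgue_measure_set1 x).
by apply: le_measure; rewrite ?inE//; exact: measurableI.
Qed.

Lemma lebRp_neg : lebRp R `]-oo, 0]%classic = 0%E.
Proof.
rewrite lebRpE -(lebesgue_measure_set1 (0 : R)); congr lebesgue_measure.
apply/seteqP; split => x /=; rewrite !in_itv/= ?andbT.
  by move=> [x0 x1]; apply/eqP; rewrite eq_le x0.
by move=> ->.
Qed.

Lemma lebRp_fin (a : R) : (lebRp R `]-oo, a]%classic < +oo)%E.
Proof.
rewrite lebRpE; apply: (@le_lt_trans _ _ (lebesgue_measure `[0, a]%classic)).
  apply: le_measure; rewrite ?inE//; first exact: measurableI.
  by move=> x /=; rewrite !in_itv/= andbT => -[-> ->].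
by rewrite lebesgue_measure_itv/=; case: ifP; rewrite ?ltry.
Qed.

End lebRp.

(** * Adjoints, commutants and generated von Neumann algebras *)

Section operator_algebras.
Variable R : realType.
Local Notation C := R[i].
Local Notation T := (measurableTypeR R).
Local Notation fock := (fock R).
Implicit Types (u v w : op R) (x y : fock) (S M : set (op R)).

Lemma hdot_eq (x y : fock) : (forall w : fock, hdot x w = hdot y w) -> x = y.
Proof.
move=> xy; apply/eqP; rewrite -subr_eq0; apply/eqP; apply: hdot_eq0.
by rewrite hdotBl xy subrr.
Qed.

(** Riesz representation of the functionals y |-> <x, u y>; the representing vector is determined by
    its inner products, which makes it linear in x. *)
Lemma adjoint_exists u : bounded_op u -> exists v, bounded_op v /\
  forall x y, hdot (v x) y = hdot x (u y).
Proof.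
move=> bu; have /bounded_opP[lu [M [M0 uM]]] := bu.
have /choice[v vE] : forall x : fock, exists w : fock, forall y, hdot x (u y) = hdot w y.
  move=> x; apply: (@riesz R fock _ (hn2 x * M)) => [a y z|y].
    by rewrite (bounded_op_linear _ _ _ bu) hdotZD.
  rewrite -mulrA; apply: le_trans (cauchy_schwarz _ _) _.
  by apply: ler_wpM2l (uM y); exact: hn2_ge0.
exists v; split; last by move=> x y; exact: esym (vE x y).
apply/bounded_opP; split.
  move=> a x y; apply: hdot_eq => w; rewrite hdotDl hdotZl -!vE.
  by rewrite hdotDl hdotZl.
exists M; split => // x.
(* For the bound, |v x|^4 = |<x, u (v x)>|^2 <= |x|^2 M |v x|^2, where |v x|^2 is cancelled; hence
   the separate case of a zero value. *)
have [v0|v0] := eqVneq (hn2 (v x)) 0; first by rewrite v0 mulr_ge0// hn2_ge0.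
have vp : 0 < hn2 (v x) by rewrite lt0r v0 hn2_ge0.
have := cauchy_schwarz x (u (v x)); rewrite vE hdotxx abs2_real => h.
rewrite -(ler_pM2l vp) -expr2; apply: le_trans h _.
have := ler_wpM2l (hn2_ge0 x) (uM (v x)).
by move: (hn2 x) (hn2 (v x)) => p q; rewrite (_ : p * (M * q) = q * (M * p))//; ring.
Qed.

(* Locked, as the unifier would otherwise compare unfolded inner products. *)
Definition adj : op R -> op R := locked (@adjoint R).

Lemma adjE u : adjoint u = adj u.
Proof. by rewrite /adj -lock. Qed.

Lemma adj_bounded u : bounded_op (adj u).
Proof. by rewrite -adjE /adjoint; case: xgetP => [v _ []//|_]; exact: bounded_op0. Qed.

Lemma hdot_adj u x y : bounded_op u -> hdot (adj u x) y = hdot x (u y).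
Proof.
move=> bu; rewrite -adjE /adjoint; case: xgetP => [v _ [bv vE]|].
  by rewrite -!fock_dot_hdot vE.
have [v [bv vE]] := adjoint_exists bu.
have vE' x' y' : fock_dot (v x') y' = fock_dot x' (u y') by rewrite !fock_dot_hdot vE.
by move=> /(_ v) h; case: h; exact: conj bv vE'.
Qed.

Lemma hdot_adjr u x y : bounded_op u -> hdot (u x) y = hdot x (adj u y).
Proof. by move=> bu; rewrite hdotC -(hdot_adj y x bu) -hdotC. Qed.

Lemma adj_uniq u v : bounded_op u -> (forall x y, hdot (v x) y = hdot x (u y)) ->
  v = adj u.
Proof.
by move=> bu vE; apply/funext => x; apply: hdot_eq => w; rewrite vE hdot_adj.
Qed.

Lemma adj_id : adj (idfun : op R) = idfun.
Proof. by apply/esym/adj_uniq => //; exact: bounded_op_id. Qed.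

Lemma commutant_bounded S : commutant S `<=` (@bounded_op R).
Proof. by move=> u []. Qed.

Lemma commutantS S S' : S `<=` S' -> commutant S' `<=` commutant S.
Proof. by move=> SS u [bu uS]; split => // v /SS/uS. Qed.

Lemma commutant2 S : S `<=` (@bounded_op R) -> S `<=` commutant (commutant S).
Proof. by move=> Sb u Su; split; [exact: Sb|move=> v [_ vS]; rewrite vS]. Qed.

Lemma commutant3 S : S `<=` (@bounded_op R) -> commutant (commutant (commutant S)) = commutant S.
Proof.
move=> Sb; apply/seteqP; split; first exact/commutantS/commutant2.
by apply: commutant2; exact: commutant_bounded.
Qed.

Lemma commutant_adjoint S : S `<=` (@bounded_op R) -> (forall u, S u -> S (adj u)) ->
  forall u, commutant S u -> commutant S (adj u).
Proof.
move=> Sb Sa u [bu uS]; split; first exact: adj_bounded.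
move=> v Sv; have bv := Sb v Sv.
have uv y : u (adj v y) = adj v (u y) := congr1 (@^~ y) (uS _ (Sa v Sv)).
apply/funext => x /=; apply: hdot_eq => y.
by rewrite hdot_adj// hdot_adjr// [RHS]hdot_adjr// hdot_adj// uv.
Qed.

(** Elements of a generated algebra are controlled only through von Neumann algebras containing the
    generators. Commutants supply them: that of the identity gives boundedness, that of a cutoff
    gives adaptedness. *)
Lemma von_neumann_commutant S : S `<=` (@bounded_op R) -> (forall u, S u -> S (adj u)) ->
  von_neumann_algebra (commutant S).
Proof.
move=> Sb Sa; split; [exact: commutant_bounded|move=> u; rewrite adjE; exact: commutant_adjoint|exact: commutant3].
Qed.

Lemma commutant_id S : S `<=` (@bounded_op R) -> commutant S idfun.
Proof. by move=> _; split => //; exact: bounded_op_id. Qed.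

Lemma commutantM S u v : commutant S u -> commutant S v -> commutant S (u \o v).
Proof.
move=> [bu uS] [bv vS]; split; first exact: bounded_opM.
move=> w Sw; apply/funext => x /=.
by have /(congr1 (@^~ x))/= := vS w Sw => ->; have /(congr1 (@^~ (v x)))/= := uS w Sw.
Qed.

Lemma commutantZD S (a : C) u v : S `<=` (@bounded_op R) ->
  commutant S u -> commutant S v -> commutant S (a *: u + v).
Proof.
move=> Sb [bu uS] [bv vS]; split; first exact: bounded_opZD.
move=> w Sw; apply/funext => x /=.
have E y : (a *: u + v) y = a *: u y + v y by [].
rewrite !E (bounded_op_linear _ _ _ (Sb w Sw)).
by have /(congr1 (@^~ x))/= -> := vS w Sw; have /(congr1 (@^~ x))/= -> := uS w Sw.
Qed.

Lemma vN_generated_sub S M : von_neumann_algebra M -> S `<=` M -> vN_generated S `<=` M.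
Proof. by move=> vM SM u; apply. Qed.

Lemma sub_vN_generated S : S `<=` vN_generated S.
Proof. by move=> u Su M [_]; apply. Qed.

Lemma vN_generatedS S S' : S `<=` S' -> vN_generated S `<=` vN_generated S'.
Proof. by move=> SS u uS M [vM SM]; apply: uS; split => //; exact: subset_trans SM. Qed.

Lemma vN_generated_id S : vN_generated S idfun.
Proof. by move=> M [[_ _ <-] _]; exact/commutant_id/commutant_bounded. Qed.

Lemma vN_generatedM S u v : vN_generated S u -> vN_generated S v -> vN_generated S (u \o v).
Proof.
move=> uS vS M MP; have [[_ _ ME] _] := MP; rewrite -ME.
by apply: commutantM; rewrite ME; [exact: uS|exact: vS].
Qed.

Lemma vN_generatedZD S (a : C) u v : vN_generated S u -> vN_generated S v ->
  vN_generated S (a *: u + v).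
Proof.
move=> uS vS M MP; have [[_ _ ME] _] := MP; rewrite -ME.
by apply: commutantZD; [exact: commutant_bounded|rewrite ME; exact: uS|rewrite ME; exact: vS].
Qed.

Lemma vN_generated_adj S u : vN_generated S u -> vN_generated S (adj u).
Proof. by rewrite -adjE; move=> uS M MP; have [[_ Ma _] _] := MP; exact: Ma (uS M MP). Qed.

Lemma von_neumann_bounded : von_neumann_algebra (@bounded_op R).
Proof.
have E : commutant [set (idfun : op R)] = @bounded_op R.
  by apply/seteqP; split => u; [exact: commutant_bounded|move=> bu; split => // v ->].
rewrite -E; apply: von_neumann_commutant => u /= ->; first exact: bounded_op_id.
exact: adj_id.
Qed.

Lemma Psi_bounded (z : T -> C) : bounded_op (Psi z).
Proof.
rewrite /Psi -[creation z]scale1r; apply: bounded_opZD; first exact: creation_bounded.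
by rewrite /annihilation adjE; exact: adj_bounded.
Qed.

Lemma clifford_bounded : @clifford R `<=` @bounded_op R.
Proof.
apply: vN_generated_sub; first exact: von_neumann_bounded.
by move=> _ [z _ <-]; exact: Psi_bounded.
Qed.

Lemma clifford_upto_clifford t : @clifford_upto R t `<=` @clifford R.
Proof. by apply: vN_generatedS => _ [z [Lz _] <-]; exists z. Qed.

End operator_algebras.

Lemma zmod_cancel (V : zmodType) (a c d e e' : V) : c = a + d -> e = e' -> c + e - (a + e') = d.
Proof. by move=> -> ->; rewrite opprD addrACA subrr addr0 addrAC subrr add0r. Qed.

Section clifford_vacuum.
Variable R : realType.
Local Notation C := R[i].
Local Notation T := (measurableTypeR R).
Local Notation lam := (tuple_measure (lebRp R)).
Local Notation mu := (fock_measure R).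
Local Notation fock := (fock R).
Implicit Types (x y : fock) (t : R).

Lemma adj_cutoff t : adj (cutoff t) = cutoff t.
Proof.
apply/esym/adj_uniq; first exact: cutoff_bounded.
by move=> x y; exact: hdot_cutoff.
Qed.

Lemma von_neumann_cutoff t : von_neumann_algebra (commutant [set cutoff t]).
Proof.
apply: von_neumann_commutant => u /= ->; first exact: cutoff_bounded.
exact: adj_cutoff.
Qed.

Lemma upto_tcons n t (u : n.+1.-tuple T) : upto t (of_tuple u) =
  ((thead u : R) <= t) && upto t (of_tuple (tbehead u)).
Proof. by rewrite -{1}(tcons_eta u). Qed.

Lemma cutoff_creation (z : T -> C) t x : L2fun (lebRp R) z ->
  (\forall s \ae lebRp R, t < (s : R) -> z s = 0) ->
  cutoff t (creation z x) = creation z (cutoff t x).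
Proof.
move=> Lz z0; rewrite -[LHS]/((cutoff t \o creation z) x) -[RHS]/((creation z \o cutoff t) x).
congr (_ x); apply: bounded_op_ext.
- exact: bounded_opM (cutoff_bounded t) (creation_bounded z).
- exact: bounded_opM (creation_bounded z) (cutoff_bounded t).
move=> n f Lf /=; have [Lf2 _] := Lf; have Lc := Lambda_cut t Lf.
have LA := Lambda_antisymmetrize (L2fun_tensor Lz Lf2).
rewrite [LHS](etrans (congr1 (cutoff t) (creation_chaos Lz Lf)) (cutoff_chaos t LA)).
rewrite [RHS](etrans (congr1 (creation z) (cutoff_chaos t Lf)) (creation_chaos Lz Lc)).
apply: chaos_eq; first exact: Lambda_cut.
  by have [Lc2 _] := Lc; exact: Lambda_antisymmetrize (L2fun_tensor Lz Lc2).
have H : \forall u \ae lam n.+1, (upto t (of_tuple u))%:R * tensor z f u =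
    tensor z (fun u : n.-tuple T => (upto t (of_tuple u))%:R * f u) u.
  apply: filterS (ae_thead n z0) => u zu; rewrite !tensorE upto_tcons -mulnb natrM.
  have [ut|ut] := leP (thead u : R) t; first by rewrite mul1r mulrCA.
  by rewrite zu// !mul0r.
apply: filterS (ae_eq_antisymmetrize H) => u <-.
rewrite /antisymmetrize mulrCA mulr_sumr; congr (_ * _); apply: eq_bigr => s _.
by rewrite upto_perm mulrCA.
Qed.

Lemma Psi_commutant (z : T -> C) t : L2fun (lebRp R) z ->
  (\forall s \ae lebRp R, t < (s : R) -> z s = 0) -> commutant [set cutoff t] (Psi z).
Proof.
move=> Lz z0; have cb : [set cutoff t] `<=` @bounded_op R by move=> _ ->; exact: cutoff_bounded.
have H w : L2fun (lebRp R) w -> (\forall s \ae lebRp R, t < (s : R) -> w s = 0) ->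
    commutant [set cutoff t] (creation w).
  move=> Lw w0; split; first exact: creation_bounded.
  by move=> _ ->; apply/funext => x /=; rewrite cutoff_creation.
rewrite /Psi -[creation z]scale1r; apply: commutantZD => //; first exact: H.
rewrite /annihilation adjE; apply: commutant_adjoint => //.
  by move=> _ ->; exact: adj_cutoff.
apply: H.
  have [mz zoo] := Lz; split; first exact: cmeasurable_conj.
  by rewrite (eq_L2norm2 _ (fun s => abs2_conj (z s))).
by apply: (@filterS _ _ (ae_filter_ringOfSetsType (lebRp R)) _ _ _ z0) => s zs /zs ->; rewrite conjc0.
Qed.

(** The commutant of the self-adjoint [cutoff t] is a von Neumann algebra and contains Psi z for
    every z vanishing after t, hence all of C_t. Since the vacuum is fixed by the cutoff, so is its
    image under C_t. *)
Lemma clifford_upto_cutoff t (u : op R) x : clifford_upto t u -> u (cutoff t x) = cutoff t (u x).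
Proof.
move=> uC; have [_ /(_ (cutoff t) erefl)] : commutant [set cutoff t] u.
  apply: (vN_generated_sub (von_neumann_cutoff t) _ uC).
  by move=> _ [z [Lz z0] <-]; exact: Psi_commutant.
by move=> /(congr1 (@^~ x)).
Qed.

Lemma Lambda_cst (c : C) : Lambda (lebRp R) (fun _ : 0.-tuple T => c).
Proof.
split; first split.
- exact: cmeasurable_cst.
- by rewrite /L2norm2/= integral_dirac//= diracT mul1e ltry.
- move=> s; apply: nearW => u; rewrite (_ : s = 1%g) ?odd_perm1 ?mul1r//.
  by apply/permP => -[].
Qed.

Lemma vacuum_upto t : upto_space t (vacuum R).
Proof.
rewrite /upto_space/= cutoff_chaos; last exact: Lambda_cst.
by rewrite /vacuum; congr chaos; apply/funext => u; rewrite tuple0 mul1r.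
Qed.

Lemma clifford_upto_vacuum t u : clifford_upto t u -> upto_space t (u (vacuum R)).
Proof. by move=> uC; rewrite /upto_space/= -clifford_upto_cutoff// vacuum_upto. Qed.

(** On a tuple with all entries up to [t], each term of the antisymmetrized tensor product evaluates
    [z] at one of these entries, hence vanishes. Dually, annihilating a [z] that lives after [t]
    kills the vectors living up to [t]. *)
Lemma hdot_creation_above (z : T -> C) t x y : L2fun (lebRp R) z ->
  (forall s : R, s <= t -> z s = 0) -> upto_space t x -> hdot x (creation z y) = 0.
Proof.
move=> Lz z0 /upto_spaceP xt; rewrite hdotE -(cintegral0 mu); apply: ae_eq_cintegral.
- have [mx _] := fock_fun_L2 x; have [my _] := fock_fun_L2 (creation z y).
  exact: cmeasurableM (cmeasurable_conj mx) my.
- exact: cmeasurable_cst.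
have H := ae_fock_class (prefock_creation Lz (fock_fun_pred y)).
have {H} : \forall s \ae mu, fock_fun (creation z y) s = creation_fun z (fock_fun y) s.
  by rewrite (creation_opE Lz).
apply: filterS2 xt => s xs ->; have [st|/xs ->] := boolP (upto t s); last by rewrite conjc0 mul0r.
rewrite [X in _ * X](_ : _ = 0) ?mulr0//.
rewrite -[s]/(of_tuple (in_tuple s)) in st *; move: (in_tuple s) st.
case: (size s) => [|n] u ut; first by rewrite creation_fun0.
rewrite creation_funE /antisymmetrize big1 ?mulr0// => r _.
rewrite tensorE z0 ?mul0r ?mulr0//.
by rewrite -(upto_perm t r) upto_tcons in ut; case/andP: ut.
Qed.

Lemma L2fun_itv a b : L2fun (lebRp R) (itv_ind a b).
Proof. exact/L2fun_itv_ind/lebRp_fin. Qed.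

Lemma itv_ind_below a b (s : R) : s <= a -> itv_ind a b s = 0 :> C.
Proof. by move=> sa; rewrite /itv_ind ltNge sa. Qed.

Lemma conj_itv_ind (a b : R) : (fun s : T => conjc (itv_ind a b s)) = itv_ind a b.
Proof. by apply/funext => s; rewrite /itv_ind conjc_nat. Qed.

Lemma PsiE (z : T -> C) x :
  Psi z x = creation z x + adj (creation (fun s => conjc (z s))) x.
Proof. by rewrite -adjE. Qed.

Lemma Psi_itv a b x : upto_space a x -> Psi (itv_ind a b) x = creation (itv_ind a b) x.
Proof.
move=> xa; rewrite PsiE conj_itv_ind.
rewrite [X in _ + X](_ : _ = 0) ?addr0//; apply: hdot_eq => w.
rewrite hdot_adj; last exact: creation_bounded.
rewrite hdot0l; apply: hdot_creation_above xa; first exact: L2fun_itv.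
by move=> s; exact: itv_ind_below.
Qed.

Definition cyclic_space t : set fock := [set u (vacuum R) | u in @clifford_upto R t].

Lemma lin_subspace_cyclic t : @lin_subspace R fock (cyclic_space t).
Proof.
split.
  exists (-1 *: idfun + idfun : op R); last by rewrite scaleN1r addNr.
  by apply: vN_generatedZD; exact: vN_generated_id.
move=> a _ _ [u uC <-] [v vC <-]; exists (a *: u + v : op R) => //.
exact: vN_generatedZD.
Qed.

Lemma cyclic_space_op t (u : op R) x : clifford_upto t u ->
  @hclosure R fock (cyclic_space t) x -> @hclosure R fock (cyclic_space t) (u x).
Proof.
move=> uC xC e e0; have bu := clifford_bounded (clifford_upto_clifford uC).
have /bounded_opP[_ [M [M0 uM]]] := bu.
have c0 : 0 < Num.sqrt M + 1 by rewrite ltr_wpDl ?sqrtr_ge0.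
have [_ [[v vC <-] vx]] := xC _ (divr_gt0 e0 c0).
exists (u (v (vacuum R))); split; first by exists (u \o v : op R) => //; exact: vN_generatedM.
rewrite -(bounded_opB _ _ bu) hnormE.
apply: le_lt_trans (ler_wsqrtr (uM _)) _; rewrite sqrtrM// -hnormE.
move: vx; rewrite ltr_pdivlMr// mulrC; apply: le_lt_trans.
by apply: ler_wpM2r; [exact: hnorm_ge0|rewrite lerDl].
Qed.

(** Induction on the level. The residue [x] of the projection onto the cyclic space is orthogonal to
    Psi(1_]a,b]) h for h of level n living up to a, a vector that the induction hypothesis puts in
    the closure. By [headmax_total] level n+1 of [x] vanishes on tuples below [t], so [x] is
    orthogonal to [chaos f] as well as to the projection, and is 0. *)
Lemma chaos_cyclic t n (f : n.-tuple T -> C) : 0 <= t -> Lambda (lebRp R) f ->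
  upto_space t (chaos f) -> @hclosure R fock (cyclic_space t) (chaos f).
Proof.
move=> t0; elim: n f => [|n ih] f Lf ft.
  (* On level 0 the vector is a multiple of the vacuum; the second summand is the zero operator,
     written so that stability under linear combinations applies. *)
  apply: sub_hclosure; exists (f [tuple] *: idfun + (-1 *: idfun + idfun) : op R).
    by apply: vN_generatedZD; [exact: vN_generated_id|apply: vN_generatedZD; exact: vN_generated_id].
  rewrite scaleN1r addNr addr0 -[LHS]/(f [tuple] *: vacuum R).
  rewrite -[LHS]addr0 -[X in _ + X](chaos0 R 0) /vacuum -chaosZD; last 2 first.
  - exact: Lambda_cst.
  - exact: Lambda_cst.
  congr chaos; apply/funext => u; rewrite mulr1 addr0; congr f.
  exact/esym/tuple0.
have [p [pC pO]] := orthogonal_projection (chaos f) (lin_subspace_cyclic t).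
set x := chaos f - p in pO; pose g (u : n.+1.-tuple T) := fock_fun x (of_tuple u).
have Lg : Lambda (lebRp R) g := Lambda_fock_fun x n.+1.
have xC y : @hclosure R fock (cyclic_space t) y -> hdot x y = 0.
  by apply: hclosure_ortho => z zC; rewrite hdotC pO// conjc0.
have g0 : \forall u \ae lam n.+1, below t u -> g u = 0.
  apply: (headmax_total (@lebRp_atomless R) (@lebRp_neg R) (@lebRp_fin R) Lg).
  move=> a b a0 ab bt h Lh ha.
  have ha' : upto_space a (chaos h).
    rewrite /upto_space/= (cutoff_chaos a Lh); congr chaos; apply/funext => u.
    have [->|/ha/upto_tuple ->] := eqVneq (h u) 0; first by rewrite mulr0.
    by rewrite mul1r.
  have LA := Lambda_antisymmetrize (L2fun_tensor (L2fun_itv a b) Lh.1).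
  have : hdot (chaos (antisymmetrize (tensor (itv_ind a b) h))) x = 0.
    rewrite hdotC xC ?conjc0// -(creation_chaos (L2fun_itv a b) Lh) -Psi_itv//.
    apply: cyclic_space_op; last first.
      exact: ih h Lh (upto_space_le (le_trans ab bt) ha').
    apply: sub_vN_generated; exists (itv_ind a b) => //; split; first exact: L2fun_itv.
    apply: nearW => s ts; rewrite /itv_ind [_ <= b]leNgt (le_lt_trans bt ts) andbF//.
  rewrite hdot_chaos// => /eqP; rewrite mulf_eq0 pnatr_eq0 gtn_eqF ?fact_gt0//=.
  by move=> /eqP.
have fx : hdot (chaos f) x = 0.
  rewrite hdot_chaos// -/g (_ : ldot _ _ _ = 0) ?mulr0// -(cintegral0 (lam n.+1)).
  apply: ae_eq_cintegral.
  - by have [[[mf _] _] [[mg _] _]] := (Lf, Lg); exact: cmeasurableM (cmeasurable_conj mf) mg.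
  - exact: cmeasurable_cst.
  have /upto_spaceP/ae_fockP/(_ n.+1) := ft.
  have /ae_fockP/(_ n.+1) := ae_fock_class (chaos_fun_pred Lf).
  apply: filterS3 g0 => u gu; rewrite -chaosE chaos_fun_tuple => -> fu.
  have [/upto_tuple/gu ->|/fu ->] := boolP (upto t (of_tuple u)); first by rewrite mulr0.
  by rewrite conjc0 mul0r.
suff -> : chaos f = p by [].
apply/eqP; rewrite -subr_eq0; apply/eqP; apply: hdot_eq0.
by rewrite -/x {1}/x hdotBl fx hdotC xC// conjc0 subr0.
Qed.

Lemma upto_space_cyclic t : 0 <= t -> upto_space t `<=` @hclosure R fock (cyclic_space t).
Proof.
move=> t0 x xt e e0; have [y [[N [v [Lv yE]]] yx]] := finite_chaos_dense x (divr_gt0 e0 (ltr0n R 2)).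
have : @hclosure R fock (cyclic_space t) (cutoff t y).
  rewrite yE (_ : cutoff t _ = \sum_(n < N) cutoff t (chaos (v n))); last first.
    elim/big_rec2 : _ => [|i y1 y2 _ <-]; first exact: cutoff0.
    by have := cutoffZD t 1 (chaos (v i)) y2; rewrite !scale1r.
  apply: lin_subspace_sum => [|n _]; first exact/lin_subspace_hclosure/lin_subspace_cyclic.
  rewrite cutoff_chaos//; apply: chaos_cyclic => //; first exact: Lambda_cut.
  by rewrite -cutoff_chaos//; exact: upto_space_cutoff.
move=> /(_ _ (divr_gt0 e0 (ltr0n R 2)))[w [wC wy]]; exists w; split => //.
apply: le_lt_trans (hdistD (cutoff t y) _ _) _; rewrite [X in _ < X]splitr ltrD//.
rewrite -[X in _ - X]xt -(bounded_opB _ _ (cutoff_bounded t)).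
exact: le_lt_trans (hnorm_cutoff _ _) yx.
Qed.

Definition vacuum_orbit : set fock := [set u (vacuum R) | u in @clifford R].

(** A vector orthogonal to the orbit is orthogonal to the cyclic space of each integer time, so all
    its cutoffs at integers vanish; every finite sequence lies below some integer. *)
Lemma vacuum_orbit_dense x : @hclosure R fock vacuum_orbit x.
Proof.
apply: dense_of_ortho.
  split.
    exists (-1 *: idfun + idfun : op R); last by rewrite scaleN1r addNr.
    by apply: vN_generatedZD; exact: vN_generated_id.
  move=> a _ _ [u uC <-] [v vC <-]; exists (a *: u + v : op R) => //.
  exact: vN_generatedZD.
move=> y yO; have yk (k : nat) : cutoff k%:R y = 0.
  apply: hdot_eq0; rewrite hdot_cutoff cutoff_comp minxx.
  apply: (@hclosure_ortho R fock (cyclic_space k%:R)).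
    by move=> _ [u uC <-]; rewrite hdotC yO ?conjc0//; exists u => //; exact: clifford_upto_clifford uC.
  exact/upto_space_cyclic/upto_space_cutoff.
apply/fock_funP.
have H : \forall s \ae mu, forall k : nat, (upto k%:R s)%:R * fock_fun y s = 0.
  apply: ae_foralln => k; apply: filterS2 (ae_cutoff k%:R y) (ae_fock_fun0 R) => s <-.
  by rewrite yk.
apply: filterS2 H (ae_fock_fun0 R) => s ys ->.
have [k sk] : exists k : nat, upto k%:R s.
  pose m : R := \sum_(r <- s) `|r : R|.
  exists (Num.truncn m).+1; apply/allP => r rs.
  apply: le_trans (ltW (truncnS_gt _)); rewrite /m (big_rem r rs)/=.
  by apply: le_trans (ler_norm _) _; rewrite lerDl sumr_ge0.
by have := ys k; rewrite sk mul1r.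
Qed.

Lemma cmeasurable_indc (t : R) : L2fun (lebRp R) (fun s => ((\1_`[0, t] s)%:C)%C).
Proof.
have -> : (fun s => ((\1_`[0, t] s)%:C)%C) = (fun s => (s \in `[0, t]%classic)%:R : C).
  by apply/funext => s; rewrite indicE rmorph_nat.
apply: L2fun_ind; first exact: measurable_itv.
apply: le_lt_trans (lebRp_fin t); apply: le_measure; rewrite ?inE; try exact: measurable_itv.
by move=> s /=; rewrite !in_itv/= => /andP[].
Qed.

Lemma creationD (z z1 z2 : T -> C) x : L2fun (lebRp R) z1 -> L2fun (lebRp R) z2 ->
  z = (fun s => z1 s + z2 s) -> creation z x = creation z1 x + creation z2 x.
Proof.
move=> L1 L2 ->; rewrite -[creation z1 x]scale1r.
rewrite -[RHS]/((1 *: creation z1 + creation z2 : op R) x); congr (_ x).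
apply: bounded_op_ext.
- exact: creation_bounded.
- exact: bounded_opZD (creation_bounded _) (creation_bounded _).
move=> n f Lf; rewrite -[RHS]/(1 *: creation z1 (chaos f) + creation z2 (chaos f)).
rewrite !creation_chaos//; last exact: L2funD.
rewrite -chaosZD; try by apply/Lambda_antisymmetrize/L2fun_tensor => //; exact: Lf.1.
congr chaos; apply/funext => u; rewrite -antisymmetrizeZD; congr antisymmetrize.
by apply/funext => v; rewrite /tensor mul1r mulrDl.
Qed.

Lemma adj_eq (u v : op R) x : bounded_op u -> bounded_op v ->
  (forall w, hdot x (u w) = hdot x (v w)) -> adj u x = adj v x.
Proof. by move=> bu bv uv; apply: hdot_eq => w; rewrite !hdot_adj. Qed.

(** The two annihilation parts agree on [x], since they differ by the annihilation of 1_]a,b], which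
    kills vectors living up to [a]; only the difference of the creation parts remains. *)
Lemma Psi_upto_incr (a b : R) x : 0 <= a -> a <= b -> upto_space a x ->
  (Psi_upto b - Psi_upto a) x = creation (itv_ind a b) x.
Proof.
move=> a0 ab xa; have zE : (fun s => ((\1_`[0, b] s)%:C)%C) =
    (fun s => ((\1_`[0, a] s)%:C)%C + itv_ind a b s).
  apply/funext => s; rewrite !indicE !mem_setE !in_itv/= /itv_ind !rmorph_nat -natrD.
  congr (_%:R); have [s0|s0] := leP 0 s => /=; last by rewrite ltNge (le_trans (ltW s0) a0).
  by have [sa|sa] := leP s a; [rewrite (le_trans sa ab)|].
have cE y : creation (fun s => ((\1_`[0, b] s)%:C)%C) y =
    creation (fun s => ((\1_`[0, a] s)%:C)%C) y + creation (itv_ind a b) y.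
  by apply: creationD zE; [exact: cmeasurable_indc|exact: L2fun_itv].
have conjE t : (fun s => conjc ((\1_`[0, t] s)%:C)%C) = (fun s => ((\1_`[0, t] s)%:C)%C) :> (T -> C).
  by apply/funext => s; rewrite conjc_real.
have -> : (Psi_upto b - Psi_upto a) x = Psi_upto b x - Psi_upto a x by [].
rewrite /Psi_upto !PsiE !conjE.
set ca := creation _ in cE *; set cb := creation _ in cE *; set ci := creation _ in cE *.
have adjE' : adj ca x = adj cb x.
  apply: adj_eq => [||w]; [exact: creation_bounded|exact: creation_bounded|].
  rewrite cE hdotDr [X in _ + X](_ : _ = 0) ?addr0//.
  apply: hdot_creation_above xa; first exact: L2fun_itv.
  by move=> s; exact: itv_ind_below.
exact: zmod_cancel (cE x) adjE'.
Qed.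

End clifford_vacuum.

(** * Transfer to the Fock space *)

Section continuous_extension.
Variables (R : realType) (H K : hilbertType R).
Local Notation C := R[i].
Variables (G : set (H * K)) (M : R).
Hypothesis M0 : 0 <= M.
Hypothesis GZD : forall (a : C) p q, G p -> G q -> G (a *: p.1 + q.1, a *: p.2 + q.2).
Hypothesis GM : forall p, G p -> hnorm p.2 <= M * hnorm p.1.
Hypothesis Gdense : forall x (e : R), 0 < e -> exists p, G p /\ hnorm (p.1 - x) < e.

Definition near_graph (x : H) (y : K) : Prop := forall e : R, 0 < e ->
  exists p, [/\ G p, hnorm (p.1 - x) < e & hnorm (p.2 - y) < e].

Lemma near_graphM x y x' y' : near_graph x y -> near_graph x' y' ->
  hnorm (y - y') <= M * hnorm (x - x').
Proof.
move=> xy xy'; apply/ler_addgt0Pr => /= e e0.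
(* Approximation within d costs 2d in the target and 2d in the source, the latter multiplied by
   [M]. *)
have c0 : 0 < 2 * M + 2 by rewrite ltr_wpDl ?mulr_ge0.
have d0 : 0 < e / (2 * M + 2) by rewrite divr_gt0.
have [p [Gp p1 p2]] := xy _ d0; have [q [Gq q1 q2]] := xy' _ d0.
have := GM (GZD (-1) Gq Gp); rewrite /= !scaleN1r ![- _ + _]addrC => pq.
have h1 : hnorm (y - y') <= hnorm (y - p.2) + (hnorm (p.2 - q.2) + hnorm (q.2 - y')).
  by apply: le_trans (hdistD p.2 _ _) _; rewrite lerD2l; exact: hdistD.
have h2 : hnorm (p.1 - q.1) <= hnorm (p.1 - x) + (hnorm (x - x') + hnorm (x' - q.1)).
  by apply: le_trans (hdistD x _ _) _; rewrite lerD2l; exact: hdistD.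
rewrite [hnorm (y - p.2)]hdistC in h1; rewrite [hnorm (x' - q.1)]hdistC in h2.
have eE : e = e / (2 * M + 2) * (2 * M + 2) by rewrite divfK// gt_eqF.
have := ler_wpM2l M0 h2; rewrite eE.
move: (e / _ : R) d0 p1 p2 q1 q2 pq h1 {eE} => d d0.
move: (hnorm (p.1 - x)) (hnorm (p.2 - y)) (hnorm (q.1 - x')) (hnorm (q.2 - y')) => a1 a2 a3 a4.
move: (hnorm (p.1 - q.1)) (hnorm (p.2 - q.2)) (hnorm (x - x')) (hnorm (y - y')) => a5 a6 a7 a8.
move=> p1 p2 q1 q2 pq h1 h3.
have k1 := ler_wpM2l M0 (ltW p1); have k2 := ler_wpM2l M0 (ltW q1); nra.
Qed.

Lemma near_graph_uniq x y y' : near_graph x y -> near_graph x y' -> y = y'.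
Proof.
move=> xy xy'; apply/eqP; rewrite -subr_eq0; apply/eqP/hnorm_eq0/eqP.
by rewrite eq_le hnorm_ge0 andbT; have := near_graphM xy xy'; rewrite subrr hnorm0 mulr0.
Qed.

Lemma near_graph_exists x : exists y, near_graph x y.
Proof.
have /choice[p pP] : forall k : nat, exists p, G p /\ hnorm (p.1 - x) < k.+1%:R^-1.
  by move=> k; apply: Gdense; rewrite invr_gt0.
have [|y yP] := @hcomplete R K (fun k => (p k).2).
  move=> e e0; have c0 : 0 < 2 * M + 1 by rewrite ltr_wpDl ?mulr_ge0.
  have [N NP] : exists N : nat, forall k, (N <= k)%N -> k.+1%:R^-1 <= e / (2 * M + 1).
    exists (Num.truncn ((e / (2 * M + 1))^-1)) => k Nk.
    rewrite -[X in _ <= X]invrK lef_pV2 ?posrE ?invr_gt0 ?divr_gt0//.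
    by apply: le_trans (ltW (truncnS_gt _)) _; rewrite ler_nat ltnS.
  exists N => i j Ni Nj.
  have := GM (GZD (-1) (pP j).1 (pP i).1); rewrite /= !scaleN1r ![- _ + _]addrC => pij.
  apply: le_lt_trans pij _.
  have hx : hnorm ((p i).1 - (p j).1) <= e / (2 * M + 1) + e / (2 * M + 1).
    apply: le_trans (hdistD x _ _) _; rewrite [hnorm (x - _)]hdistC; apply: lerD.
      by apply: ltW; apply: lt_le_trans (pP i).2 _; exact: NP.
    by apply: ltW; apply: lt_le_trans (pP j).2 _; exact: NP.
  have d0 : 0 < e / (2 * M + 1) by rewrite divr_gt0.
  have eE : e = e / (2 * M + 1) * (2 * M + 1) by rewrite divfK// gt_eqF.
  have := ler_wpM2l M0 hx; rewrite [X in _ -> _ < X]eE; move: (e / _) d0 => d d0 h; nra.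
exists y => e e0; have [N NP] := yP e e0.
pose k := maxn N (Num.truncn (e^-1)); exists (p k); split.
- exact: (pP k).1.
- apply: lt_le_trans (pP k).2 _; rewrite -[X in _ <= X]invrK lef_pV2 ?posrE ?invr_gt0//.
  by apply: le_trans (ltW (truncnS_gt _)) _; rewrite ler_nat ltnS leq_maxr.
- by apply: NP; exact: leq_maxl.
Qed.

Lemma near_graphZD (a : C) x y x' y' : near_graph x y -> near_graph x' y' ->
  near_graph (a *: x + x') (a *: y + y').
Proof.
move=> xy xy' e e0; set c := Num.sqrt (abs2 a).
have c0 : 0 <= c by exact: sqrtr_ge0.
have d0 : 0 < e / (c + 1) by rewrite divr_gt0// ltr_wpDl.
have [p [Gp p1 p2]] := xy _ d0; have [q [Gq q1 q2]] := xy' _ d0.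
exists (a *: p.1 + q.1, a *: p.2 + q.2); split; first exact: GZD.
all: rewrite /= opprD addrACA -scalerBr; apply: le_lt_trans (hnorm_triangle _ _) _; rewrite hnormZ -/c.
all: have eE : e = e / (c + 1) * (c + 1) by rewrite divfK// gt_eqF// ltr_wpDl.
all: rewrite [X in _ < X]eE.
- move: (e / _) d0 p1 q1 => d d0; move: (hnorm _) (hnorm _) => r s rd sd; nra.
- move: (e / _) d0 p2 q2 => d d0; move: (hnorm _) (hnorm _) => r s rd sd; nra.
Qed.

Lemma near_graph_id p : G p -> near_graph p.1 p.2.
Proof. by move=> Gp e e0; exists p; rewrite !subrr !hnorm0. Qed.

Lemma continuous_extension : exists Phi : H -> K,
  [/\ (forall a x y, Phi (a *: x + y) = a *: Phi x + Phi y),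
      (forall p, G p -> Phi p.1 = p.2) &
      (forall x y, hnorm (Phi x - Phi y) <= M * hnorm (x - y))].
Proof.
have /choice[Phi PhiP] := near_graph_exists; exists Phi; split.
- by move=> a x y; exact: near_graph_uniq (PhiP _) (near_graphZD a (PhiP x) (PhiP y)).
- by move=> p Gp; exact: near_graph_uniq (PhiP _) (near_graph_id Gp).
- by move=> x y; exact: near_graphM.
Qed.

End continuous_extension.

Section L2_clifford_fock.
Variables (R : realType) (L2C : hilbertType R) (iota : op R -> L2C).
Hypothesis HL2C : is_L2_clifford iota.
Local Notation C := R[i].
Local Notation T := (measurableTypeR R).
Local Notation fock := (fock R).
Local Notation Om := (vacuum R).
Implicit Types (x y : L2C).

Lemma stateE (u : op R) : state u = hdot Om (u Om).
Proof. by rewrite -fock_dot_hdot. Qed.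

Lemma hdot_iota (u v : op R) : clifford u -> clifford v -> hdot (iota u) (iota v) = hdot (u Om) (v Om).
Proof.
move=> uC vC; rewrite (L2_iota_dot HL2C uC vC) stateE adjE.
by rewrite [RHS](hdot_adjr _ _ (clifford_bounded uC)).
Qed.

Lemma hnorm_iota (u : op R) : clifford u -> hnorm (iota u) = hnorm (u Om).
Proof. by move=> uC; rewrite !hnormE !hn2_hdot hdot_iota. Qed.

Lemma cliffordZD (a : C) (u v : op R) : clifford u -> clifford v -> clifford (a *: u + v).
Proof. exact: vN_generatedZD. Qed.

(** The correspondence of [iota u] and u Omega is isometric, and both sides are dense, on the Fock
    side by cyclicity of the vacuum. It therefore extends in both directions, and the two extensions
    are inverse to each other on dense sets, hence everywhere. *)
Lemma fock_unitary_exists : exists VW : (L2C -> fock) * (fock -> L2C),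
  [/\ (forall a x y, VW.1 (a *: x + y) = a *: VW.1 x + VW.1 y),
      (forall u, clifford u -> VW.1 (iota u) = u Om),
      (forall x, VW.2 (VW.1 x) = x), (forall y : fock, VW.1 (VW.2 y) = y) &
      (forall x, hnorm (VW.1 x) = hnorm x)].
Proof.
pose G : set (L2C * fock) := [set (iota u, u Om) | u in @clifford R].
pose G' : set (fock * L2C) := [set (u Om, iota u) | u in @clifford R].
have [||||V [VZD VG V1]] := @continuous_extension R L2C fock G 1.
- exact: ler01.
- move=> a _ _ [u uC <-] [v vC <-]; exists (a *: u + v : op R) => /=; first exact: cliffordZD.
  by rewrite (L2_iota_linear HL2C).
- by move=> _ [u uC <-] /=; rewrite mul1r (hnorm_iota uC).
- move=> x e e0; have [u [uC ux]] := L2_iota_dense HL2C x e0.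
  by exists (iota u, u Om); split => //; exists u.
have [||||W [WZD WG W1]] := @continuous_extension R fock L2C G' 1.
- exact: ler01.
- move=> a _ _ [u uC <-] [v vC <-]; exists (a *: u + v : op R) => /=; first exact: cliffordZD.
  by rewrite (L2_iota_linear HL2C).
- by move=> _ [u uC <-] /=; rewrite mul1r (hnorm_iota uC).
- move=> x e e0; have [_ [[u uC <-] ux]] := vacuum_orbit_dense x e0.
  by exists (u Om, iota u); split => //; exists u.
have Vi u : clifford u -> V (iota u) = u Om by move=> uC; apply: (VG (iota u, u Om)); exists u.
have Wi u : clifford u -> W (u Om) = iota u by move=> uC; apply: (WG (u Om, iota u)); exists u.
have WV x : W (V x) = x.
  apply/eqP; rewrite -subr_eq0; apply/eqP/hnorm_eq0; apply: eps_eq0 => [e e0|]; last exact: hnorm_ge0.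
  have [u [uC ux]] := L2_iota_dense HL2C x (divr_gt0 e0 (ltr0n R 2)).
  apply: le_trans (hdistD (iota u) _ _) _; rewrite [X in _ <= X]splitr; apply: lerD; last exact: ltW.
  rewrite -{1}(Wi u uC); apply: le_trans (W1 _ _) _; rewrite mul1r -(Vi u uC).
  by apply: le_trans (V1 _ _) _; rewrite mul1r hdistC; exact: ltW.
have VW (y : fock) : V (W y) = y.
  apply/eqP; rewrite -subr_eq0; apply/eqP/hnorm_eq0; apply: eps_eq0 => [e e0|]; last exact: hnorm_ge0.
  have [_ [[u uC <-] ux]] := vacuum_orbit_dense y (divr_gt0 e0 (ltr0n R 2)).
  apply: le_trans (hdistD (u Om) _ _) _; rewrite [X in _ <= X]splitr; apply: lerD; last exact: ltW.
  rewrite -{1}(Vi u uC); apply: le_trans (V1 _ _) _; rewrite mul1r -(Wi u uC).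
  by apply: le_trans (W1 _ _) _; rewrite mul1r hdistC; exact: ltW.
exists (V, W); split => //= x.
have V0 : V 0 = 0 by have := VZD (-1) 0 0; rewrite scaler0 addr0 scaleN1r addNr.
have W0 : W 0 = 0 by rewrite -V0 WV.
apply/eqP; rewrite eq_le; apply/andP; split.
  by have := V1 x 0; rewrite V0 !subr0 mul1r.
by have := W1 (V x) 0; rewrite W0 WV !subr0 mul1r.
Qed.

Definition to_fock : L2C -> fock := (projT1 (cid fock_unitary_exists)).1.
Definition of_fock : fock -> L2C := (projT1 (cid fock_unitary_exists)).2.
Local Notation V := to_fock.
Local Notation W := of_fock.

Let VWP := projT2 (cid fock_unitary_exists).

Lemma to_fockZD (a : C) x y : V (a *: x + y) = a *: V x + V y.
Proof. by have [h _ _ _ _] := VWP; exact: h. Qed.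

Lemma to_fock_iota u : clifford u -> V (iota u) = u Om.
Proof. by have [_ h _ _ _] := VWP; exact: h. Qed.

Lemma to_fockK : cancel V W.
Proof. by have [_ _ h _ _] := VWP; exact: h. Qed.

Lemma of_fockK : cancel W V.
Proof. by have [_ _ _ h _] := VWP; exact: h. Qed.

Lemma hnorm_to_fock x : hnorm (V x) = hnorm x.
Proof. by have [_ _ _ _ h] := VWP; exact: h. Qed.

Lemma to_fock0 : V 0 = 0.
Proof. by have := to_fockZD (-1) 0 0; rewrite scaler0 addr0 scaleN1r addNr. Qed.

Lemma to_fockD x y : V (x + y) = V x + V y.
Proof. by have := to_fockZD 1 x y; rewrite !scale1r. Qed.

Lemma to_fockZ (a : C) x : V (a *: x) = a *: V x.
Proof. by have := to_fockZD a x 0; rewrite to_fock0 !addr0. Qed.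

Lemma to_fockN x : V (- x) = - V x.
Proof. by rewrite -scaleN1r to_fockZ scaleN1r. Qed.

Lemma to_fockB x y : V (x - y) = V x - V y.
Proof. by rewrite to_fockD to_fockN. Qed.

Lemma to_fock_sum I (s : seq I) (P : pred I) (F : I -> L2C) :
  V (\sum_(i <- s | P i) F i) = \sum_(i <- s | P i) V (F i).
Proof. by rewrite (big_morph V to_fockD to_fock0). Qed.

Lemma hn2_to_fock x : hn2 (V x) = hn2 x.
Proof. by rewrite -!sqr_hnorm hnorm_to_fock. Qed.

Lemma to_fock_inj x y : V x = V y -> x = y.
Proof. by move=> /(congr1 W); rewrite !to_fockK. Qed.

Lemma of_fockB (y y' : fock) : W (y - y') = W y - W y'.
Proof. by apply: to_fock_inj; rewrite to_fockB !of_fockK. Qed.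

Lemma hnorm_of_fock (y : fock) : hnorm (W y) = hnorm y.
Proof. by rewrite -hnorm_to_fock of_fockK. Qed.

Lemma iota_of_fock u : clifford u -> iota u = W (u Om).
Proof. by move=> uC; rewrite -(to_fock_iota uC) to_fockK. Qed.

Lemma L2_fockE x : L2_fock iota x = V x.
Proof.
rewrite /L2_fock (_ : (fun x : fock => (fock_norm x)%:E) = (fun x : fock => (hnorm x)%:E)); last first.
  by apply/funext => y; rewrite fock_norm_hnorm.
apply: (@extend_continuous R L2C fock _ V 1).
- by move=> _ [u uC <-] /=; rewrite to_fock_iota.
- move=> y e e0; have [u [uC ux]] := L2_iota_dense HL2C y e0.
  by exists (iota u, u Om); split => //; exists u.
- by move=> y y'; rewrite mul1r -to_fockB hnorm_to_fock.
Qed.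

Lemma L2_lmulE (a : op R) x : clifford a -> L2_lmul iota a x = W (a (V x)).
Proof.
move=> aC; have ba := clifford_bounded aC; have /bounded_opP[_ [M [M0 aM]]] := ba.
apply: (@extend_continuous R L2C L2C _ (fun x => W (a (V x))) (Num.sqrt M)).
- move=> _ [u uC <-] /=; rewrite (to_fock_iota uC) (@iota_of_fock (a \o u))//.
  exact: vN_generatedM.
- move=> y e e0; have [u [uC ux]] := L2_iota_dense HL2C y e0.
  by exists (iota u, iota (a \o u)); split => //; exists u.
- move=> y y'; rewrite -of_fockB hnorm_of_fock -(bounded_opB _ _ ba) -to_fockB.
  rewrite -[hnorm (y - y')]hnorm_to_fock !hnormE -sqrtrM// ler_wsqrtr//.
Qed.

Lemma L2_uptoE (t : R) x : 0 <= t -> L2_upto iota t x <-> upto_space t (V x).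
Proof.
move=> t0; split=> [xt|/(upto_space_cyclic t0) xt].
  apply: hclosure_upto_space => e e0; have [u [uC ux]] := xt e e0.
  have uC' := clifford_upto_clifford uC.
  exists (u Om); split; first exact: clifford_upto_vacuum.
  by rewrite -(to_fock_iota uC') -to_fockB hnorm_to_fock.
move=> e e0; have [_ [[u uC <-] ux]] := xt e e0; exists u; split => //.
by rewrite -hnorm_to_fock to_fockB (to_fock_iota (clifford_upto_clifford uC)).
Qed.

(** For a in C_t, <a Omega, E(u) Omega> = m(a^* E(u)) = m(E(a^* u)) = m(a^* u) = <a Omega, u Omega>,
    by the bimodule property and preservation of m. As the vectors a Omega are dense in the range of
    the cutoff, to which E(u) Omega belongs, E(u) Omega is the projection of u Omega. *)
Lemma cond_exp_vacuum (t : R) (E : op R -> op R) u : 0 <= t -> conditional_expectation t E ->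
  clifford u -> E u Om = cutoff t (u Om).
Proof.
move=> t0 HE uC; have EuC := cond_exp_range HE uC.
have EuK := clifford_upto_vacuum EuC.
have key (y : fock) : cyclic_space t y -> hdot y (E u Om) = hdot y (cutoff t (u Om)).
  move=> [a aC <-]; have aC' := clifford_upto_clifford aC.
  have ba := clifford_bounded aC'; have aA := vN_generated_adj aC.
  have idC : clifford_upto t idfun by exact: vN_generated_id.
  rewrite -hdot_cutoff (clifford_upto_vacuum aC).
  have := cond_exp_bimod HE aA idC uC => /(congr1 (@state R)).
  rewrite (cond_exp_state HE); last exact: vN_generatedM (clifford_upto_clifford aA) uC.
  by rewrite !stateE /= -!(hdot_adjr _ _ ba) => ->.
apply/eqP; rewrite -subr_eq0; apply/eqP; set d := _ - _.
have dK : upto_space t d.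
  by apply: lin_subspaceB => //; [exact: lin_subspace_upto_space|exact: upto_space_cutoff].
apply: hdot_eq0; apply: hclosure_ortho (upto_space_cyclic t0 dK) => y yC.
by rewrite hdotC /d hdotBr key// subrr conjc0.
Qed.

Lemma L2_cond_expE (t : R) (E : op R -> op R) x : 0 <= t -> conditional_expectation t E ->
  L2_cond_exp iota E x = W (cutoff t (V x)).
Proof.
move=> t0 HE; apply: (@extend_continuous R L2C L2C _ (fun x => W (cutoff t (V x))) 1).
- move=> _ [u uC <-] /=; rewrite (to_fock_iota uC) -(cond_exp_vacuum t0 HE uC).
  apply: iota_of_fock; exact: clifford_upto_clifford (cond_exp_range HE uC).
- move=> y e e0; have [u [uC ux]] := L2_iota_dense HL2C y e0.
  by exists (iota u, iota (E u)); split => //; exists u.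
- move=> y y'; rewrite mul1r -of_fockB hnorm_of_fock -(bounded_opB _ _ (cutoff_bounded t)) -to_fockB.
  by rewrite -[hnorm (y - y')]hnorm_to_fock; exact: hnorm_cutoff.
Qed.

(** The target is the scalars with their modulus, so the argument of [extend_continuous] is
    repeated, with Cauchy-Schwarz as the Lipschitz bound. *)
Lemma L2_stateE x : L2_state iota x = hdot Om (V x).
Proof.
have est u : clifford u ->
    Num.sqrt (abs2 (state u - hdot Om (V x))) <= hnorm Om * hnorm (iota u - x).
  move=> uC; rewrite stateE -hdotBr -(to_fock_iota uC) -to_fockB.
  rewrite -[hnorm (iota u - x)]hnorm_to_fock !hnormE -sqrtrM ?hn2_ge0// ler_wsqrtr//.
  exact: cauchy_schwarz.
apply: extendE.
  have /choice[g gP] : forall k : nat, exists u, clifford u /\ hnorm (iota u - x) < k.+1%:R^-1.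
    by move=> k; apply: (L2_iota_dense HL2C); rewrite invr_gt0.
  have gx : hnorm (iota (g k) - x) @[k --> \oo] --> 0.
    apply: (@squeeze0 R _ (fun k => k.+1%:R^-1)) => [k|]; last exact: invS_cvg0.
    by have [_ /ltW ->] := gP k; rewrite hnorm_ge0.
  exists (fun k => (iota (g k), state (g k))); split => /=.
  - by move=> k; exists (g k) => //; have [] := gP k.
  - exact/EFin_cvg0.
  - apply/EFin_cvg0/(@squeeze0 _ _ (fun k => hnorm Om * hnorm (iota (g k) - x))).
      by move=> k; rewrite sqrtr_ge0 est//; have [] := gP k.
    by rewrite -(mulr0 (hnorm Om)); exact: cvgMr.
move=> y [g [/= gG /EFin_cvg0 gx /EFin_cvg0 gy]].
apply/eqP; rewrite -subr_eq0; apply/eqP/abs2_eq0.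
apply/esym; apply: (cvg_unique (@Rhausdorff R) (F := (fun _ : nat => abs2 (y - hdot Om (V x))) @ \oo)).
- apply: (@squeeze0 _ _ (fun k => 2 * Num.sqrt (abs2 ((g k).2 - y)) ^+ 2 +
      2 * (hnorm Om * hnorm ((g k).1 - x)) ^+ 2)).
    move=> k; rewrite abs2_ge0/=; have [u uC gE] := gG k; rewrite -gE/=.
    have -> : y - hdot Om (V x) = - (state u - y) + (state u - hdot Om (V x)).
      by rewrite opprB addrA subrK.
    apply: le_trans (abs2D _ _) _; rewrite abs2N sqr_sqrtr ?abs2_ge0// lerD2l ler_wpM2l//.
    rewrite -[X in X <= _]sqr_sqrtr ?abs2_ge0//; apply: lerXn2r; rewrite ?nnegrE ?sqrtr_ge0 ?mulr_ge0 ?hnorm_ge0//.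
    exact: est.
  have h1 : (hnorm Om * hnorm ((g k).1 - x)) @[k --> \oo] --> 0.
    by rewrite -(mulr0 (hnorm Om)); exact: cvgMr.
  have sq (v : nat -> R) : v k @[k --> \oo] --> 0 -> 2 * v k ^+ 2 @[k --> \oo] --> 0.
    move=> v0.
    have : (fun k => 2 * (v k * v k)) @ \oo --> 2 * ((0 : R) * 0) by apply: cvgMr; exact: cvgM.
    rewrite !mulr0; apply: cvg_trans.
    by apply: near_eq_cvg; apply: nearW => k /=; rewrite expr2.
  by rewrite -[X in _ --> X]addr0; apply: cvgD; exact: sq.
- exact: cvg_cst.
Qed.

Lemma to_fock_J n (f : n.-tuple T -> C) : V (J iota f) = chaos f.
Proof.
rewrite /J; case: xgetP => [x _ /=|/(_ (W (chaos f)))]; first by rewrite L2_fockE.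
by rewrite /= L2_fockE of_fockK => h; case: h.
Qed.

End L2_clifford_fock.

(** * Comparison of integrals over the half-line and over the unit interval *)

Section lebesgue_restrictions.
Variable R : realType.
Local Notation T := (measurableTypeR R).

Let leb1oo : {sigma_finite_measure set T -> \bar R} := lebesgue_on (@measurable_itv R `]1, +oo[%R).

Lemma lebRp_split (A : set T) : measurable A -> lebRp R A = (leb01 R A + leb1oo A)%E.
Proof.
move=> mA; rewrite /lebRp /leb01 /leb1oo /= /lebesgue_on /mrestr.
rewrite -measureU; try exact: measurableI.
  congr lebesgue_measure; apply/seteqP; split => x /=; rewrite !in_itv/= ?andbT.
    by move=> [Ax x0]; have [x1|x1] := leP x 1; [left|right]; rewrite ?x0.
  by move=> [[Ax /andP[-> _]]|[Ax x1]]//; split => //; exact: le_trans ler01 (ltW x1).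
apply/seteqP; split => x //= [[_ +] [_]]; rewrite !in_itv/= andbT => /andP[_ x1].
by rewrite ltNge x1.
Qed.

Lemma integral_lebRp_split (f : T -> \bar R) : measurable_fun setT f -> (forall x, (0 <= f x)%E) ->
  (\int[lebRp R]_x f x = \int[leb01 R]_x f x + \int[leb1oo]_x f x)%E.
Proof.
move=> mf f0; rewrite -ge0_integral_measure_add//.
by apply: eq_measure_integral => A mA _; exact: etrans (lebRp_split mA) (esym (measure_addE _ _ _)).
Qed.

Lemma ae_leb01 (P : T -> Prop) : (\forall x \ae lebRp R, P x) -> \forall x \ae leb01 R, P x.
Proof.
move=> [N [mN N0 NP]]; exists N; split => //.
apply/eqP; rewrite eq_le measure_ge0 andbT; have := lebRp_split mN; rewrite N0 => ->.
by rewrite leeDl.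
Qed.

Lemma ae_leb01_itv : \forall x \ae leb01 R, 0 <= (x : R) <= 1.
Proof.
exists (~` `[0, 1]%classic); split; first exact: measurableC.
  by rewrite /leb01 /= /lebesgue_on /mrestr setICl measure0.
by move=> x /= h; rewrite in_itv.
Qed.

Lemma integral_leb01_le (f : T -> \bar R) : measurable_fun setT f -> (forall x, (0 <= f x)%E) ->
  (\int[leb01 R]_x f x <= \int[lebRp R]_x f x)%E.
Proof. by move=> mf f0; rewrite integral_lebRp_split// leeDl// integral_ge0. Qed.

Lemma integral_lebRp_leb01 (f : T -> \bar R) : measurable_fun setT f -> (forall x, (0 <= f x)%E) ->
  (\forall x \ae lebRp R, 1 < (x : R) -> f x = 0%E) ->
  (\int[lebRp R]_x f x = \int[leb01 R]_x f x)%E.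
Proof.
move=> mf f0 [N [mN N0 Nf]]; rewrite integral_lebRp_split// [X in (_ + X)%E](_ : _ = 0%E) ?adde0//.
rewrite (@ae_eq_lower_integral _ _ _ leb1oo f (cst 0%E))//; first by rewrite integral0.
exists (N `|` ~` `]1, +oo[%classic); split.
- by apply: measurableU => //; exact: measurableC.
- apply: null_set_setU => //; first exact: measurableC.
    apply/eqP; rewrite eq_le measure_ge0 andbT; have := lebRp_split mN; rewrite N0 => ->.
    by rewrite leeDr.
  by rewrite /leb1oo /= /lebesgue_on /mrestr setICl measure0.
- move=> x /= fx; apply: contrapT => /not_orP[Nx /contrapT]; rewrite in_itv/= andbT => x1.
  by apply: Nx; apply: Nf => /= h; apply: fx; exact: h.
Qed.

Lemma nneseries_recl0 (f : nat -> \bar R) : (forall n, (0 <= f n)%E) -> f 0%N = 0%E ->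
  (\sum_(0 <= n <oo) f n = \sum_(0 <= n <oo) f n.+1)%E.
Proof.
move=> f0 f00; apply/esym/cvg_lim => //.
have := @is_cvg_nneseries R f xpredT 0%N (fun n _ _ => f0 n).
move=> /cvg_ex[l fl]; rewrite (cvg_lim _ fl)//.
move: fl; rewrite -(cvg_shiftS (fun n => \sum_(0 <= i < n) f i)%E); apply: cvg_trans; apply: near_eq_cvg; apply: nearW => n /=.
by rewrite big_nat_recl// f00 add0e.
Qed.

End lebesgue_restrictions.

Section ito_fock_isometry.
Variable R : realType.
Local Notation C := R[i].
Local Notation T := (measurableTypeR R).
Local Notation lam := (tuple_measure (lebRp R)).
Local Notation mu := (fock_measure R).
Local Notation fock := (fock R).

Lemma EFin_hn2 (x : fock) : (hn2 x)%:E = prefock_norm2 (fock_fun x).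
Proof.
have [mx _] := fock_fun_L2 x.
by rewrite hn2E fineK; [exact: L2norm2_fock|exact/L2norm2_fin/fock_fun_L2].
Qed.

(** On each level (n+1)! |antisymmetrization of W_n|^2 = n! |W_n|^2, and Tonelli splits the latter
    over the head. [P] is a measurable version of the squared norm of [y], which is specified only
    almost everywhere. *)
Lemma ito_fock_isometry (W : forall n, n.+1.-tuple T -> C) (x : fock) (y : T -> fock) :
  (forall n, L2fun (lam n.+1) (W n)) ->
  (forall n, stab_antisymmetric (lebRp R) (W n)) ->
  (forall n, \forall u \ae lam n.+1, W n u != 0 -> headmax u) ->
  (\forall u \ae lam 0, fock_fun x (of_tuple u) = 0) ->
  (forall n, \forall u \ae lam n.+1, fock_fun x (of_tuple u) = antisymmetrize (W n) u) ->
  (\forall t \ae lebRp R, forall n, \forall s \ae lam n,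
     fock_fun (y t) (of_tuple s) = W n (tcons (t, s))) ->
  exists P : T -> \bar R, [/\ measurable_fun setT P, (forall t, (0 <= P t)%E),
    ((hn2 x)%:E = \int[lebRp R]_t P t)%E & \forall t \ae lebRp R, P t = (hn2 (y t))%:E].
Proof.
move=> LW aW hW x0 xS yW.
pose f n (t : T) := ((n`!%:R)%:E * L2norm2 (lam n) (fun s => W n (tcons (t, s))))%E.
have f0 n t : (0 <= f n t)%E by rewrite mule_ge0// L2norm2_ge0.
have mL n : measurable_fun setT (fun t => L2norm2 (lam n) (fun s => W n (tcons (t, s)))).
  have [mW _] := LW n.
  apply: (@measurable_tonelli1 _ _ _ (lebRp R) n (fun u => (abs2 (W n u))%:E)).
    exact: measurable_abs2.
  by move=> u; rewrite lee_fin abs2_ge0.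
have mf n : measurable_fun setT (f n) by apply: measurable_funeM; exact: mL.
exists (fun t => \sum_(0 <= n <oo) f n t)%E; split.
- by apply: ge0_emeasurable_sum => // k t _ _; exact: f0.
- by move=> t; apply: nneseries_ge0 => n _ _; exact: f0.
- rewrite integral_nneseries// EFin_hn2 /prefock_norm2 nneseries_recl0; last 2 first.
  + by move=> n; rewrite mule_ge0// L2norm2_ge0.
  + rewrite (@ae_eq_L2norm2 _ _ _ (lam 0) (@chaos_comp R (fock_fun x) 0) (fun=> 0)) ?L2norm20 ?mule0//.
  apply: eq_eseriesr => n _; have [mW _] := LW n.
  have Lf0 t : (0 <= L2norm2 (lam n) (fun s => W n (tcons (t, s))))%E by exact: L2norm2_ge0.
  rewrite (ge0_integralZl (lebRp R) measurableT (mL n) (fun t _ => Lf0 t))//.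
  rewrite -(L2norm2_tcons (lebRp R) mW) (@ae_eq_L2norm2 _ _ _ (lam n.+1) (@chaos_comp R (fock_fun x) n.+1) (antisymmetrize (W n))); last exact: xS.
  rewrite -(fineK (L2norm2_fin (LW n))) -(fineK (L2norm2_fin (L2fun_antisymmetrize (LW n)))).
  rewrite -(ito_isometry (@lebRp_atomless R) (LW n) (aW n) (hW n)) -!EFinM factS natrM.
  by congr EFin; rewrite mulrA; congr (_ * _); exact: mulrC.
apply: filterS yW => t yt; rewrite EFin_hn2; apply: eq_eseriesr => n _; congr (_ * _)%E.
by apply/esym/ae_eq_L2norm2; exact: yt.
Qed.

End ito_fock_isometry.

(** * The Ito identity for finite chaos expansions *)

Lemma nat_monotone (R : realType) (t : nat -> R) n : (forall k, (k < n)%N -> t k <= t k.+1) ->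
  forall i j, (i <= j)%N -> (j <= n)%N -> t i <= t j.
Proof.
move=> tS i; elim=> [|j ih]; first by rewrite leqn0 => /eqP ->.
rewrite leq_eqVlt => /predU1P[->//|]; rewrite ltnS => ij jn.
by apply: le_trans (ih ij (ltnW jn)) (tS j jn).
Qed.

Section ito_identity.
Variable R : realType.
Local Notation C := R[i].
Local Notation T := (measurableTypeR R).
Local Notation lam := (tuple_measure (lebRp R)).
Local Notation mu := (fock_measure R).
Local Notation fock := (fock R).
Local Notation Om := (vacuum R).

Lemma ae_fock_funZ (a : C) (x : fock) : \forall s \ae mu, fock_fun (a *: x) s = a * fock_fun x s.
Proof.
have := ae_fock_funZD a x 0; rewrite addr0; apply: filterS2 (ae_fock_fun0 R) => s + ->.
by move=> ->; rewrite addr0.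
Qed.

Lemma ae_fock_fun_sum (n : nat) (x : 'I_n -> fock) :
  \forall s \ae mu, fock_fun (\sum_(i < n) x i) s = \sum_(i < n) fock_fun (x i) s.
Proof.
elim: n x => [|n ih] x.
  by rewrite big_ord0; apply: filterS (ae_fock_fun0 R) => s ->; rewrite big_ord0.
have H := ae_fock_funZD 1 (x ord0) (\sum_(i < n) x (lift ord0 i)).
rewrite scale1r in H; rewrite big_ord_recl.
apply: filterS2 (ih (fun i => x (lift ord0 i))) H => s e ->.
by rewrite e mul1r big_ord_recl.
Qed.

Lemma ae_fock_funB (x y : fock) :
  \forall s \ae mu, fock_fun (x - y) s = fock_fun x s - fock_fun y s.
Proof.
have := ae_fock_funZD (-1) y x; rewrite scaleN1r addrC; apply: filterS => s ->.
by rewrite mulN1r addrC.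
Qed.

Lemma ae_fock_chaos n m (f : n.-tuple T -> C) : Lambda (lebRp R) f ->
  \forall u \ae lam m, fock_fun (chaos f) (of_tuple u) = chaos_fun f (of_tuple u).
Proof.
move=> Lf; have /ae_fockP/(_ m) := ae_fock_class (chaos_fun_pred Lf).
by apply: filterS => u; rewrite -chaosE.
Qed.

Definition chaos_kernel (N : nat) (v : forall n, n.-tuple T -> C) (n : nat) : n.-tuple T -> C :=
  fun u => if (n < N)%N then v n u else 0.

Lemma Lambda_chaos_kernel N (v : forall n, n.-tuple T -> C) n :
  (forall n, Lambda (lebRp R) (v n)) -> Lambda (lebRp R) (@chaos_kernel N v n).
Proof. by move=> Lv; rewrite /chaos_kernel; case: (n < N)%N; [exact: Lv|exact: Lambda0]. Qed.

Lemma sum_chaos_fun N (v : forall n, n.-tuple T -> C) n (u : n.-tuple T) :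
  \sum_(k < N) chaos_fun (v k) (of_tuple u) = chaos_kernel N v u.
Proof.
rewrite /chaos_kernel; case: ifPn => [nN|]; last first.
  rewrite -leqNgt => Nn; rewrite big1// => k _; rewrite chaos_fun_neq//.
  by rewrite neq_ltn (leq_trans (ltn_ord k) Nn) orbT.
rewrite (bigD1 (Ordinal nN))//= chaos_fun_tuple big1 ?addr0// => k kn.
by rewrite chaos_fun_neq// eq_sym.
Qed.

Lemma ae_fock_fun_finite_chaos N (v : forall n, n.-tuple T -> C) n :
  (forall n, Lambda (lebRp R) (v n)) ->
  \forall u \ae lam n, fock_fun (\sum_(k < N) chaos (v k)) (of_tuple u) = chaos_kernel N v u.
Proof.
move=> Lv; have /ae_fockP/(_ n) := ae_fock_fun_sum (fun k : 'I_N => chaos (v k)).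
have H : \forall u \ae lam n, forall k : 'I_N, fock_fun (chaos (v k)) (of_tuple u) = chaos_fun (v k) (of_tuple u).
  by apply: filter_forall => k; exact: ae_fock_chaos.
by apply: filterS2 H => u uv ->; rewrite -sum_chaos_fun; apply: eq_bigr => k _; exact: uv.
Qed.

Definition dchaos (n : nat) : (n.-tuple T -> C) -> T -> fock :=
  match n with
  | 0 => fun _ _ => 0
  | n.+1 => fun f t => n.+1%:R *: chaos (fun s : n.-tuple T => f (tcons (t, s)))
  end.

Lemma ae_fock_fun_dchaos n m (v : forall n, n.-tuple T -> C) t :
  (forall n, Lambda (lebRp R) (fun s : n.-tuple T => v n.+1 (tcons (t, s)))) ->
  \forall u \ae lam m, fock_fun (dchaos (v n) t) (of_tuple u) =
    m.+1%:R * chaos_fun (v n) (of_tuple (tcons (t, u))).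
Proof.
move=> Lv; case: n => [|n].
  have /ae_fockP/(_ m) := ae_fock_fun0 R; apply: filterS => u ->.
  by rewrite chaos_fun_neq// mulr0.
have /ae_fockP/(_ m) := ae_fock_funZ n.+1%:R (chaos (fun s : n.-tuple T => v n.+1 (tcons (t, s)))).
apply: filterS2 (ae_fock_chaos m (Lv n)) => u + ->; move=> ->.
have [mn|mn] := eqVneq m n; first by subst m; rewrite !chaos_fun_tuple.
by rewrite !chaos_fun_neq ?mulr0// eqSS.
Qed.

Lemma ae_fock_fun_derivative N (v : forall n, n.-tuple T -> C) m t :
  (forall n, Lambda (lebRp R) (fun s : n.-tuple T => v n.+1 (tcons (t, s)))) ->
  \forall u \ae lam m, fock_fun (\sum_(k < N) dchaos (v k) t) (of_tuple u) =
    m.+1%:R * chaos_kernel N v (tcons (t, u)).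
Proof.
move=> Lv; have /ae_fockP/(_ m) := ae_fock_fun_sum (fun k : 'I_N => dchaos (v k) t).
have H : \forall u \ae lam m, forall k : 'I_N, fock_fun (dchaos (v k) t) (of_tuple u) =
    m.+1%:R * chaos_fun (v k) (of_tuple (tcons (t, u))).
  by apply: filter_forall => k; exact: ae_fock_fun_dchaos.
apply: filterS2 H => u uv ->; rewrite -sum_chaos_fun mulr_sumr.
by apply: eq_bigr => k _; exact: uv.
Qed.

Lemma antisymmetrize_sum n m (f : 'I_m -> n.-tuple T -> C) u :
  antisymmetrize (fun u => \sum_(k < m) f k u) u = \sum_(k < m) antisymmetrize (f k) u.
Proof.
elim: m f => [|m ih] f.
  by rewrite big_ord0 /antisymmetrize big1 ?mulr0// => s _; rewrite big_ord0 mulr0.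
rewrite big_ord_recl -ih -[antisymmetrize (f ord0) u]mul1r -antisymmetrizeZD.
by congr antisymmetrize; apply/funext => w; rewrite big_ord_recl mul1r.
Qed.

Lemma headmax_stab n (s : 'S_n.+1) (u : n.+1.-tuple T) : s ord0 = ord0 ->
  headmax (tperm_tuple s u) = headmax u.
Proof. by move=> s0; rewrite tperm_headmax s0. Qed.

Lemma headmax_upto n (u : n.+1.-tuple T) : headmax u = upto (thead u : R) (of_tuple (tbehead u)).
Proof.
apply/idP/idP => [/forallP h|/upto_tuple h].
  by apply/upto_tuple => i; rewrite tnth_tbehead.
apply/forallP => i; by case: (unliftP ord0 i) => [j ->|->//]; rewrite -tnth_tbehead.
Qed.

Lemma cmeasurable_headmax n : cmeasurable (fun u : n.+1.-tuple T => (headmax u)%:R : C).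
Proof.
have := cmeasurable_ind R (@measurable_headmax R n); congr cmeasurable; apply/funext => u.
by congr ((nat_of_bool _)%:R); apply/idP/idP; rewrite inE.
Qed.

Section identity.
Unset Implicit Arguments.
Variables (n N : nat) (t : nat -> R) (x : nat -> fock) (v : forall n, n.-tuple T -> C)
  (D : T -> fock).
Set Implicit Arguments.
Hypotheses (tS : forall k, (k < n)%N -> t k <= t k.+1) (t1 : t n <= 1).
Hypothesis xt : forall k, (k < n)%N -> upto_space (t k) (x k).
Hypothesis Lv : forall n, Lambda (lebRp R) (v n).
Hypothesis DE : \forall r \ae lebRp R, D r = \sum_(k < N) dchaos (v k) r.

Let z (k : nat) : T -> C := itv_ind (t k) (t k.+1).
Let xl k m : m.-tuple T -> C := fun u => fock_fun (x k) (of_tuple u).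
Let G : fock := \sum_(k < N) chaos (v k).
(** The slices of [A] are the components of the simple process, those of [B] the components of pi_t
    D_t G for t <= 1: the indicator of a largest head is the cutoff at the time given by the head.
    Antisymmetrizing [W], that is [A] minus [B], yields [X - Y] on the positive levels. *)
Let f m : m.+1.-tuple T -> C := fun u => (upto 1 (of_tuple u))%:R * chaos_kernel N v u.
Let A m : m.+1.-tuple T -> C := fun u => \sum_(k < n) tensor (z k) (@xl k m) u.
Let B m : m.+1.-tuple T -> C := fun u => m.+1%:R * ((headmax u)%:R * @f m u).
Let W m : m.+1.-tuple T -> C := fun u => -1 * @B m u + @A m u.

Let Lf m : Lambda (lebRp R) (@f m).
Proof. exact: Lambda_cut (Lambda_chaos_kernel N m.+1 Lv). Qed.

Let LA m : L2fun (lam m.+1) (@A m).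
Proof.
apply: L2fun_sum => k; apply: L2fun_tensor; first exact: L2fun_itv.
exact: (Lambda_fock_fun (x k) m).1.
Qed.

Let LB m : L2fun (lam m.+1) (@B m).
Proof.
apply: L2funZ; have [Lf2 _] := Lf m; have [mf _] := Lf2; apply: (L2fun_le Lf2).
  exact: cmeasurableM (@cmeasurable_headmax m) mf.
by move=> u; case: (headmax u); rewrite ?mul1r// mul0r abs20 abs2_ge0.
Qed.

Let LW m : L2fun (lam m.+1) (@W m).
Proof. exact: L2funZD. Qed.

Let aW m : stab_antisymmetric (lebRp R) (@W m).
Proof.
move=> s s0.
have HA : \forall u \ae lam m.+1, forall k : 'I_n,
    tensor (z k) (@xl k m) (tperm_tuple s u) = (-1) ^+ s * tensor (z k) (@xl k m) u.
  apply: filter_forall => k; apply: stab_antisymmetric_tensor => //.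
  exact: (Lambda_fock_fun (x k) m).2.
apply: filterS2 HA ((Lf m).2 s) => u uA uf.
rewrite /W /A /B headmax_stab// uf (eq_bigr _ (fun k _ => uA k)) -mulr_sumr.
by move: ((-1) ^+ s : C) (f u) => e g; ring.
Qed.

(** Adaptedness is used here: in the k-th term of [A] the head exceeds [t k], while [x k] lives on
    tails up to [t k]. In [B] the restriction is explicit. *)
Let hW m : \forall u \ae lam m.+1, @W m u != 0 -> headmax u.
Proof.
have H : \forall u \ae lam m.+1, forall k : 'I_n,
    ~~ upto (t k) (of_tuple (tbehead u)) -> @xl k m (tbehead u) = 0.
  apply: filter_forall => k.
  have /upto_spaceP/ae_fockP/(_ m) := xt (ltn_ord k).
  exact: (@ae_tbehead _ _ _ (lebRp R) m (fun u => ~~ upto (t k) (of_tuple u) -> @xl k m u = 0)).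
apply: filterS H => u uH; apply: contraR => hu; apply/eqP.
rewrite /W /B (negbTE hu) mul0r !mulr0 add0r /A big1// => k _; rewrite tensorE.
have [tu|tu] := leP (thead u : R) (t k); first by rewrite /z (itv_ind_below _ tu) mul0r.
rewrite uH ?mulr0//; apply: contra hu; rewrite headmax_upto.
by apply: sub_all => r /= /le_trans; apply; exact: ltW.
Qed.

Let X : fock := \sum_(k < n) creation (z k) (x k).
Let Y : fock := cutoff 1 G - hdot Om G *: Om.

Let ae_creation k m : \forall u \ae lam m, fock_fun (creation (z k) (x k)) (of_tuple u) =
  creation_fun (z k) (fock_fun (x k)) (of_tuple u).
Proof.
have /ae_fockP/(_ m) := ae_fock_class (prefock_creation (L2fun_itv (t k) (t k.+1)) (fock_fun_pred (x k))).
by rewrite (creation_opE (L2fun_itv (t k) (t k.+1))).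
Qed.

Let ae_X m : \forall u \ae lam m, fock_fun X (of_tuple u) =
  \sum_(k < n) creation_fun (z k) (fock_fun (x k)) (of_tuple u).
Proof.
have /ae_fockP/(_ m) := ae_fock_fun_sum (fun k : 'I_n => creation (z k) (x k)).
have H : \forall u \ae lam m, forall k : 'I_n, fock_fun (creation (z k) (x k)) (of_tuple u) =
    creation_fun (z k) (fock_fun (x k)) (of_tuple u).
  by apply: filter_forall => k; exact: ae_creation.
by apply: filterS2 H => u uv ->; apply: eq_bigr => k _; exact: uv.
Qed.

Let ae_Y m : \forall u \ae lam m, fock_fun Y (of_tuple u) =
  (upto 1 (of_tuple u))%:R * chaos_kernel N v u - hdot Om G * chaos_fun (fun _ : 0.-tuple T => 1 : C) (of_tuple u).
Proof.
have /ae_fockP/(_ m) H1 := ae_fock_funB (cutoff 1 G) (hdot Om G *: Om).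
have /ae_fockP/(_ m) H2 := ae_cutoff 1 G.
have /ae_fockP/(_ m) H3 := ae_fock_funZ (hdot Om G) Om.
have H4 := ae_fock_fun_finite_chaos N m Lv.
have H5 := ae_fock_chaos m (Lambda_cst (1 : C)).
apply: filterS3 H1 (filterI H2 H3) (filterI H4 H5) => u -> [-> ->] [e4 e5].
by rewrite e4 e5.
Qed.

Let hdot_Om_G (u : 0.-tuple T) : hdot Om G = chaos_kernel N v u.
Proof.
rewrite /vacuum hdot_chaos; last exact: Lambda_cst.
rewrite fact0 mul1r /ldot.
have [[mG _] _] := Lambda_fock_fun G 0; have [[mk _] _] := Lambda_chaos_kernel N 0 Lv.
rewrite (@ae_eq_cintegral _ _ _ (lam 0) _ (@chaos_kernel N v 0)) //.
- rewrite /cintegral /Rintegral /= !integral_dirac//.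
  + by rewrite diracT !mul1e (tuple0 u); case: (chaos_kernel _ _ _).
  + by apply/measurable_EFinP; exact: mk.2.
  + by apply/measurable_EFinP; exact: mk.1.
- by apply: cmeasurableM => //; exact: cmeasurable_cst.
apply: filterS (ae_fock_fun_finite_chaos N 0 Lv) => w ->.
by rewrite conjc1 mul1r.
Qed.

Lemma ito_identity : exists P : T -> \bar R, [/\ measurable_fun setT P, (forall r, (0 <= P r)%E),
  ((hn2 (X - Y))%:E = \int[leb01 R]_r P r)%E &
  \forall r \ae leb01 R, P r =
    (hn2 (\sum_(k < n) ((\1_`[t k, t k.+1[ r)%:C)%C *: x k - cutoff r (D r)))%:E].
Proof.
(* The isometry lives on the whole half-line. The truncation at 1 matches the cutoff of G at time 1
   and makes [y] vanish afterwards, so that the integral reduces to [0, 1]. *)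
pose y (r : T) : fock := \sum_(k < n) z k r *: x k - (nat_of_bool ((r : R) <= 1)%R)%:R *: cutoff r (D r).
have [|||P [mP P0 PI Py]] := @ito_fock_isometry R W (X - Y) y LW aW hW.
- have /ae_fockP/(_ 0%N) H := ae_fock_funB X Y.
  apply: filterS3 H (ae_X 0) (ae_Y 0) => u -> -> ->.
  rewrite big1 => [|k _]; last exact: creation_fun0.
  rewrite (hdot_Om_G u) chaos_fun_tuple mulr1 (_ : upto 1 (of_tuple u)) ?mul1r ?subrr ?subr0//.
  by rewrite (tuple0 u).
- move=> m; have /ae_fockP/(_ m.+1) H := ae_fock_funB X Y.
  have := antisymmetrize_headmax (@lebRp_atomless R) (Lf m).2.
  apply: filterS3 H (filterI (ae_X m.+1) (ae_Y m.+1)) => u -> [-> ->] fu.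
  rewrite /W antisymmetrizeZD fu chaos_fun_neq// mulr0 subr0 mulN1r addrC; congr (_ + _).
  by rewrite /A antisymmetrize_sum; apply: eq_bigr => k _; rewrite creation_funE.
- have Lvs : \forall r \ae lebRp R, forall m, Lambda (lebRp R) (fun s : m.-tuple T => v m.+1 (tcons (r, s))).
    by apply: ae_foralln => m; exact: Lambda_slice.
  apply: filterS2 Lvs DE => r Lvr Dr m.
  have /ae_fockP/(_ m) H1 := ae_fock_funB (\sum_(k < n) z k r *: x k) ((nat_of_bool ((r : R) <= 1)%R)%:R *: cutoff r (D r)).
  have /ae_fockP/(_ m) H2 := ae_fock_fun_sum (fun k : 'I_n => z k r *: x k).
  have H3 : \forall u \ae lam m, forall k : 'I_n, fock_fun (z k r *: x k) (of_tuple u) = z k r * @xl k m u.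
    apply: filter_forall => k; have /ae_fockP/(_ m) := ae_fock_funZ (z k r) (x k).
    by apply.
  have /ae_fockP/(_ m) H4 := ae_fock_funZ (nat_of_bool ((r : R) <= 1)%R)%:R (cutoff r (D r)).
  have /ae_fockP/(_ m) H5 := ae_cutoff r (D r).
  have H6 := ae_fock_fun_derivative N m Lvr.
  apply: filterS3 (filterI H1 H2) (filterI H3 H4) (filterI H5 H6) => u [-> ->] [e3 ->] [-> e6].
  rewrite Dr e6 (eq_bigr _ (fun k _ => e3 k)) /W /A /B /f mulN1r addrC; congr (- _ + _).
    rewrite headmax_upto upto_tcons thead_tcons tbehead_tcons.
    have [ru|_] := boolP (upto r _); last by rewrite /= !mul0r !mulr0.
    have [r1|_] := boolP (r <= 1)%R; last by rewrite /= !mul0r !mulr0.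
    have u1 : upto 1 (of_tuple u) by apply: sub_all ru => q /= /le_trans; apply.
    by rewrite u1 /= !mul1r.
(* Simple processes use [t_k, t_{k+1}[ while the increments of Psi give ]t_k, t_{k+1}]; the two
   differ at the grid points only. *)
have H1 : \forall r \ae lebRp R, forall k : nat, r != t k :> R.
  apply: ae_foralln => k; exists [set t k : T]; split => //; first exact: lebRp_atomless.
  by move=> r /= /negP; rewrite negbK => /eqP.
have tmono k : (k <= n)%N -> t k <= 1.
  by move=> kn; apply: le_trans t1; exact: (nat_monotone tS kn).
exists P; split => //.
- rewrite PI; apply: integral_lebRp_leb01 => //; apply: filterS Py => r -> r1.
  rewrite (_ : y r = 0) ?hn20// /y leNgt r1 scale0r subr0 big1// => k _.
  rewrite /z /itv_ind [_ <= t k.+1]leNgt (le_lt_trans (tmono k.+1 _) r1)// andbF scale0r//.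
- apply: filterS3 (ae_leb01 Py) (ae_leb01 H1) (ae_leb01_itv R) => r -> rt /andP[_ r1].
  congr ((hn2 _)%:E); rewrite /y r1 scale1r; congr (_ - _); apply: eq_bigr => k _.
  congr (_ *: _); rewrite indicE mem_setE in_itv/= rmorph_nat /z /itv_ind; congr ((nat_of_bool _)%:R).
  have e1 : (t k < (r : R)) = (t k <= r) by rewrite lt_neqAle eq_sym (rt k).
  have e2 : ((r : R) < t k.+1) = (r <= t k.+1) by rewrite lt_neqAle (rt k.+1).
  by rewrite e1 e2.
Qed.

End identity.

End ito_identity.

(** * Simple stochastic integrals *)

(** After clamping the grid to [a, b], the terms outside the interval become 0 and the full sum
    telescopes; as [a] and [b] are grid points, no cell straddles an end of the interval. *)
Lemma telescope_clamp (R : realType) (V : zmodType) (phi : R -> V) (s : nat -> R) n (a b : R) :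
  (forall k, (k < n)%N -> s k <= s k.+1) -> a <= b ->
  (exists2 i, (i <= n)%N & s i = a) -> (exists2 j, (j <= n)%N & s j = b) ->
  \sum_(k < n | a <= s k < b) (phi (s k.+1) - phi (s k)) = phi b - phi a.
Proof.
move=> sS ab [i iN si] [j jN sj]; have smono := nat_monotone sS.
pose c x := Num.min (Num.max x a) b.
have clo x : x <= a -> c x = a by move=> xa; rewrite /c max_r// min_l.
have chi x : b <= x -> c x = b.
  by move=> bx; rewrite /c max_l ?(le_trans ab)// min_r.
have cmid x : a <= x -> x <= b -> c x = x by move=> ax xb; rewrite /c max_l// min_l.
rewrite big_mkcond/= (eq_bigr (fun k : 'I_n => phi (c (s k.+1)) - phi (c (s k)))) => [|k _].
  rewrite -(big_mkord xpredT (fun k => phi (c (s k.+1)) - phi (c (s k)))) telescope_sumr//.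
  rewrite chi ?clo//; first by rewrite -si smono.
  by rewrite -sj smono.
have kn := ltn_ord k.
have [ak|ka] := leP a (s k); last first.
  have ki : (k < i)%N.
    by rewrite ltnNge; apply/negP => ik; move: ka; rewrite -si ltNge smono// ltnW.
  by rewrite !clo ?subrr ?(ltW ka)// -si smono.
have [kb|bk] := ltP (s k) b; last first.
  by rewrite !chi ?subrr//; exact: le_trans bk (sS k kn).
have kj : (k < j)%N.
  by rewrite ltnNge; apply/negP => jk; move: kb; rewrite -sj ltNge smono// ltnW.
rewrite !cmid ?(ltW kb)//; first exact: le_trans ak (sS k kn).
by rewrite -sj smono.
Qed.

Section ito_range.
Variable R : realType.
Local Notation C := R[i].
Local Notation T := (measurableTypeR R).
Local Notation lam := (tuple_measure (lebRp R)).
Local Notation fock := (fock R).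
Local Notation Om := (vacuum R).
Implicit Types (p : R * R * fock) (l : seq (R * R * fock)).

Lemma bounded_opZ (u : op R) (a : C) (x : fock) : bounded_op u -> u (a *: x) = a *: u x.
Proof.
move=> bu; have u0 : u 0 = 0 by have := bounded_opB 0 0 bu; rewrite !subrr.
by have := bounded_op_linear a x 0 bu; rewrite u0 !addr0.
Qed.

Definition elementary p : Prop :=
  [/\ 0 <= p.1.1, p.1.1 <= p.1.2, p.1.2 <= 1 & upto_space p.1.1 p.2].

Definition elementary_sum l : fock := \sum_(p <- l) creation (itv_ind p.1.1 p.1.2) p.2.

(** Each term has its own interval, so that linear combinations are mere concatenations of lists; a
    common partition is produced only in [simple_ito_merge]. *)
Definition ito_range : set fock :=
  [set y | exists l, (forall p, p \in l -> elementary p) /\ y = elementary_sum l].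

Lemma lin_subspace_ito_range : @lin_subspace R fock ito_range.
Proof.
split; first by exists [::]; rewrite /elementary_sum big_nil.
move=> a _ _ [l [lP ->]] [l' [lP' ->]].
exists ([seq (p.1, a *: p.2) | p <- l] ++ l'); split.
  move=> p; rewrite mem_cat => /orP[/mapP[q ql ->]|]; last exact: lP'.
  have [q0 q1 q2 q3] := lP q ql; split => //=.
  exact: lin_subspaceZ (lin_subspace_upto_space _) q3.
rewrite /elementary_sum big_cat/= big_map scaler_sumr; congr (_ + _); apply: eq_bigr => p _ /=.
exact/esym/bounded_opZ/creation_bounded.
Qed.

Lemma ito_range_upto y : ito_range y -> upto_space 1 y.
Proof.
move=> [l [lP ->]]; rewrite /elementary_sum big_seq.
apply: (@lin_subspace_sum R fock); first exact: lin_subspace_upto_space.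
move=> p /lP[p0 p1 p2 p3]; rewrite /upto_space/= cutoff_creation.
- by rewrite (upto_space_le (le_trans p1 p2) p3).
- exact: L2fun_itv.
- apply: nearW => s s1; rewrite /itv_ind [_ <= p.1.2]leNgt (le_lt_trans p2 s1) andbF//.
Qed.

Lemma ito_range_vacuum y : ito_range y -> hdot Om y = 0.
Proof.
move=> [l [lP ->]]; rewrite /elementary_sum hdot_sumr big_seq big1// => p /lP[p0 p1 p2 p3].
apply: (hdot_creation_above (t := p.1.1)); [exact: L2fun_itv| |exact: vacuum_upto].
by move=> s; exact: itv_ind_below.
Qed.

(** The residue [d] of the projection onto the simple integrals again lives up to time 1 and is
    orthogonal to the vacuum, which kills its level 0. Each level n+1 vanishes by [headmax_total],
    whose test kernels are exactly the elementary integrals. *)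
Lemma ito_total y : upto_space 1 y -> hdot Om y = 0 -> @hclosure R fock ito_range y.
Proof.
move=> y1 y0; have [p [pC pO]] := orthogonal_projection y lin_subspace_ito_range.
set d := y - p in pO.
have p1 : upto_space 1 p.
  apply: hclosure_upto_space; apply: hclosure_sub pC => q /ito_range_upto.
  exact: sub_hclosure.
have p0 : hdot Om p = 0 by apply: hclosure_ortho pC => q; exact: ito_range_vacuum.
have d1 : upto_space 1 d by apply: lin_subspaceB => //; exact: lin_subspace_upto_space.
suff d0 : d = 0 by move: d0; rewrite /d => /eqP; rewrite subr_eq0 => /eqP ->.
have lev n : \forall u \ae lam n, fock_fun d (of_tuple u) = 0.
  case: n => [|n].
    have Ld := Lambda_fock_fun d 0.
    have : hdot (chaos (fun u : 0.-tuple T => fock_fun d (of_tuple u))) d = 0.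
      have -> : chaos (fun u : 0.-tuple T => fock_fun d (of_tuple u)) =
          fock_fun d (of_tuple [tuple]) *: Om.
        rewrite -[RHS]addr0 -[X in _ = _ + X](chaos0 R 0) /vacuum -chaosZD; last 2 first.
        - exact: Lambda_cst.
        - exact: Lambda_cst.
        by congr chaos; apply/funext => u; rewrite mulr1 addr0 (tuple0 u).
      by rewrite hdotZl hdotBr y0 p0 subrr mulr0.
    rewrite hdot_chaos// fact0 mul1r ldotxx; last exact: Ld.1.
    move=> /(congr1 (@complex.Re R))/= n0; apply: L2norm2_eq0; first exact: Ld.1.1.
    by rewrite -[LHS]fineK ?n0//; exact: L2norm2_fin Ld.1.
  have Lg : Lambda (lebRp R) (fun u : n.+1.-tuple T => fock_fun d (of_tuple u)) := Lambda_fock_fun d n.+1.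
  have /upto_spaceP/ae_fockP/(_ n.+1) dn := d1.
  have H := headmax_total (@lebRp_atomless R) (@lebRp_neg R) (@lebRp_fin R) (T0 := 1) Lg.
  have : \forall u \ae lam n.+1, below 1 u -> fock_fun d (of_tuple u) = 0.
    apply: H => a b a0 ab b1 h Lh ha.
    have ha' : upto_space a (chaos h).
      rewrite /upto_space/= (cutoff_chaos a Lh); congr chaos; apply/funext => u.
      have [->|/ha/upto_tuple ->] := eqVneq (h u) 0; first by rewrite mulr0.
      by rewrite mul1r.
    have LA := Lambda_antisymmetrize (L2fun_tensor (L2fun_itv a b) Lh.1).
    have : hdot (chaos (antisymmetrize (tensor (itv_ind a b) h))) d = 0.
      apply: pO; exists [:: (a, b, chaos h)]; split.
        by move=> q; rewrite inE => /eqP ->; split.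
      by rewrite /elementary_sum big_seq1/= (creation_chaos (L2fun_itv a b) Lh).
    rewrite hdot_chaos// => /eqP; rewrite mulf_eq0 pnatr_eq0 gtn_eqF ?fact_gt0//=.
    by move=> /eqP.
  apply: filterS2 dn => u du bu.
  by have [/upto_tuple/bu//|/du] := boolP (upto 1 (of_tuple u)).
have dz : \forall s \ae (fock_measure R), fock_fun d s = 0 by apply/ae_fockP; exact: lev.
by apply/fock_funP; apply: filterS2 dz (ae_fock_fun0 R) => s -> ->.
Qed.

End ito_range.

Section simple_integrals.
Variables (R : realType) (L2C : hilbertType R) (iota : op R -> L2C).
Hypothesis HL2C : is_L2_clifford iota.
Local Notation C := R[i].
Local Notation T := (measurableTypeR R).
Local Notation fock := (fock R).
Local Notation Om := (vacuum R).
Local Notation V := (to_fock HL2C).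
Local Notation W := (of_fock HL2C).

Lemma Psi_upto_clifford (t : R) : clifford (Psi_upto t).
Proof.
by apply: sub_vN_generated; exists (fun s => ((\1_`[0, t] s)%:C)%C) => //; exact: cmeasurable_indc.
Qed.

Lemma to_fock_lmul (a b : R) x :
  V (L2_lmul iota (Psi_upto b - Psi_upto a) x) = (Psi_upto b - Psi_upto a) (V x).
Proof.
rewrite (L2_lmulE HL2C) ?of_fockK//.
rewrite addrC -scaleN1r; apply: cliffordZD; exact: Psi_upto_clifford.
Qed.

Lemma op_subE (u v : op R) (x : fock) : (u - v) x = u x - v x.
Proof. by []. Qed.

Lemma simple_ito_merge (l : seq (R * R * fock)) : (forall p, p \in l -> elementary p) ->
  exists h I, simple_ito iota (h, I) /\ V I = elementary_sum l.
Proof.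
move=> lP; pose e := sort <=%R ([seq p.1.1 | p <- l] ++ [seq p.1.2 | p <- l]).
pose n := (size e).-1; pose t k := nth 0 e k.
have e01 r : r \in e -> 0 <= r <= 1.
  rewrite mem_sort mem_cat => /orP[] /mapP[p /lP[p0 p1 p2 _] ->].
    by rewrite p0 (le_trans p1).
  by rewrite p2 (le_trans p0).
have t01 k : 0 <= t k <= 1.
  have [kn|nk] := ltnP k (size e); first by apply: e01; rewrite mem_nth.
  by rewrite /t nth_default// lexx ler01.
have se : sorted <=%R e by apply: sort_sorted; exact: le_total.
have tS k : (k < n)%N -> t k <= t k.+1.
  move=> kn; have kn' : (k.+1 < size e)%N by move: kn; rewrite /n; case: (size e).
  by apply: (sorted_leq_nth le_trans le_refl 0 se) => //; rewrite inE ?(ltnW kn').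
have te r : r \in e -> exists2 i, (i <= n)%N & t i = r.
  move=> re; exists (index r e); last by rewrite /t nth_index.
  by move: re; rewrite -index_mem /n; case: (size e).
(* The grid consists of all endpoints, sorted. On a cell the process collects the terms whose
   interval contains the left end [t k]; they live up to [p.1.1 <= t k], so [h] is adapted. *)
pose h k : L2C := \sum_(p <- l | p.1.1 <= t k < p.1.2) W p.2.
have Vh k : V (h k) = \sum_(p <- l | p.1.1 <= t k < p.1.2) p.2.
  by rewrite to_fock_sum; apply: eq_bigr => p _; rewrite of_fockK.
exists (fun s => \sum_(k < n) (\1_`[t k, t k.+1[ s)%:C%C *: h k),
  (\sum_(k < n) L2_lmul iota (Psi_upto (t k.+1) - Psi_upto (t k)) (h k)); split.
  exists n, t, h; split => //.
  - by have /andP[] := t01 0%N.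
  - by have /andP[] := t01 n.
  - move=> k kn; have /andP[k0 _] := t01 k; apply/(L2_uptoE HL2C _ k0); rewrite Vh big_seq_cond.
    apply: (@lin_subspace_sum R fock); first exact: lin_subspace_upto_space.
    by move=> p /andP[/lP[_ _ _ p3] /andP[pk _]]; exact: upto_space_le p3.
rewrite to_fock_sum (eq_bigr (fun k : 'I_n => \sum_(p <- l | p.1.1 <= t k < p.1.2)
    (Psi_upto (t k.+1) p.2 - Psi_upto (t k) p.2))); last first.
  move=> k _; rewrite to_fock_lmul Vh op_subE.
  have lin_sum (r : R) : Psi_upto r (\sum_(p <- l | p.1.1 <= t k < p.1.2) p.2) =
      \sum_(p <- l | p.1.1 <= t k < p.1.2) Psi_upto r p.2.
    have br := clifford_bounded (Psi_upto_clifford r).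
    apply: (big_morph (Psi_upto r)) => [x y|].
      by have := bounded_op_linear 1 x y br; rewrite !scale1r.
    by have := bounded_opB 0 0 br; rewrite !subrr.
  by rewrite !lin_sum sumrB.
rewrite (exchange_big_dep xpredT)//= /elementary_sum big_seq [RHS]big_seq; apply: eq_bigr => p pl.
have [p0 p1 p2 p3] := lP p pl.
rewrite (telescope_clamp (fun r => Psi_upto r p.2) tS p1).
- by rewrite -op_subE (Psi_upto_incr p0 p1 p3).
- by apply: te; rewrite mem_sort mem_cat; apply/orP; left; apply/mapP; exists p.
- by apply: te; rewrite mem_sort mem_cat; apply/orP; right; apply/mapP; exists p.
Qed.

End simple_integrals.

(** * Processes and the Clark-Ocone formula *)

Section processes.
Variables (R : realType) (H : hilbertType R).
Local Notation T := (measurableTypeR R).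
Implicit Types (s u v w : T -> H).

Lemma simple_process0 : simple_process (fun _ : T => 0 : H).
Proof.
exists 0%N, (fun=> set0), (fun=> 0); split; first by case.
by apply/funext => t; rewrite big_ord0.
Qed.

Lemma simple_processD s s' : simple_process s -> simple_process s' ->
  simple_process (fun t => s t + s' t).
Proof.
move=> [n [A [x [mA ->]]]] [m [B [y [mB ->]]]].
exists (n + m)%N,
  (fun i => match fintype.split i with inl j => A j | inr j => B j end),
  (fun i => match fintype.split i with inl j => x j | inr j => y j end); split.
  by move=> i; case: (fintype.split i).
apply/funext => t; rewrite big_split_ord/=; congr (_ + _); apply: eq_bigr => i _.
  by rewrite (unsplitK (inl i : 'I_n + 'I_m)).
by rewrite (unsplitK (inr i : 'I_n + 'I_m)).
Qed.

Lemma simple_process_sum m (s : 'I_m -> T -> H) : (forall i, simple_process (s i)) ->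
  simple_process (fun t => \sum_(i < m) s i t).
Proof.
elim: m s => [|m ih] s sS.
  rewrite (_ : (fun t => _) = (fun=> 0)); first exact: simple_process0.
  by apply/funext => t; rewrite big_ord0.
rewrite (_ : (fun t => _) = (fun t => s ord0 t + \sum_(i < m) s (lift ord0 i) t)).
  by apply: simple_processD => //; exact: ih.
by apply/funext => t; rewrite big_ord_recl.
Qed.

Lemma simple_process_map (L : H -> H) (B : set T) s : (forall a x y, L (a *: x + y) = a *: L x + L y) ->
  measurable B -> simple_process s -> simple_process (fun t => (\1_B t)%:C%C *: L (s t)).
Proof.
move=> LZD mB [n [A [x [mA ->]]]].
have L0 : L 0 = 0 by have := LZD (-1) 0 0; rewrite scaler0 addr0 scaleN1r addNr.
have LD y z : L (y + z) = L y + L z by have := LZD 1 y z; rewrite !scale1r.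
have LZ a y : L (a *: y) = a *: L y by have := LZD a y 0; rewrite L0 !addr0.
exists n, (fun i => B `&` A i), (L \o x); split; first by move=> i; exact: measurableI.
apply/funext => t; rewrite (big_morph L LD L0) scaler_sumr; apply: eq_bigr => i _.
by rewrite LZ scalerA indicI /= rmorphM.
Qed.

Lemma simple_processZ (a : R[i]) s : simple_process s -> simple_process (fun t => a *: s t).
Proof.
have LZD b (x y : H) : a *: (b *: x + y) = b *: (a *: x) + a *: y.
  by rewrite scalerDr !scalerA mulrC.
move=> /(simple_process_map LZD measurableT); congr simple_process.
by apply/funext => t; rewrite indicT scale1r.
Qed.

Lemma measurable_hn2_simple s : simple_process s -> measurable_fun setT (fun t => hn2 (s t)).
Proof.
move=> [n [A [x [mA ->]]]].
rewrite (_ : (fun t => _) = (fun t => \sum_(i < n) \sum_(j < n)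
    \1_(A j) t * (\1_(A i) t * complex.Re (hdot (x j) (x i))))); last first.
  apply/funext => t; rewrite hn2_hdot hdot_sumr cRe_sum; apply: eq_bigr => i _.
  rewrite hdotC hdot_sumr cRe_conj cRe_sum; apply: eq_bigr => j _.
  by rewrite hdotZr hdotZl cReMl conjc_real cReMl hdotC cRe_conj.
apply: measurable_sum => i; apply: measurable_sum => j.
by apply: measurable_funM => //; apply: measurable_funM.
Qed.

Variable mu : {measure set T -> \bar R}.
Local Notation sm := (strongly_measurable mu).
Local Notation pn := (process_norm2 mu).

Lemma simple_strongly_measurable s : simple_process s -> sm s.
Proof.
move=> sS; exists (fun=> s); split => //; apply: nearW => t.
by rewrite subrr hnorm0; exact: cvg_cst.
Qed.

Lemma ae_eq_strongly_measurable u v : (\forall t \ae mu, u t = v t) -> sm u -> sm v.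
Proof.
move=> uv [s [sS su]]; exists s; split => //.
by apply: filterS2 uv su => t ->.
Qed.

Lemma strongly_measurableZD (a : R[i]) u v : sm u -> sm v -> sm (fun t => a *: u t + v t).
Proof.
move=> [s [sS su]] [s' [s'S s'v]]; exists (fun k t => a *: s k t + s' k t); split.
  by move=> k; apply: simple_processD => //; exact: simple_processZ.
apply: filterS2 su s'v => t su s'v.
apply: (@squeeze0 R _ (fun k => Num.sqrt (abs2 a) * hnorm (s k t - u t) + hnorm (s' k t - v t))).
  move=> k; rewrite hnorm_ge0/= opprD addrACA -scalerBr.
  by apply: le_trans (hnorm_triangle _ _) _; rewrite hnormZ.
rewrite -[X in _ --> X]addr0 -[X in _ --> X + _](mulr0 (Num.sqrt (abs2 a))).
by apply: cvgD => //; exact: cvgMr.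
Qed.

Lemma strongly_measurableB u v : sm u -> sm v -> sm (fun t => u t - v t).
Proof.
move=> mu_ mv; apply: ae_eq_strongly_measurable (strongly_measurableZD (-1) mv mu_).
by apply: nearW => t; rewrite scaleN1r addrC.
Qed.

(** The squared norm of [u] is only an almost everywhere limit of measurable functions. The upper
    limit is measurable, and the absolute value makes it nonnegative also on the exceptional set. *)
Lemma strongly_measurable_hnorm2 u : sm u -> exists f : T -> \bar R,
  [/\ measurable_fun setT f, (forall t, (0 <= f t)%E) &
      \forall t \ae mu, (hnorm (u t) ^+ 2)%:E = f t].
Proof.
move=> [s [sS su]]; exists (fun t => `|limn_esup (fun k => (hn2 (s k t))%:E)|%E); split.
- apply: measurableT_comp => //; apply: measurable_fun_limn_esup => k.
  by apply/measurable_EFinP; exact: measurable_hn2_simple.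
- by move=> t; exact: abse_ge0.
apply: filterS su => t su.
have sn : hnorm (s k t) @[k --> \oo] --> hnorm (u t).
  apply/cvgrPdist_lt => e e0; move/cvgrPdist_lt: su => /(_ e e0); apply: filterS => k.
  rewrite sub0r normrN ger0_norm ?hnorm_ge0// => sk; apply: le_lt_trans sk.
  rewrite ler_norml; apply/andP; split.
    by rewrite lerBrDl lerBlDr; have := hnorm_triangle (s k t - u t) (u t); rewrite subrK addrC.
  by rewrite lerBlDr hdistC; have := hnorm_triangle (u t - s k t) (s k t); rewrite subrK.
have : (fun k => (hn2 (s k t))%:E) @ \oo --> (hnorm (u t) ^+ 2)%:E.
  apply: cvg_EFin; first exact: nearW.
  rewrite (_ : _ \o _ = (fun k => hnorm (s k t) * hnorm (s k t))).
    by rewrite expr2; exact: cvgM.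
  by apply/funext => k /=; rewrite -expr2 sqr_hnorm.
by move=> /cvg_limn_einf_sup[_ ->]; rewrite gee0_abs// lee_fin sqr_ge0.
Qed.

Lemma process_norm2_ge0 u : (0 <= pn u)%E.
Proof. by apply: integral_ge0 => t _; rewrite lee_fin sqr_ge0. Qed.

Lemma ae_eq_process_norm2 u f : (forall t, (0 <= f t)%E) ->
  (\forall t \ae mu, (hnorm (u t) ^+ 2)%:E = f t) -> pn u = (\int[mu]_t f t)%E.
Proof.
move=> f0; apply: ae_eq_lower_integral => // t.
by rewrite lee_fin sqr_ge0.
Qed.

Lemma ae_le_process_norm2 u v : (\forall t \ae mu, hnorm (u t) <= hnorm (v t)) -> (pn u <= pn v)%E.
Proof.
move=> uv; apply: ae_le_lower_integral => [t|t|]; rewrite ?lee_fin ?sqr_ge0//.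
by apply: filterS uv => t uv; rewrite lee_fin lerXn2r// nnegrE hnorm_ge0.
Qed.

Lemma process_norm2_distC u v : pn (u - v) = pn (v - u).
Proof. by apply: eq_integral => t _; rewrite [hnorm _]hdistC. Qed.

(** A triangle inequality for squared norms; additivity of the integral is applied to the measurable
    versions of the squared norms. *)
Lemma process_norm2_dist v u w : sm u -> sm v -> sm w ->
  (pn (u - w)%R <= 2%:E * pn (u - v)%R + 2%:E * pn (v - w)%R)%E.
Proof.
move=> mu_ mv mw.
have [f [mf f0 fE]] := strongly_measurable_hnorm2 (strongly_measurableB mu_ mv).
have [g [mg g0 gE]] := strongly_measurable_hnorm2 (strongly_measurableB mv mw).
rewrite (@ae_eq_process_norm2 (u - v) f)// (@ae_eq_process_norm2 (v - w) g)//.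
rewrite -!ge0_integralZl//.
have f20 t : (0 <= 2%:E * f t)%E by rewrite mule_ge0.
have g20 t : (0 <= 2%:E * g t)%E by rewrite mule_ge0.
rewrite -ge0_integralD//; try exact: measurable_funeM.
apply: ae_le_lower_integral => [t|t|].
- by rewrite lee_fin sqr_ge0.
- by rewrite adde_ge0.
apply: filterS2 fE gE => t <- <-; rewrite -!EFinM -EFinD lee_fin !sqr_hnorm.
rewrite (_ : (u - w) t = (u t - v t) + (v t - w t)); first exact: hn2D_le.
by rewrite addrA subrK.
Qed.

End processes.

Section processes_unit_interval.
Variables (R : realType) (H : hilbertType R).
Local Notation T := (measurableTypeR R).
Implicit Types u : T -> H.

Lemma strongly_measurable_leb01 u : strongly_measurable (lebRp R) u -> strongly_measurable (leb01 R) u.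
Proof. by move=> [s [sS su]]; exists s; split => //; exact: ae_leb01. Qed.

Lemma process_norm2_leb01 u : strongly_measurable (lebRp R) u ->
  (process_norm2 (leb01 R) u <= process_norm2 (lebRp R) u)%E.
Proof.
move=> /strongly_measurable_hnorm2[f [mf f0 fE]].
rewrite (ae_eq_process_norm2 f0 fE) (ae_eq_process_norm2 f0 (ae_leb01 fE)).
exact: integral_leb01_le.
Qed.

End processes_unit_interval.

Lemma ereal_cvg0_lt (R : realType) (u : nat -> \bar R) (e : R) : u k @[k --> \oo] --> 0%E -> 0 < e ->
  \forall k \near \oo, (u k < e%:E)%E.
Proof.
move=> /fine_cvgP[uf /cvgrPdist_lt/(_ e) u0] e0; have {u0}u0 := u0 e0.
apply: filterS2 uf u0 => k uk; rewrite sub0r normrN /= => ue.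
by rewrite -(fineK uk) lte_fin (le_lt_trans (ler_norm _)).
Qed.

Lemma ereal_squeeze0 (R : realType) (u v : nat -> \bar R) : (forall k, 0 <= u k <= v k)%E ->
  v k @[k --> \oo] --> 0%E -> u k @[k --> \oo] --> 0%E.
Proof.
move=> uv; apply: squeeze_cvge (cvg_cst _).
by apply: nearW => k; exact: uv.
Qed.

Lemma subrACA (U : zmodType) (a b c d : U) : a - b - (c - d) = a - c - (b - d).
Proof. by rewrite !opprD !opprK addrACA. Qed.

Section clark_ocone.
Variables (R : realType) (L2C : hilbertType R) (iota : op R -> L2C).
Hypothesis HL2C : is_L2_clifford iota.
Local Notation C := R[i].
Local Notation T := (measurableTypeR R).
Local Notation fock := (fock R).
Local Notation Om := (vacuum R).
Local Notation V := (to_fock HL2C).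
Local Notation W := (of_fock HL2C).
Implicit Types (D : T -> L2C) (F : L2C).

Definition adapted_part D (t : T) : L2C := W (cutoff t (V (D t))).

Lemma of_fock_cutoffB (t : R) x y : W (cutoff t (V x)) - W (cutoff t (V y)) = W (cutoff t (V (x - y))).
Proof. by rewrite -of_fockB -(bounded_opB _ _ (cutoff_bounded t)) -to_fockB. Qed.

Lemma hnorm_of_fock_cutoff (t : R) x : hnorm (W (cutoff t (V x))) <= hnorm x.
Proof. by rewrite hnorm_of_fock -[X in _ <= X](hnorm_to_fock HL2C); exact: hnorm_cutoff. Qed.

Lemma of_fock_cutoffZD (t : R) (a : C) x y :
  W (cutoff t (V (a *: x + y))) = a *: W (cutoff t (V x)) + W (cutoff t (V y)).
Proof. by apply: (to_fock_inj (HL2C := HL2C)); rewrite [RHS]to_fockZD !of_fockK to_fockZD cutoffZD. Qed.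

(* The cutoff at time [t] is replaced by the cutoff at the next point of the
   grid of mesh [1/(k+1)]; the error vanishes since the filtration is right
   continuous. *)
Lemma strongly_measurable_adapted_part D : strongly_measurable (leb01 R) D ->
  strongly_measurable (leb01 R) (adapted_part D).
Proof.
move=> [s [sS sD]].
pose g k j : R := j%:R / k.+1%:R.
(* One cell beyond k+1 is included because cells are open on the right, so that the point t = 1
   falls into the cell j = k+1. *)
pose q k t := \sum_(j < k.+2) (\1_`[g k j, g k j.+1[ t)%:C%C *: W (cutoff (g k j.+1) (V (s k t))).
exists q; split.
  move=> k; apply: simple_process_sum => j.
  apply: (simple_process_map (L := fun x => W (cutoff (g k j.+1) (V x)))) => //.
  exact: of_fock_cutoffZD.
have FF := ae_filter_ringOfSetsType (leb01 R).
apply: filterS2 (ae_leb01_itv R) sD => t /andP[t0 t1] st.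
pose m k := Num.truncn ((t : R) * k.+1%:R).
have tk0 k : 0 <= t * k.+1%:R by rewrite mulr_ge0.
have mlt k : (m k < k.+2)%N.
  rewrite ltnS -(ler_nat R); apply: le_trans (_ : t * k.+1%:R <= _).
    by rewrite truncn_le.
  by rewrite -[X in _ <= X]mul1r ler_wpM2r.
have gm k j : (g k j <= t < g k j.+1) = (j == m k).
  by rewrite /g ler_pdivrMr// ltr_pdivlMr// -truncn_eq// eq_sym.
have qE k : q k t = W (cutoff (g k (m k).+1) (V (s k t))).
  rewrite /q (bigD1 (Ordinal (mlt k)))//= big1 ?addr0.
    by rewrite indicE mem_set ?scale1r//= in_itv/= gm eqxx.
  move=> j jm; rewrite indicE memNset ?scale0r//= in_itv/= gm => /eqP jE.
  by move/eqP: jm; apply; exact: val_inj.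
have gt k : t < g k (m k).+1 by have := gm k (m k); rewrite eqxx => /andP[].
have gle k : g k (m k).+1 <= t + k.+1%:R^-1.
  have := gm k (m k); rewrite eqxx => /andP[h _].
  by rewrite /g -[X in X%:R / _]addn1 natrD mulrDl div1r lerD2r.
apply: (@squeeze0 R _ (fun k => hnorm (s k t - D t) +
    hnorm (cutoff (g k (m k).+1) (V (D t)) - cutoff t (V (D t))))).
  move=> k; rewrite hnorm_ge0/= qE /adapted_part.
  apply: le_trans (hdistD (W (cutoff (g k (m k).+1) (V (D t)))) _ _) _; apply: lerD.
    by rewrite of_fock_cutoffB; exact: hnorm_of_fock_cutoff.
  by rewrite -of_fockB hnorm_of_fock.
rewrite -[X in _ --> X]addr0; apply: cvgD => //.
apply: cutoff_cvg => [k|r tr]; first exact: ltW.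
have rt : 0 < r - t by rewrite subr_gt0.
have := near_infty_natSinv_lt (PosNum rt); apply: filterS => k /= kr.
by apply: le_lt_trans (gle k) _; rewrite -ltrBrDl.
Qed.

Lemma adapted_part_dist D D' t : hnorm (adapted_part D t - adapted_part D' t) <= hnorm (D t - D' t).
Proof. by rewrite of_fock_cutoffB; exact: hnorm_of_fock_cutoff. Qed.

Lemma to_fock_DJ n (f : n.-tuple T -> C) t : V (DJ iota f t) = dchaos f t.
Proof.
case: n f => [|n] f; first exact: to_fock0.
by rewrite /DJ /dchaos to_fockZ to_fock_J.
Qed.

(** For F in L^2 of C_1 this is the image of F - m(F). The cutoff is kept because the finite
    expansions approximating F need not live up to time 1. *)
Definition centered_part (x : fock) : fock := cutoff 1 x - hdot Om x *: Om.

Lemma centered_partB (x y : fock) : centered_part x - centered_part y = centered_part (x - y).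
Proof.
rewrite /centered_part (bounded_opB _ _ (cutoff_bounded 1)) hdotBr scalerBl.
exact: subrACA.
Qed.

Lemma hnorm_centered_part (x : fock) : hnorm (centered_part x) <= (1 + hnorm Om * hnorm Om) * hnorm x.
Proof.
rewrite /centered_part; apply: le_trans (hnorm_triangle _ _) _; rewrite hnorm_opp mulrDl mul1r.
apply: lerD; first exact: hnorm_cutoff.
rewrite hnormZ mulrAC ler_wpM2r ?hnorm_ge0//.
rewrite !hnormE -sqrtrM ?hn2_ge0// ler_wsqrtr//; exact: cauchy_schwarz.
Qed.

Lemma simple_ito_process p : simple_ito iota p -> simple_process p.1.
Proof.
move=> [n [t [h [_ _ _ _ ->]]]] /=.
by exists n, (fun k : 'I_n => `[t k, t k.+1[%classic), h.
Qed.

Lemma simple_ito_isometry p q : simple_ito iota p -> finite_chaos_D iota q ->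
  process_norm2 (leb01 R) (p.1 - adapted_part q.2) =
  (hn2 (V p.2 - centered_part (V q.1)))%:E.
Proof.
move=> [n [t [h [t0 tS t1 ht ->]]]] [N [v [Lv FE _ DE]]] /=.
have tk k : (k <= n)%N -> 0 <= t k.
  by move=> kn; apply: le_trans t0 _; exact: (nat_monotone tS).
have hV k : (k < n)%N -> upto_space (t k) (V (h k)).
  by move=> kn; apply/(L2_uptoE HL2C _ (tk k (ltnW kn))); exact: ht.
have VF : V q.1 = \sum_(k < N) chaos (v k).
  by rewrite FE to_fock_sum; apply: eq_bigr => k _; exact: to_fock_J.
have VI : V (\sum_(k < n) L2_lmul iota (Psi_upto (t k.+1) - Psi_upto (t k)) (h k)) =
    \sum_(k < n) creation (itv_ind (t k) (t k.+1)) (V (h k)).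
  rewrite to_fock_sum; apply: eq_bigr => k _; rewrite to_fock_lmul.
  by apply: Psi_upto_incr; [exact: tk (ltnW (ltn_ord k))|exact: tS|exact: hV].
have VD : \forall r \ae lebRp R, V (q.2 r) = \sum_(k < N) dchaos (v k) r.
  apply: filterS DE => r ->; rewrite to_fock_sum; apply: eq_bigr => k _; exact: to_fock_DJ.
have [P [mP P0 PI PE]] := ito_identity tS t1 hV Lv VD.
rewrite VI VF /centered_part PI; apply: ae_eq_process_norm2 => //.
apply: filterS PE => r ->; rewrite sqr_hnorm -(hn2_to_fock HL2C); congr (hn2 _)%:E.
rewrite [V _]to_fockB of_fockK to_fock_sum; congr (_ - _).
by apply: eq_bigr => k _; rewrite to_fockZ.
Qed.

Lemma hdot_vacuum : hdot Om Om = 1.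
Proof.
have L1 : Lambda (lebRp R) (fun _ : 0.-tuple T => 1 : C) by exact: Lambda_cst.
rewrite /vacuum hdot_chaos2// fact0 mul1r /ldot /cintegral /Rintegral /= !integral_dirac//.
by rewrite diracT !mul1e /= !(mulr0, mulr1, mul0r, oppr0, subr0, addr0).
Qed.

Lemma to_fock_idfun : V (iota idfun) = Om.
Proof. by rewrite to_fock_iota//; exact: vN_generated_id. Qed.

Section main.
Variables (F : L2C) (DF : T -> L2C).
Hypotheses (HF : D_graph iota (F, DF)) (HF1 : L2_upto iota 1 F).
Variable u : T -> L2C.
Hypothesis uE : \forall t \ae leb01 R, adapted_part DF t = u t.
Let y := F - L2_state iota F *: iota idfun.
Local Notation pn := (process_norm2 (leb01 R)).

Let Vy : V y = centered_part (V F).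
Proof.
have /(L2_uptoE HL2C _ ler01) F1 := HF1.
by rewrite /y to_fockB to_fockZ to_fock_idfun (L2_stateE HL2C) /centered_part F1.
Qed.

(** The finite expansions [g k] of the graph closure are a bridge: their adapted parts tend to [u]
    and their centered parts to [y]. By [simple_ito_isometry], a simple process is then near [u]
    exactly when its integral is near [y], which gives a limit and its uniqueness. *)
Lemma ito_integral_adapted_part : ito_integral iota u = y.
Proof.
have [[mDF _] [g [gG /EFin_cvg0 gF gD]]] := HF.
have mg k : strongly_measurable (lebRp R) (g k).2 by have [N [v [_ _ []]]] := gG k.
have mEg k : strongly_measurable (leb01 R) (adapted_part (g k).2).
  exact/strongly_measurable_adapted_part/strongly_measurable_leb01.
have mu_ : strongly_measurable (leb01 R) u.
  apply: ae_eq_strongly_measurable uE _.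
  exact/strongly_measurable_adapted_part/strongly_measurable_leb01.
have gu : pn (adapted_part (g k).2 - u) @[k --> \oo] --> 0%E.
  apply: ereal_squeeze0 gD => k; rewrite process_norm2_ge0/=.
  apply: (@le_trans _ _ (pn ((g k).2 - DF))).
    by apply: ae_le_process_norm2; apply: filterS uE => t ut; rewrite [(_ - u) t](_ : _ = adapted_part (g k).2 t - u t)// -ut; exact: adapted_part_dist.
  by apply: process_norm2_leb01; exact: strongly_measurableB.
have gy : hnorm (centered_part (V (g k).1) - V y) @[k --> \oo] --> 0.
  apply: (@squeeze0 R _ (fun k => (1 + hnorm Om * hnorm Om) * hnorm ((g k).1 - F))).
    move=> k; rewrite hnorm_ge0/= Vy centered_partB -to_fockB.
    by rewrite -[hnorm (_ - F)](hnorm_to_fock HL2C); exact: hnorm_centered_part.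
  by rewrite -(mulr0 (1 + hnorm Om * hnorm Om)); exact: cvgMr.
have y1 : upto_space 1 (V y).
  rewrite Vy /centered_part; apply: lin_subspaceB; first exact: lin_subspace_upto_space.
    exact: upto_space_cutoff.
  by apply: lin_subspaceZ; [exact: lin_subspace_upto_space|exact: vacuum_upto].
have y0 : hdot Om (V y) = 0.
  rewrite Vy /centered_part hdotBr hdotZr hdot_vacuum mulr1 -hdot_cutoff.
  by rewrite (vacuum_upto 1) subrr.
have approx (e : R) : 0 < e -> exists p, [/\ simple_ito iota p, (pn (p.1 - u)%R < e%:E)%E & hnorm (p.2 - y) < e].
  (* The squared distance to [u] is at most 2 (2d)^2 + 2d; since d <= 1 this is at most 10 d, below
     [e]. *)
  move=> e0; pose d := Num.min 1 (e / 12).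
  have d0 : 0 < d by rewrite lt_min ltr01 divr_gt0.
  have [z [[l [lP zE]] zy]] := ito_total y1 y0 d0.
  have [h [I [hI VI]]] := simple_ito_merge HL2C lP.
  exists (h, I); split => //=; last first.
    rewrite -(hnorm_to_fock HL2C) to_fockB VI -zE; apply: lt_le_trans zy _.
    by rewrite ge_min ler_pdivrMr// ler_peMr ?orbT//; [exact: ltW|rewrite ler1n].
  have [|k [ku ky]] := @filter_ex _ \oo _ (fun k => (pn (adapted_part (g k).2 - u)%R < d%:E)%E /\
      hnorm (centered_part (V (g k).1) - V y) < d).
    apply: filterI; first exact: ereal_cvg0_lt.
    by move/cvgrPdist_lt: gy => /(_ d d0); apply: filterS => k; rewrite sub0r normrN ger0_norm ?hnorm_ge0.
  apply: le_lt_trans (process_norm2_dist (v := adapted_part (g k).2) _ _ _) _ => //.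
    exact/simple_strongly_measurable/(simple_ito_process hI).
  rewrite (simple_ito_isometry hI (gG k)) /= VI -zE.
  have hd : hn2 (z - centered_part (V (g k).1)) <= 4 * d ^+ 2.
    rewrite -sqr_hnorm (_ : 4 * d ^+ 2 = (d + d) ^+ 2); last by ring.
    rewrite lerXn2r ?nnegrE ?hnorm_ge0 ?addr_ge0 ?ltW//.
    by apply: le_lt_trans (hdistD (V y) _ _) _; rewrite [hnorm (V y - _)]hdistC ltrD.
  apply: (@lt_le_trans _ _ ((2 * (4 * d ^+ 2))%:E + (2 * d)%:E)%E).
    rewrite -EFinM; apply: lee_ltD => //; first by rewrite lee_fin ler_wpM2l.
    by rewrite EFinM lte_pmul2l// lte_fin.
  rewrite -EFinD lee_fin.
  have d1 : d <= 1 by rewrite ge_min lexx.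
  have de : 12 * d <= e by rewrite mulrC -ler_pdivlMr// ge_min lexx orbT.
  have := ler_wpM2l (ltW d0) d1; rewrite mulr1 -expr2 => dd; lra.
apply: extendE.
  have /choice[f fP] : forall k : nat, exists p, [/\ simple_ito iota p,
      (pn (p.1 - u)%R < (k.+1%:R^-1)%:E)%E & hnorm (p.2 - y) < k.+1%:R^-1].
    by move=> k; apply: approx; rewrite invr_gt0.
  have i0 : (k.+1%:R^-1 : R)%:E @[k --> \oo] --> 0%E by apply/EFin_cvg0; exact: invS_cvg0.
  exists f; split => [k| |]; first by have [] := fP k.
    apply: ereal_squeeze0 i0 => k; rewrite process_norm2_ge0/=.
    by apply: ltW; have [] := fP k.
  apply: ereal_squeeze0 i0 => k; rewrite !lee_fin hnorm_ge0/=.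
  by apply: ltW; have [] := fP k.
move=> y' [f [/= fG fu /EFin_cvg0 fy]].
apply/eqP; rewrite -subr_eq0; apply/eqP/hnorm_eq0; apply: eps_eq0 => [e e0|]; last exact: hnorm_ge0.
pose d := e / 3; have d0 : 0 < d by rewrite divr_gt0.
(* Two squared distances below d^2/4, each doubled by [process_norm2_dist], add up to d^2; the
   isometry turns this into a distance [d] between the integrals. *)
have dd0 : 0 < d ^+ 2 / 4 by rewrite divr_gt0// exprn_gt0.
have [|k [[ku ky] [fku fky]]] := @filter_ex _ \oo _ (fun k =>
    ((pn (adapted_part (g k).2 - u)%R < (d ^+ 2 / 4)%:E)%E /\
      hnorm (centered_part (V (g k).1) - V y) < d) /\
    ((pn ((f k).1 - u)%R < (d ^+ 2 / 4)%:E)%E /\ hnorm ((f k).2 - y') < d)).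
  apply: filterI; apply: filterI; try exact: ereal_cvg0_lt.
    by move/cvgrPdist_lt: gy => /(_ d d0); apply: filterS => k; rewrite sub0r normrN ger0_norm ?hnorm_ge0.
  by move/cvgrPdist_lt: fy => /(_ d d0); apply: filterS => k; rewrite sub0r normrN ger0_norm ?hnorm_ge0.
have fz : hnorm (V (f k).2 - centered_part (V (g k).1)) < d.
  rewrite hnorm_lt// -lte_fin -(simple_ito_isometry (fG k) (gG k)).
  have ms := simple_strongly_measurable (leb01 R) (simple_ito_process (fG k)).
  apply: le_lt_trans (process_norm2_dist ms mu_ (mEg k)) _.
  rewrite [X in (_ + _ * X)%E]process_norm2_distC.
  rewrite (_ : (d ^+ 2)%:E = (2%:E * (d ^+ 2 / 4)%:E + 2%:E * (d ^+ 2 / 4)%:E)%E); last first.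
    by rewrite -EFinM -EFinD; congr EFin; field.
  by apply: lteD; rewrite lte_pmul2l.
apply: le_trans (hdistD (f k).2 _ _) _; rewrite [hnorm (y' - _)]hdistC.
rewrite -[hnorm ((f k).2 - y)](hnorm_to_fock HL2C) to_fockB.
have := hdistD (centered_part (V (g k).1)) (V (f k).2) (V y).
have eE : e = d + d + d by rewrite /d; field.
rewrite eE => h; apply: le_trans (lerD (lexx _) h) _.
by rewrite -[d + d + d]addrA; apply: lerD; [exact: ltW|apply: lerD; exact: ltW].
Qed.

End main.
End clark_ocone.

(* HF1: the noise is indexed by R_+ while the integral is over [0, 1], so F has to
   be measurable with respect to the algebra of time 1; without it the formula
   fails, for instance for F = Psi(1_[1, 2]), both terms on the right being 0. *)
Theorem theorem4p14 (R : realType) (L2C : hilbertType R) (iota : op R -> L2C)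
    (HL2C : is_L2_clifford iota)
    (E : R -> op R -> op R)
    (HE : forall t, 0 <= t -> conditional_expectation t (E t))
    (F : L2C) (DF : R -> L2C)
    (HF : D_graph iota (F, DF)) (HF1 : L2_upto iota 1 F) :
  let u t := L2_cond_exp iota (E t) (DF t) in
  adapted_L2_process iota u /\
  F = L2_state iota F *: iota idfun + ito_integral iota u.
Proof.
move=> u; have FF := ae_filter_ringOfSetsType (leb01 R).
have [[mDF DFoo] _] := HF.
have mv : strongly_measurable (leb01 R) (adapted_part HL2C DF).
  exact/strongly_measurable_adapted_part/strongly_measurable_leb01.
(* The conditional expectations are given for nonnegative times only, which covers almost every time
   for the measure on [0, 1]. *)
have vu : \forall t \ae leb01 R, adapted_part HL2C DF t = u t.
  apply: (@filterS _ _ FF _ _ _ (ae_leb01_itv R)) => t /andP[t0 _].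
  by rewrite /u (L2_cond_expE HL2C _ t0 (HE t t0)).
split; first split; first split.
- exact: ae_eq_strongly_measurable vu mv.
- apply: le_lt_trans DFoo; apply: le_trans (process_norm2_leb01 mDF).
  apply: ae_le_process_norm2; apply: filterS vu => t <-; exact: hnorm_of_fock_cutoff.
- apply: filterS2 (ae_leb01_itv R) vu => t /andP[t0 _] <-.
  apply/(L2_uptoE HL2C _ t0); rewrite /adapted_part of_fockK; exact: upto_space_cutoff.
by rewrite (ito_integral_adapted_part HF HF1 vu) addrC subrK.
Qed.
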